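(* Let $p>2$ be a prime and let $u \geq 1$ be an odd integer coprime to $p$. For each integer $k \geq 0$, consider the curves over $\overline{\mathbb{F}}_p$ $$\mathcal{F}_k : y^2 = x^{2^ku} + 1 \quad\text{and}\quad \mathcal{H}_k : y^2 = x(x^{2^ku} + 1).$$ Then (i) $\gamma(\mathcal{F}_0) = \gamma(\mathcal{H}_0)$; (ii) $\gamma(\mathcal{H}_{k-1}) = \gamma(\mathcal{F}_{k}) - \gamma(\mathcal{F}_{k-1})$ for $k \geq 1$; (iii) $\gamma(\mathcal{F}_{k}) = \gamma(\mathcal{F}_0) + \sum_{i=0}^{k-1} \gamma(\mathcal{H}_i)$ for $k \geq 1$; (iv) $\gamma(\mathcal{F}_1) = 2\gamma(\mathcal{F}_0)$.
   Context: A ''curve'' given by an affine equation over $\overline{\mathbb{F}}_p$ means the nonsingular, projective, irreducible curve whose function field is defined by that equation. The $p$-rank $\gamma(\mathcal{X})$ of a curve $\mathcal{X}$ with Jacobian $J$ is the integer such that $J[p](\overline{\mathbb{F}}_p)\cong(\mathbb{Z}/p\mathbb{Z})^{\gamma(\mathcal{X})}$; a curve of genus $0$ has $p$-rank $0$. *)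

(* Defs.v *)
From HB Require Import structures.
From mathcomp Require Import all_boot all_order all_algebra.
From mathcomp Require Import ring_quotient.
From mathcomp Require Import boolp classical_sets.
From mathcomp Require Import freeg.

Set Implicit Arguments.
Unset Strict Implicit.
Unset Printing Implicit Defensive.

Import GRing.Theory.
Local Open Scope classical_set_scope.
Local Open Scope ring_scope.

(* The function field of the affine plane curve E(x, y) = 0 over k, i.e. a
   fraction field of k[X, Y] / (E), where k[X, Y] is {poly {poly k}} with
   coordinates 'X and 'Y.  It determines the nonsingular projective model. *)
Record function_field (k : fieldType) (E : {poly {poly k}}) := FunctionField {
  ff_sort :> fieldType;
  ff_const : {rmorphism k -> ff_sort};
  ff_x : ff_sort;
  ff_y : ff_sort;
  ff_eval := fun G : {poly {poly k}} =>
    (map_poly (map_poly ff_const) G).[ff_x, ff_y];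
  ff_rel : forall G, ff_eval G = 0 <-> exists Q, G = Q * E;
  ff_gen : forall z, exists G H, ff_eval H != 0 /\ z = ff_eval G / ff_eval H
}.

Section Places.
Variables (k K : fieldType) (c : {rmorphism k -> K}).

(* The points of the nonsingular projective curve with function field K / k
   (k algebraically closed) are the normalized discrete valuations of K that
   are trivial on k.  The valuation of 0 is +oo; the value of place_val at 0
   is a dummy, fixed so that distinct places are distinct valuations. *)
Record place := Place {
  place_val :> K -> int;
  place_val0 : place_val 0 = 0;
  place_valM : forall f g, f != 0 -> g != 0 ->
    place_val (f * g) = place_val f + place_val g;
  place_valD : forall f g, f != 0 -> g != 0 -> f + g != 0 ->
    Num.min (place_val f) (place_val g) <= place_val (f + g);
  place_valC : forall a, a != 0 -> place_val (c a) = 0;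
  place_val_surj : forall n, exists2 f, f != 0 & place_val f = n
}.

HB.instance Definition _ := gen_eqMixin place.
HB.instance Definition _ := gen_choiceMixin place.

Definition divisor := {freeg place / int}.

Definition principal : {pred divisor} := fun D =>
  `[< exists2 f : K, f != 0 & forall P : place, coeff P D = P f >].

Lemma place_val1 (P : place) : P 1 = 0.
Proof.
have := place_valM P (oner_neq0 K) (oner_neq0 K).
by rewrite mulr1 => /eqP; rewrite -subr_eq subrr eq_sym => /eqP.
Qed.

Lemma principal_zmod_closed : zmod_closed principal.
Proof.
split; first by apply/asboolP; exists 1; rewrite ?oner_neq0 // => P;
  rewrite coeff0 place_val1.
move=> D1 D2 /asboolP[f f0 vf] /asboolP[g g0 vg]; apply/asboolP.
exists (f / g); first by rewrite mulf_neq0 ?invr_eq0.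
move=> P; rewrite coeffB vf vg.
have fg0 : f / g != 0 by rewrite mulf_neq0 ?invr_eq0.
have := place_valM P fg0 g0; rewrite divfK // => ->.
by rewrite addrK.
Qed.

HB.instance Definition _ :=
  GRing.isZmodClosed.Build divisor principal principal_zmod_closed.

Definition Pic := Quotient.quot principal.

HB.instance Definition _ := EqQuotient.on Pic.
HB.instance Definition _ := GRing.Zmodule.on Pic.

(* The group J(k) of k-rational points of the Jacobian (k algebraically
   closed): divisor classes of degree 0.  All places have degree 1. *)
Definition jacobian : set Pic :=
  [set d : Pic | exists2 D : divisor, deg D = 0 & d = (\pi_Pic D)%qT].

Definition has_prank (p g : nat) : Prop :=
  exists phi : {additive 'rV['F_p]_g -> Pic}, injective phi /\
    range phi = [set d : Pic | jacobian d /\ d *+ p = 0].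

(* The integer g such that J[p](k) is isomorphic to (Z/pZ)^g. *)
Definition prank_of (p : nat) : nat := xget 0%N [set g : nat | has_prank p g].

End Places.

Definition prank (p : nat) (k : fieldType) (E : {poly {poly k}})
  (X : function_field E) : nat := prank_of (ff_const X) p.

Definition eqF (k : fieldType) (u n : nat) : {poly {poly k}} :=
  'Y ^+ 2 - ('X ^+ (2 ^ n * u) + 1).

Definition eqH (k : fieldType) (u n : nat) : {poly {poly k}} :=
  'Y ^+ 2 - 'X * ('X ^+ (2 ^ n * u) + 1).

(* Main.v *)
Require Import Defs.
From HB Require Import structures.
From mathcomp Require Import all_boot all_order all_algebra.
From mathcomp Require Import ring_quotient polyXY fraction.
From mathcomp Require Import boolp classical_sets.
From mathcomp Require Import freeg zify ring.

(** A curve [y^2 = f(x^2)] has, besides its hyperelliptic involution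
    [iota : (x, y) |-> (x, -y)], the two involutions [sigma : (x, y) |-> (-x, y)] and
    [tau : (x, y) |-> (-x, -y)], with [sigma tau = iota].  The functions fixed by
    [sigma] are generated by [X = x^2] and [Y = y], where [Y^2 = f(X)]; those fixed by
    [tau] by [X = x^2] and [Y = x y], where [Y^2 = X f(X)].  For
    [f = x^(2^(n-1) u) + 1] the curve is F_n and its two quotients are F_(n-1) and
    H_(n-1).  Pulling back to F_n the push-forward of a divisor [D] gives
    [D + sigma D], respectively [D + tau D].  As [iota] acts as [-1] on divisor classes
    of degree 0, the sum of the two is equivalent to [2 D], while a class pulled back
    from one quotient goes to 0 when pushed to the other and pulled back again.  Since
    2 is invertible on [p]-torsion, the [p]-torsion of the Jacobian of F_n is the
    direct sum of those of F_(n-1) and H_(n-1) ([torsion_basis_decomposition],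
    resting on [conorm_norm_maps] and [involution_neg]).  Moreover F_0 and H_0 are
    isomorphic by [x |-> 1/x], because [u] is odd ([torsion_basis_inversion]).  The
    four statements are then additivity and induction on [n].

    The [p]-rank is the dimension of the [p]-torsion provided that the latter is
    finite, and the finiteness has to be proved ([torsion_rank_bound]).  By the
    above only models [y^2 = h(x)] with [h] squarefree of odd degree matter.
    If [D] is a torsion class, [p D] is the divisor of a function [f] whose
    logarithmic derivative [df / f] has no poles, as the residues of [df / f] are
    multiples of [p]; it is [S / (2 y) dx] with a polynomial [S] whose degree is
    bounded in terms of [h] ([log_derivative_ex]).  So more classes than the bound
    give logarithmic derivatives that are dependent over [k].  By Jacobson's formula
    logarithmic derivatives [w] satisfy [(d/dx)^(p-1) w = - w^p]
    ([log_derivative_Cartier]), and this turns a dependence over [k] into one over the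
    prime field ([Cartier_dependence]).  The corresponding product of the
    functions [f] has derivative 0, hence is a [p]-th power ([derivation_kernel]), and
    this is a relation between the classes.

    Places are handled through the quadratic extensions that occur: the rational
    function field below a hyperelliptic one, and the two quotients above.  There, the
    fibre over a place is a pair of conjugate places, with multiplicity 2 when they
    coincide ([conjugate_fibre_everywhere]). *)
Set Implicit Arguments.
Unset Strict Implicit.
Unset Printing Implicit Defensive.

Import Order.TTheory GRing.Theory Num.Theory.
Local Open Scope ring_scope.

(** * Linear arithmetic in large contexts *)

Ltac integral_type a :=
  let t := type of a in first [unify t int | unify t nat].

Ltac arithmetic T :=
  lazymatch T with
  | is_true (@Order.le _ _ ?a _) => integral_type a
  | is_true (@Order.lt _ _ ?a _) => integral_type a
  | is_true (~~ (@Order.le _ _ ?a _)) => integral_type a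
  | is_true (~~ (@Order.lt _ _ ?a _)) => integral_type a
  | is_true (leq _ _) => idtac
  | is_true (~~ leq _ _) => idtac
  | is_true (@eq_op _ ?a _) => integral_type a
  | is_true (~~ (@eq_op _ ?a _)) => integral_type a
  | @eq bool _ _ => idtac
  | is_true (odd _) => idtac
  | @eq ?t _ _ => first [unify t int | unify t nat]
  | ~ (@eq ?t _ _) => first [unify t int | unify t nat]
  end.

(** The arithmetic of a few integers is often needed among many algebraic hypotheses,
    whose preprocessing would dominate the cost of the decision procedure. *)
Ltac clear_non_arithmetic :=
  repeat match goal with
  | H : ?T |- _ => let s := type of T in unify s Prop;
      first [arithmetic T; fail 1 | clear H]
  end.

Ltac zlia := clear_non_arithmetic; lia.
Ltac znia := clear_non_arithmetic; nia.

(** * Torsion classes at the level of divisors *)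

Section TorsionBasis.
Variables (k K : fieldType) (c : {rmorphism k -> K}) (p : nat).

Definition torsion (D : divisor c) := deg D = 0 /\ principal (D *+ p).

Definition independent r (d : 'I_r -> divisor c) :=
  forall n : 'I_r -> nat,
    \sum_i d i *+ n i \in @principal _ _ c -> forall i, (p %| n i)%N.

(** A basis of the [p]-torsion classes over the prime field, kept as divisors:
    coefficients are natural numbers and equality holds up to principal divisors, so
    that maps of divisors can be applied before passing to classes. *)
Definition torsion_basis r (d : 'I_r -> divisor c) :=
  [/\ forall i, torsion (d i), independent d &
      forall D, torsion D ->
        exists n : 'I_r -> nat, D - \sum_i d i *+ n i \in @principal _ _ c].

Local Notation cl D := (\pi_(Pic c) D)%qT.

Lemma class_eq0 (D : divisor c) : (cl D == 0) = (D \in @principal _ _ c).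
Proof. by rewrite -[D in RHS]subr0 Quotient.idealrBE raddf0. Qed.

Lemma jacobian_torsion (d : Pic c) :
  (jacobian d /\ d *+ p = 0) <-> exists2 D, torsion D & d = cl D.
Proof.
split=> [[[D dD ->]]|[D [dD pD] ->]].
  move=> /eqP; rewrite -raddfMn class_eq0 => pD.
  by exists D.
split; first by exists D.
by apply/eqP; rewrite -raddfMn class_eq0.
Qed.

Hypothesis p_prime : prime p.

Lemma torsion_basis_has_prank r (d : 'I_r -> divisor c) :
  torsion_basis d -> has_prank c p r.
Proof.
move=> [dT dI dS].
have cl0 i : cl (d i) *+ p = 0.
  by apply/eqP; rewrite -raddfMn class_eq0; case: (dT i).
have clmod i n : cl (d i) *+ (n %% p) = cl (d i) *+ n.
  by rewrite [in RHS](divn_eq n p) mulrnDr mulnC mulrnA cl0 mul0rn add0r.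
have Fpmod : (Zp_trunc (pdiv p)).+2 = p by exact: Fp_cast.
have Fpadd (a b : 'F_p) : ((a + b)%R : nat) = (a + b)%N %[mod p].
  by rewrite /= [X in (_ %% X %% _)%N]Fpmod modn_mod.
pose phi (v : 'rV['F_p]_r) : Pic c := \sum_i cl (d i) *+ (v ord0 i : nat).
have phiD : zmod_morphism phi.
  move=> v w; rewrite /phi -sumrB; apply: eq_bigr => i _; rewrite !mxE.
  apply/eqP; rewrite eq_sym subr_eq -mulrnDr; apply/eqP.
  rewrite -[RHS]clmod -[LHS]clmod; congr (_ *+ _).
  have : v ord0 i = (v ord0 i - w ord0 i) + w ord0 i by rewrite subrK.
  by move=> /(congr1 (@nat_of_ord _)) ->; rewrite Fpadd.
pose phiM := GRing.isZmodMorphism.Build _ _ phi phiD.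
pose Phi : {additive 'rV['F_p]_r -> Pic c} := HB.pack phi phiM.
have phiE n : Phi n = cl (\sum_i d i *+ (n ord0 i : nat)).
  by rewrite raddf_sum; apply: eq_bigr => i _; rewrite /= raddfMn.
exists Phi; split.
  apply: raddf_inj => v /eqP; rewrite phiE class_eq0 => /dI dv.
  apply/rowP=> i; apply: val_inj; rewrite mxE /=.
  have := dv i; rewrite /dvdn modn_small; first by move/eqP.
  by rewrite -[X in (_ < X)%N]Fpmod ltn_ord.
apply/seteqP; split=> z /=.
  move=> [v _ <-]; apply/jacobian_torsion.
  exists (\sum_i d i *+ (v ord0 i : nat)); last exact: phiE.
  split.
    rewrite raddf_sum /= big1 // => i _.
    by rewrite raddfMn /= (proj1 (dT i)) mul0rn.
  rewrite -sumrMnl; apply: rpred_sum => i _; rewrite -mulrnA mulnC mulrnA.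
  by apply: rpredMn; case: (dT i).
move=> /jacobian_torsion[D DT ->]; have [n nD] := dS D DT.
exists (\row_i (n i)%:R) => //.
apply: etrans (phiE _) _.
have -> : cl D = cl (\sum_i d i *+ n i).
  by apply/eqP; rewrite -Quotient.idealrBE.
rewrite !raddf_sum /=; apply: eq_bigr => i _; rewrite !raddfMn mxE /=.
by rewrite (val_Fp_nat p_prime) clmod.
Qed.

(** Both vector spaces have the same finite image, and their cardinals are powers
    of [p]. *)
Lemma has_prank_inj g1 g2 : has_prank c p g1 -> has_prank c p g2 -> g1 = g2.
Proof.
have le g g' : has_prank c p g -> has_prank c p g' -> (g <= g')%N.
  move=> [f [f_inj fE]] [f' [f'_inj f'E]].
  have /choice[h hE] v : exists w, f' w = f v.
    have : range f (f v) by exists v.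
    by rewrite fE -f'E => -[w _ <-]; exists w.
  have h_inj : injective h.
    by move=> v w hvw; apply: f_inj; rewrite -!hE hvw.
  have := leq_card h h_inj; rewrite !card_mx !card_Fp // !mul1n.
  by rewrite leq_exp2l // prime_gt1.
by move=> h1 h2; apply/eqP; rewrite eqn_leq !le.
Qed.

Lemma torsion_basis_prank r (d : 'I_r -> divisor c) :
  torsion_basis d -> prank_of c p = r.
Proof.
move=> /torsion_basis_has_prank hr.
apply: (has_prank_inj _ hr).
exact: (@xgetI _ 0%N [set g | has_prank c p g]%classic r hr).
Qed.
End TorsionBasis.

Section TorsionClosure.
Variables (k K : fieldType) (c : {rmorphism k -> K}) (p : nat).

Lemma torsionD (D E : divisor c) : torsion p D -> torsion p E -> torsion p (D + E).
Proof.
move=> [dD pD] [dE pE]; split; first by rewrite raddfD /= dD dE addr0.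
by rewrite mulrnDl; apply: (rpredD pD pE).
Qed.

Lemma torsionMn (D : divisor c) n : torsion p D -> torsion p (D *+ n).
Proof.
move=> [dD pD]; split; first by rewrite raddfMn /= dD mul0rn.
by rewrite -mulrnA mulnC mulrnA; apply: (@rpredMn _ (@principal _ _ c)).
Qed.

Lemma torsion_sum r (d : 'I_r -> divisor c) n :
  (forall i, torsion p (d i)) -> torsion p (\sum_i d i *+ n i).
Proof.
move=> dT; apply: (big_ind (torsion p)); first last.
- by move=> i _; apply: torsionMn.
- by move=> *; apply: torsionD.
split; first by rewrite raddf0.
by rewrite mul0rn; apply: (rpred0 (@principal _ _ c)).
Qed.

Hypothesis p_prime : prime p.

(** A maximal independent family is a basis: adjoining a torsion class outside the span
    keeps independence, since a coefficient of that class prime to [p] can be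
    inverted modulo [p]. *)
Lemma bounded_torsion_basis m :
  (forall r (d : 'I_r -> divisor c),
    (forall i, torsion p (d i)) -> independent p d -> (r <= m)%N) ->
  exists r (d : 'I_r -> divisor c), torsion_basis p d.
Proof.
move=> bound.
pose good r := `[< exists2 d : 'I_r -> divisor c,
  forall i, torsion p (d i) & independent p d >].
have good0 : exists r, good r.
  by exists 0%N; apply/asboolP; exists (fun _ => 0) => [[]|n _ []].
have goodm r : good r -> (r <= m)%N.
  by move=> /asboolP[d dT dI]; apply: bound dI.
case: (ex_maxnP good0 goodm) => r /asboolP[d dT dI] rmax.
exists r, d; split=> // D DT; apply: contrapT => Dn.
suff /rmax : good r.+1 by rewrite ltnn.
apply/asboolP.
exists (fun i => if unlift ord_max i is Some j then d j else D).
  by move=> i; case: unlift.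
move=> n; rewrite big_ord_recr /= unlift_none.
under eq_bigr => i _.
  have -> : widen_ord (leqnSn r) i = fintype.lift ord_max i.
    by apply: val_inj; rewrite /= /bump leqNgt ltn_ord.
  rewrite liftK; over.
move=> pr.
have pn : (p %| n ord_max)%N.
  apply: contrapT => /negP pNn; apply: Dn.
  have n_gt0 : (0 < n ord_max)%N by case: (n ord_max) pNn; rewrite ?dvdn0.
  case: (egcdnP p n_gt0) => u v uv _.
  have cop : gcdn (n ord_max) p = 1%N.
    by rewrite gcdnC; apply/eqP; rewrite -/(coprime _ _) prime_coprime.
  rewrite cop in uv.
  (* Modulo [p] this is [- u n_i], where [u] inverts the coefficient of [D]. *)
  exists (fun i => n (fintype.lift ord_max i) * u * (p - 1))%N.
  have S : forall i, principal (d i *+ p) by move=> i; case: (dT i).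
  have e : D - \sum_i d i *+ (n (fintype.lift ord_max i) * u * (p - 1))%N =
    (\sum_i d i *+ n (fintype.lift ord_max i) + D *+ n ord_max) *+ u
    - (\sum_i (d i *+ p) *+ (n (fintype.lift ord_max i) * u)%N) - (D *+ p) *+ v.
    have -> : \sum_i d i *+ (n (fintype.lift ord_max i) * u * (p - 1))%N =
      \sum_i (d i *+ p) *+ (n (fintype.lift ord_max i) * u)%N -
      (\sum_i d i *+ n (fintype.lift ord_max i)) *+ u.
      rewrite -sumrMnl -sumrB; apply: eq_bigr => i _.
      rewrite -!mulrnA -mulrnBr; last by have := prime_gt0 p_prime; nia.
      by congr (_ *+ _); have := prime_gt0 p_prime; nia.
    rewrite [in RHS]mulrnDl.
    have -> : D *+ n ord_max *+ u = D *+ p *+ v + D.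
      by rewrite -!mulrnA mulnC uv mulrnDr mulr1n mulnC.
    rewrite opprB [D *+ p *+ v + D]addrC addrA -[RHS]addrA -opprD.
    by rewrite [X in _ = _ - X]addrC opprD !addrA addrK [D + _]addrC.
  rewrite e; apply: rpredB; last by apply: rpredMn; case: DT.
  apply: rpredB; first exact: rpredMn.
  by apply: rpred_sum => i _; apply: rpredMn; case: (dT i).
have := pr; rewrite rpredDr => [/dI dn|]; last first.
  case/dvdnP: pn => q ->; rewrite mulnC mulrnA; apply: rpredMn.
  by case: DT.
by move=> i; case: (unliftP ord_max i) => [j|] ->.
Qed.
End TorsionClosure.

Section TorsionTransfer.
Variables (k A B : fieldType) (cA : {rmorphism k -> A}) (cB : {rmorphism k -> B}).
Variable p : nat.

(** The property that makes a map of divisors act on the divisor classes of degree 0. *)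
Definition class_map (f : divisor cB -> divisor cA) :=
  (forall D, deg D = 0 -> deg (f D) = 0) /\
  (forall D, principal D -> principal (f D)).

Lemma class_map_torsion (f : {additive divisor cB -> divisor cA}) D :
  class_map f -> torsion p D -> torsion p (f D).
Proof. by move=> [fd fp] [/fd dD /fp pD]; split=> //; rewrite -raddfMn. Qed.

Lemma class_map_comb (f : {additive divisor cB -> divisor cA}) r
    (d : 'I_r -> divisor cB) n :
  f (\sum_i d i *+ n i) = \sum_i f (d i) *+ n i.
Proof. by rewrite raddf_sum; apply: eq_bigr => i _; rewrite raddfMn. Qed.
End TorsionTransfer.

Lemma torsion_basis_iso (k A B : fieldType) (cA : {rmorphism k -> A})
    (cB : {rmorphism k -> B}) (p : nat)
    (f : {additive divisor cB -> divisor cA})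
    (g : {additive divisor cA -> divisor cB}) r (d : 'I_r -> divisor cB) :
  class_map f -> class_map g -> cancel f g -> cancel g f ->
  torsion_basis p d -> torsion_basis p (f \o d).
Proof.
move=> fc gc fK gK [dT dI dS]; split=> [i|n|D DT].
- exact: class_map_torsion.
- by rewrite -class_map_comb => /(proj2 gc); rewrite fK => /dI.
- have [n nD] := dS _ (class_map_torsion gc DT).
  exists n; rewrite -class_map_comb -[D]gK -raddfB /=.
  exact: (proj2 fc).
Qed.

(** If [A] maps to and from [B] and [C] in such a way that each round trip from below
    is multiplication by 2, that the cross terms vanish on classes, and that the two
    round trips from above add up to multiplication by 2, then the torsion classes of
    [A] are the direct sum of those of [B] and [C], as [p] is odd. *)
Section TorsionSum.
Variables (k A B C : fieldType) (cA : {rmorphism k -> A}).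
Variables (cB : {rmorphism k -> B}) (cC : {rmorphism k -> C}) (p : nat).
Hypotheses (p_prime : prime p) (p_gt2 : (2 < p)%N).
Variables (fB : {additive divisor cB -> divisor cA})
  (gB : {additive divisor cA -> divisor cB})
  (fC : {additive divisor cC -> divisor cA})
  (gC : {additive divisor cA -> divisor cC}).
Hypotheses (fBc : class_map fB) (gBc : class_map gB)
  (fCc : class_map fC) (gCc : class_map gC).
Hypothesis gfB : forall D, gB (fB D) = D *+ 2.
Hypothesis gfC : forall D, gC (fC D) = D *+ 2.
Hypothesis fgBC : forall D, torsion p D -> principal (fB (gB (fC D))).
Hypothesis fgCB : forall D, torsion p D -> principal (fC (gC (fB D))).
Hypothesis fgD : forall D, torsion p D ->
  principal (D *+ 2 - (fB (gB D) + fC (gC D))).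

Lemma torsion_basis_sum b m (dB : 'I_b -> divisor cB) (dC : 'I_m -> divisor cC) :
  torsion_basis p dB -> torsion_basis p dC ->
  torsion_basis p (fun i : 'I_(b + m) =>
     match split i with inl j => fB (dB j) | inr j => fC (dC j) end).
Proof.
move=> [BT BI BS] [CT CI CS].
set d := fun _ => _.
have dE n : \sum_i d i *+ n i = fB (\sum_i dB i *+ n (lshift m i)) +
     fC (\sum_i dC i *+ n (rshift b i)).
  rewrite big_split_ord !class_map_comb /d; congr (_ + _); apply: eq_bigr => i _.
    by rewrite (unsplitK (inl _ i)).
  by rewrite (unsplitK (inr _ i)).
have copp : coprime p 4.
  by rewrite (coprimeXr 2 (_ : coprime p 2)) // prime_coprime // dvdn_prime2 // gtn_eqF.
split.
- by move=> i; rewrite /d; case: split => j; apply: class_map_torsion.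
- move=> n; rewrite dE => pr.
  set DB := \sum_i dB i *+ _ in pr; set DC := \sum_i dC i *+ _ in pr.
  have TB : torsion p DB by apply: torsion_sum.
  have TC : torsion p DC by apply: torsion_sum.
  (* Projecting to one factor and back kills the other one and multiplies by 4,
     which is prime to [p]. *)
  have hB : DB *+ 4 \in @principal _ _ cB.
    have : DB *+ 4 + gB (fC DC) *+ 2 \in @principal _ _ cB.
      have := proj2 gBc _ (proj2 fBc _ (proj2 gBc _ pr)).
      by rewrite !raddfD /= !gfB -mulrnA.
    by rewrite rpredDr // -gfB; apply: (proj2 gBc); apply: fgBC.
  have hC : DC *+ 4 \in @principal _ _ cC.
    have : gC (fB DB) *+ 2 + DC *+ 4 \in @principal _ _ cC.
      have := proj2 gCc _ (proj2 fCc _ (proj2 gCc _ pr)).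
      by rewrite !raddfD /= !gfC -mulrnA.
    by rewrite rpredDl // -gfC; apply: (proj2 gCc); apply: fgCB.
  move=> i; rewrite -(splitK i); case: (split i) => j /=.
    move: hB; rewrite /DB -sumrMnl.
    under eq_bigr => l _ do rewrite -mulrnA.
    by move=> /BI /(_ j); rewrite Gauss_dvdl.
  move: hC; rewrite /DC -sumrMnl.
  under eq_bigr => l _ do rewrite -mulrnA.
  by move=> /CI /(_ j); rewrite Gauss_dvdl.
move=> D DT.
(* [q] inverts 2 modulo [p], so that [D] is the sum of its projections. *)
pose q := (p.+1)./2.
have q2 : (2 * q = p + 1)%N.
  have : odd p by case: (even_prime p_prime) p_gt2 => [->|].
  by rewrite /q; lia.
have [nB nBE] := BS _ (class_map_torsion gBc (torsionMn q DT)).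
have [nC nCE] := CS _ (class_map_torsion gCc (torsionMn q DT)).
exists (fun i => match split i with inl j => nB j | inr j => nC j end).
rewrite dE.
have -> : \sum_i dB i *+ match split (lshift m i) with
   inl j => nB j | inr j => nC j end = \sum_i dB i *+ nB i.
  by apply: eq_bigr => i _; rewrite (unsplitK (inl _ i)).
have -> : \sum_i dC i *+ match split (rshift b i) with
   inl j => nB j | inr j => nC j end = \sum_i dC i *+ nC i.
  by apply: eq_bigr => i _; rewrite (unsplitK (inr _ i)).
have h1 : fB (gB (D *+ q)) - fB (\sum_i dB i *+ nB i) \in @principal _ _ cA.
  by rewrite -raddfB; apply: (proj2 fBc).
have h2 : fC (gC (D *+ q)) - fC (\sum_i dC i *+ nC i) \in @principal _ _ cA.
  by rewrite -raddfB; apply: (proj2 fCc).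
have h3 : D *+ q *+ 2 - (fB (gB (D *+ q)) + fC (gC (D *+ q)))
    \in @principal _ _ cA by have := fgD (torsionMn q DT).
have h4 : D *+ p \in @principal _ _ cA by case: DT.
have e : D *+ q *+ 2 = D *+ p + D.
  by rewrite -mulrnA mulnC q2 mulrnDr mulr1n.
have zE (V : zmodType) (X Y U W P D1 D2 : V) : D2 = P + D1 ->
    X - U + (Y - W) + (D2 - (X + Y)) - P = D1 - (U + W).
  move=> ->; rewrite [X - U + _]addrACA -opprD [X in X - _]addrC addrA subrK.
  by rewrite (addrAC _ _ (- P)) [P + D1]addrC addrK.
rewrite -(zE _ (fB (gB (D *+ q))) (fC (gC (D *+ q))) _ _ _ _ _ e).
by apply: (rpredB _ h4); apply: (rpredD _ h3); apply: (rpredD h1 h2).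
Qed.
End TorsionSum.

(** * Valuations *)

Section Valuation.
Variables (k K : fieldType) (c : {rmorphism k -> K}).
Implicit Types (P Q : place c) (z : K).

Lemma place_ext P Q : (forall z, z != 0 -> P z = Q z) -> P = Q.
Proof.
case: P Q => [v v0 vM vD vC vS] [w w0 wM wD wC wS] /= e.
have ew : v = w.
  by apply/funext => z; case: (eqVneq z 0) => [->|/e//]; rewrite v0 w0.
by subst w; congr Place; exact: Prop_irrelevance.
Qed.

Lemma valM P y z : y != 0 -> z != 0 -> P (y * z) = P y + P z.
Proof. exact: place_valM. Qed.

Lemma valV P z : P z^-1 = - P z.
Proof.
have [->|z0] := eqVneq z 0; first by rewrite invr0 place_val0.
have := valM P z0 (invr_neq0 z0); rewrite divff // place_val1; lia.
Qed.

Lemma valX P z n : P (z ^+ n) = P z *+ n.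
Proof.
elim: n => [|n IH]; first by rewrite expr0 place_val1.
have [->|z0] := eqVneq z 0; first by rewrite expr0n !place_val0 mul0rn.
by rewrite exprS valM ?expf_neq0 // IH mulrS.
Qed.

Lemma valN P z : P (- z) = P z.
Proof.
have [->|z0] := eqVneq z 0; first by rewrite oppr0.
have N1 : (-1 : K) != 0 by rewrite oppr_eq0 oner_eq0.
have := valX P (-1) 2; rewrite sqrrN expr1n place_val1 => e.
rewrite -mulN1r valM //; lia.
Qed.

(** The value at 0 is a dummy, whereas the inequality is to hold there: 0 vanishes to
    every order. *)
Definition vge P n z := (z == 0) || (n <= P z).

Lemma vge0 P n : vge P n 0. Proof. by rewrite /vge eqxx. Qed.

Lemma vgeE P n z : z != 0 -> vge P n z = (n <= P z).
Proof. by rewrite /vge => /negbTE ->. Qed.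

Lemma vge_val P z : vge P (P z) z.
Proof. by rewrite /vge lexx orbT. Qed.

Lemma vgeC P a : vge P 0 (c a).
Proof.
have [->|a0] := eqVneq a 0; first by rewrite rmorph0 vge0.
by rewrite /vge place_valC // lexx orbT.
Qed.

Lemma vge_le P n m z : n <= m -> vge P m z -> vge P n z.
Proof. by move=> nm /orP[/eqP ->|h]; rewrite /vge ?eqxx // (le_trans nm h) orbT. Qed.

Lemma vgeD P n y z : vge P n y -> vge P n z -> vge P n (y + z).
Proof.
have [->|y0] := eqVneq y 0; first by rewrite add0r.
have [->|z0] := eqVneq z 0; first by rewrite addr0.
rewrite /vge (negbTE y0) (negbTE z0) /= => hy hz.
case: (eqVneq (y + z) 0) => //= yz0; apply: le_trans (place_valD P y0 z0 yz0).
by rewrite le_min hy hz.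
Qed.

Lemma vgeN P n z : vge P n (- z) = vge P n z.
Proof. by rewrite /vge oppr_eq0 valN. Qed.

Lemma vgeB P n y z : vge P n y -> vge P n z -> vge P n (y - z).
Proof. by move=> hy hz; apply: vgeD; rewrite ?vgeN. Qed.

Lemma vgeM P n m y z : vge P n y -> vge P m z -> vge P (n + m) (y * z).
Proof.
have [->|y0] := eqVneq y 0; first by move=> _ _; rewrite mul0r vge0.
have [->|z0] := eqVneq z 0; first by move=> _ _; rewrite mulr0 vge0.
by rewrite !vgeE ?mulf_neq0 // valM //; lia.
Qed.

Lemma vgeM0 P m y z : vge P 0 y -> vge P m z -> vge P m (y * z).
Proof. by move=> hy /(vgeM hy); rewrite add0r. Qed.

(** Equality in the ultrametric inequality when one summand dominates. *)
Lemma val_addr P y z : y != 0 -> vge P (P y + 1) z ->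
  y + z != 0 /\ P (y + z) = P y.
Proof.
move=> y0; have [->|z0] := eqVneq z 0; first by move=> _; rewrite addr0; split.
rewrite vgeE // => lt.
have yz0 : y + z != 0.
  by apply/eqP => /eqP; rewrite addr_eq0 => /eqP e; move: lt; rewrite e valN; lia.
split=> //.
have h1 := place_valD P y0 z0 yz0; rewrite minEle in h1.
have nz0 : - z != 0 by rewrite oppr_eq0.
have := place_valD P yz0 nz0; rewrite addrK => /(_ y0); rewrite valN minEle.
by move: h1; case: ifP; case: ifP; lia.
Qed.

Lemma uniformizer P : exists2 t, t != 0 & P t = 1.
Proof. exact: place_val_surj. Qed.

End Valuation.

(** A place is determined by a uniformizer [t] and by the functions that are regular
    and nonzero at the point: every nonzero function is then a power of [t] times a
    quotient of two such functions.  [R] is a ring of functions regular at the point,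
    not necessarily its whole local ring, and [U] the elements of [R] that do not
    vanish there, so that [R] may be semilocal. *)
Section PlaceOfUnits.
Variables (k K : fieldType) (c : {rmorphism k -> K}).
Variables (R U : K -> Prop) (t : K).
Hypotheses (t0 : t != 0) (Rt : R t).
Hypotheses (RD : forall a b, R a -> R b -> R (a + b))
  (RM : forall a b, R a -> R b -> R (a * b)).
Hypotheses (UR : forall a, U a -> R a) (UM : forall a b, U a -> U b -> U (a * b))
  (UC : forall a, a != 0 -> U (c a)) (U0 : ~ U 0).
Hypothesis Ut : forall a, R a -> ~ U (t * a).
Hypothesis tU : forall z, z != 0 ->
  exists (n : int) a b, [/\ U a, U b & z = t ^ n * (a / b)].

Let Un0 a : U a -> a != 0.
Proof. by move=> Ua; apply/eqP => a0; rewrite a0 in Ua. Qed.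

Let RX n : R (t ^+ n.+1).
Proof. by elim: n => // n IH; rewrite exprS; apply: RM. Qed.

Let U1 : U 1. Proof. by rewrite -(rmorph1 c); apply: UC; rewrite oner_neq0. Qed.

Let exp_le0 (n : int) a b : R a -> U b -> b = t ^ n * a -> n <= 0.
Proof.
case: n => // -[|n] // Ra Ub e; suff: False by [].
have : U (t * (t ^+ n * a)).
  by rewrite mulrA -exprS -[t ^+ n.+1]/(t ^ Posz n.+1) -e.
apply: Ut; case: n {e} => [|n]; first by rewrite mul1r.
exact: RM.
Qed.

(* The exponent of [t] is the same in all presentations, hence defines a valuation. *)
Let exp_uniq (n m : int) a b a' b' : U a -> U b -> U a' -> U b' ->
  t ^ n * (a / b) = t ^ m * (a' / b') -> n = m.
Proof.
move=> Ua Ub Ua' Ub' e.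
have e1 : a * b' = t ^ (m - n) * (a' * b).
  rewrite expfzDr // -invr_expz; apply: (mulfI (expfz_neq0 n t0)).
  have -> : t ^ n * (a * b') = t ^ n * (a / b) * (b * b').
    by field; apply: Un0.
  by rewrite e; field; rewrite (Un0 Ub') expfz_neq0.
have e2 : a' * b = t ^ (n - m) * (a * b').
  by rewrite e1 mulrA -expfzDr // addrA subrK subrr expr0z mul1r.
have := exp_le0 (UR (UM Ua' Ub)) (UM Ua Ub') e1.
have := exp_le0 (UR (UM Ua Ub')) (UM Ua' Ub) e2; lia.
Qed.

Let ord_ex z : exists n : int, (z = 0 -> n = 0) /\ (z != 0 ->
  exists a b, [/\ U a, U b & z = t ^ n * (a / b)]).
Proof.
have [->|/tU[n [a [b h]]]] := eqVneq z 0; first by exists 0.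
exists n; split=> [z0|_]; last by exists a, b.
case: h => /Un0 a0 /Un0 b0 e.
by move/eqP: z0; rewrite e !mulf_eq0 invr_eq0 (negbTE a0) (negbTE b0) expfz_eq0 (negbTE t0) andbF.
Qed.

Let ord z := projT1 (cid (ord_ex z)).

Let ord0 : ord 0 = 0.
Proof. by rewrite /ord; case: cid => n [/= h _]; apply: h. Qed.

Let ordP z : z != 0 -> exists a b, [/\ U a, U b & z = t ^ (ord z) * (a / b)].
Proof. by rewrite /ord; case: cid => n [/= _ h]; apply: h. Qed.

Let ord_eq n a b : U a -> U b -> ord (t ^ n * (a / b)) = n.
Proof.
move=> Ua Ub.
have z0 : t ^ n * (a / b) != 0.
  by rewrite !mulf_neq0 ?expfz_neq0 ?invr_neq0 // Un0.
by have [a' [b' [Ua' Ub' /esym]]] := ordP z0; apply: exp_uniq.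
Qed.

Let ordM f g : f != 0 -> g != 0 -> ord (f * g) = ord f + ord g.
Proof.
move=> /ordP[a [b [Ua Ub ef]]] /ordP[a' [b' [Ua' Ub' eg]]].
rewrite [in LHS]ef [in LHS]eg -(ord_eq (ord f + ord g) (UM Ua Ua') (UM Ub Ub')).
by congr ord; rewrite expfzDr //; field; rewrite (Un0 Ub) (Un0 Ub').
Qed.

Let ordD f g : f != 0 -> g != 0 -> f + g != 0 ->
  Num.min (ord f) (ord g) <= ord (f + g).
Proof.
wlog le : f g / ord f <= ord g => [h f0 g0 fg0|].
  case: (leP (ord f) (ord g)) => le.
    by have := h _ _ le f0 g0 fg0; rewrite min_l.
  by have := h _ _ (ltW le) g0 f0; rewrite addrC min_l ?(ltW le) //; apply.
move=> f0 g0 fg0; rewrite min_l //.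
have [a [b [Ua Ub ef]]] := ordP f0; have [a' [b' [Ua' Ub' eg]]] := ordP g0.
have [a2 [b2 [Ua2 Ub2 es]]] := ordP fg0.
set s := a * b' + t ^ (ord g - ord f) * (a' * b).
have Rs : R s.
  apply: RD; first exact: UR (UM Ua Ub').
  have : 0 <= ord g - ord f by rewrite subr_ge0.
  case: (ord g - ord f) => // -[|n] _; first by rewrite expr0z mul1r; apply: UR; apply: UM.
  by apply: RM; [exact: RX | apply: UR; apply: UM].
rewrite -subr_le0; apply: (exp_le0 (a := s * b2) (b := a2 * (b * b'))).
- by apply: RM => //; apply: UR.
- by apply: UM => //; apply: UM.
rewrite /s !expfzDr // -!invr_expz mulrDl mulrDr.
have tn0 n : t ^ n != 0 by apply: expfz_neq0.
apply: (mulfI (tn0 (ord (f + g)))).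
have -> : t ^ ord (f + g) * (a2 * (b * b')) =
   t ^ ord (f + g) * (a2 / b2) * (b2 * (b * b')) by field; rewrite (Un0 Ub2).
rewrite -es [in LHS]ef [in LHS]eg; field.
by rewrite !tn0 (Un0 Ub) (Un0 Ub').
Qed.

Let ordC a : a != 0 -> ord (c a) = 0.
Proof.
move=> a0; rewrite -(ord_eq 0 (UC a0) U1); congr ord.
by rewrite expr0z mul1r divr1.
Qed.

Let ord_surj n : exists2 f, f != 0 & ord f = n.
Proof.
exists (t ^ n); first exact: expfz_neq0.
by rewrite -[in RHS](ord_eq n U1 U1) divff ?oner_neq0 // mulr1.
Qed.

Lemma place_of_units : exists P : place c,
  [/\ forall a, U a -> P a = 0, P t = 1 &
      forall P' : place c, (forall a, U a -> P' a = 0) -> 0 <= P' t -> P' = P].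
Proof.
exists (Place ord0 ordM ordD ordC ord_surj); split=> /=.
- move=> a Ua; rewrite -(ord_eq 0 Ua U1); congr ord.
  by rewrite expr0z mul1r divr1.
- rewrite -[in RHS](ord_eq 1 U1 U1); congr ord.
  by rewrite expr1z divff ?oner_neq0 // mulr1.
move=> P' P'U P't.
(* A place for which [U] has value 0 is a multiple of [ord]; normalization makes the
   factor 1. *)
have vE z : z != 0 -> P' z = P' t * ord z.
  move=> /ordP[a [b [Ua Ub]]]; set n := ord z => ->.
  have tn0 : t ^ n != 0 by apply: expfz_neq0.
  have a0 := Un0 Ua; have b0 := Un0 Ub.
  rewrite !valM ?mulf_neq0 ?invr_neq0 // valV.
  rewrite (P'U _ Ua) (P'U _ Ub) subr0; case: n {tn0} => m; first by rewrite valX; lia.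
  by rewrite NegzE -invr_expz valV valX; lia.
have t1 : P' t = 1.
  have [z z0 z1] := uniformizer P'.
  move: (vE _ z0); rewrite z1; move: (P' t) (ord z) P't => a b a0 /esym ab.
  have b0 : 0 < b by nia.
  by nia.
by apply: place_ext => z z0; rewrite vE // t1 mul1r.
Qed.
End PlaceOfUnits.

(** * Maps of divisors *)

Section DivisorMap.
Variables (k A : fieldType) (cA : {rmorphism k -> A}).

Lemma divisor_ext (V : zmodType) (f g : {additive divisor cA -> V}) :
  (forall P, f << P >> = g << P >>) -> f =1 g.
Proof.
move=> e; elim/freeg_ind_dom0 => [|n P D _ _ IH]; first by rewrite !raddf0.
rewrite !raddfD /= {}IH; congr (_ + _).
have -> : << n *g P >> = << P >> *~ n :> divisor cA by rewrite freegU_mulz intz.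
by rewrite !raddfMz /= e.
Qed.

Variables (B : fieldType) (cB : {rmorphism k -> B}).
Variable m : place cA -> divisor cB.

Definition divisor_map (D : divisor cA) : divisor cB := fglift m D.

Lemma divisor_map_is_zmod_morphism : zmod_morphism divisor_map.
Proof. exact: lift_is_additive. Qed.

HB.instance Definition _ :=
  GRing.isZmodMorphism.Build (divisor cA) (divisor cB) divisor_map divisor_map_is_zmod_morphism.

Lemma divisor_mapU P : divisor_map << P >> = m P.
Proof. by rewrite /divisor_map liftU scale1r. Qed.
End DivisorMap.

Section DegMap.
Variables (k A B : fieldType) (cA : {rmorphism k -> A}) (cB : {rmorphism k -> B}).

Lemma deg_divisor_map (m : place cA -> divisor cB) e D :
  (forall P, deg (m P) = e) -> deg (divisor_map m D) = deg D * e.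
Proof.
move=> me; elim/freeg_ind_dom0: D => [|n P D _ _ IH].
  by rewrite raddf0 !deg0 mul0r.
rewrite raddfD /= !degD IH degU mulrDl; congr (_ + _).
have -> : << n *g P >> = << P >> *~ n :> divisor cA by rewrite freegU_mulz intz.
by rewrite raddfMz /= divisor_mapU raddfMz /= me mulrzz mulrC.
Qed.
End DegMap.

Section IsoPlace.
Variables (k A B : fieldType) (cA : {rmorphism k -> A}) (cB : {rmorphism k -> B}).
Variables (f : {rmorphism A -> B}) (g : {rmorphism B -> A}).
Hypotheses (fc : forall a, f (cA a) = cB a) (gK : cancel g f).

Section Pull.
Variable P : place cB.
Let v z := P (f z).
Let v0 : v 0 = 0. Proof. by rewrite /v rmorph0 place_val0. Qed.
Let vM y z : y != 0 -> z != 0 -> v (y * z) = v y + v z.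
Proof. by move=> *; rewrite /v rmorphM valM ?fmorph_eq0. Qed.
Let vD y z : y != 0 -> z != 0 -> y + z != 0 -> Num.min (v y) (v z) <= v (y + z).
Proof. by move=> *; rewrite /v rmorphD place_valD -?rmorphD ?fmorph_eq0. Qed.
Let vC a : a != 0 -> v (cA a) = 0.
Proof. by rewrite /v fc => /place_valC ->. Qed.
Let vS n : exists2 z, z != 0 & v z = n.
Proof.
have [z z0 zn] := place_val_surj P n; exists (g z); rewrite ?fmorph_eq0 //.
by rewrite /v gK.
Qed.
(** The right inverse [g] of [f] makes all values occur. *)
Definition pull_place := Place v0 vM vD vC vS.
End Pull.
End IsoPlace.

Section Iso.
Variables (k A B : fieldType) (cA : {rmorphism k -> A}) (cB : {rmorphism k -> B}).
Variables (f : {rmorphism A -> B}) (g : {rmorphism B -> A}).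
Hypotheses (fc : forall a, f (cA a) = cB a) (gc : forall a, g (cB a) = cA a).
Hypotheses (gK : cancel g f) (fK : cancel f g).

Definition iso_div := divisor_map (fun P => << pull_place gc fK P >> : divisor cB).

Lemma coeff_iso_div Q D : coeff Q (iso_div D) = coeff (pull_place fc gK Q) D.
Proof.
have := @divisor_ext _ _ cA _ (coeff Q \o iso_div) (coeff (pull_place fc gK Q)).
apply=> P /=; rewrite /iso_div divisor_mapU !coeffU !mul1r; congr (_%:R).
congr nat_of_bool; apply/eqP/eqP => [<-|->]; apply: place_ext => z _ /=.
  by rewrite fK.
by rewrite gK.
Qed.

Lemma iso_div_class_map : class_map iso_div.
Proof.
split=> D.
  by move=> dD; rewrite (deg_divisor_map (e := 1)) ?dD // => P; rewrite degU.
move=> /asboolP[z z0 zD]; apply/asboolP; exists (f z); rewrite ?fmorph_eq0 //.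
by move=> Q; rewrite coeff_iso_div zD.
Qed.
End Iso.

Section IsoCancel.
Variables (k A B : fieldType) (cA : {rmorphism k -> A}) (cB : {rmorphism k -> B}).
Variables (f : {rmorphism A -> B}) (g : {rmorphism B -> A}).
Hypotheses (fc : forall a, f (cA a) = cB a) (gc : forall a, g (cB a) = cA a).
Hypotheses (gK : cancel g f) (fK : cancel f g).

Lemma iso_divK : cancel (iso_div gc fK) (iso_div fc gK).
Proof.
move=> D.
apply: (divisor_ext (f := iso_div fc gK \o iso_div gc fK) (g := idfun)) => P /=.
rewrite /iso_div !divisor_mapU; congr << _ >>.
by apply: place_ext => z _ /=; rewrite fK.
Qed.
End IsoCancel.

Lemma torsion_basis_field_iso (k A B : fieldType)
    (cA : {rmorphism k -> A}) (cB : {rmorphism k -> B})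
    (f : {rmorphism A -> B}) (g : {rmorphism B -> A}) p r (d : 'I_r -> divisor cA) :
  (forall a, f (cA a) = cB a) -> cancel g f -> cancel f g ->
  torsion_basis p d -> exists d' : 'I_r -> divisor cB, torsion_basis p d'.
Proof.
move=> fc gK fK dB.
have gc a : g (cB a) = cA a by rewrite -fc fK.
exists (iso_div gc fK \o d).
apply: (torsion_basis_iso (g := iso_div fc gK)) dB.
- exact: iso_div_class_map.
- exact: iso_div_class_map.
- exact: iso_divK.
- exact: iso_divK.
Qed.

Lemma unit_val (k K : fieldType) (c : {rmorphism k -> K}) (P : place c) z :
  vge P 0 z -> ~~ vge P 1 z -> z != 0 /\ P z = 0.
Proof. by rewrite /vge; case: eqVneq => //= z0; zlia. Qed.

Lemma vge1_val0 (k K : fieldType) (c : {rmorphism k -> K}) (P : place c) z :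
  z != 0 -> P z = 0 -> ~~ vge P 1 z.
Proof. by move=> z0 e; rewrite vgeE // e. Qed.

Lemma val_scale (k K : fieldType) (c : {rmorphism k -> K}) (P : place c) (u z : K) :
  P u = 1 -> z != 0 -> P (u ^ (- P z) * z) = 0.
Proof.
move=> u1 z0.
have u0 : u != 0 by apply/eqP => e; move: u1; rewrite e place_val0.
rewrite valM ?expfz_neq0 //; case: (P z) => n.
  by rewrite -invr_expz valV valX u1; zlia.
by rewrite NegzE opprK valX u1; zlia.
Qed.

Lemma valXz (k K : fieldType) (c : {rmorphism k -> K}) (P : place c) (z : K) n :
  P (z ^ n) = P z * n.
Proof.
case: n => n; first by rewrite valX; zlia.
by rewrite NegzE -invr_expz valV valX; zlia.
Qed.

(** * Quadratic extensions of function fields *)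

(** [A] is a quadratic extension of [i B], generated by a square root [t] of [i s],
    with conjugation [sg]. *)

Section QuadraticExtension.
Variables (k : closedFieldType) (A B : fieldType).
Variables (cA : {rmorphism k -> A}) (cB : {rmorphism k -> B}).
Variables (i : {rmorphism B -> A}) (sg : {rmorphism A -> A}).
Hypotheses (two_neq0 : (2 : k) != 0).
Hypotheses (ic : forall a, i (cB a) = cA a) (sgi : forall b, sg (i b) = i b).
Hypothesis sgK : involutive sg.

Lemma sgc a : sg (cA a) = cA a. Proof. by rewrite -ic sgi. Qed.

Local Notation sP := (pull_place sgc sgK).

(** [e] is the ramification index. *)
Definition lies_over (P : place cA) (Q : place cB) (e : int) :=
  0 < e /\ forall b, P (i b) = e * Q b.

Lemma lies_over_conj P Q e : lies_over P Q e -> lies_over (sP P) Q e.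
Proof. by move=> [e0 h]; split=> // b; rewrite /= sgi. Qed.

Lemma conj_placeK P : sP (sP P) = P.
Proof. by apply: place_ext => z _ /=; rewrite sgK. Qed.

Lemma lies_over_uniq P Q Q' e e' :
  lies_over P Q e -> lies_over P Q' e' -> Q = Q' /\ e = e'.
Proof.
move=> [e0 h] [e0' h'].
have ee b : e * Q b = e' * Q' b by rewrite -h -h'.
have [b _ b1] := uniformizer Q; have [b' _ b1'] := uniformizer Q'.
have := ee b; have := ee b'; rewrite b1 b1' !mulr1 => h1 h2.
have x0 : 0 < Q b' by znia.
have y0 : 0 < Q' b by znia.
have eE : e = e' by znia.
split=> //; apply: place_ext => z _; have := ee z; znia.
Qed.

Lemma lies_over_vge P Q e n b : lies_over P Q e -> 0 <= n -> vge Q n b -> vge P n (i b).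
Proof.
move=> [e0 h] n0; rewrite /vge fmorph_eq0 h => /orP[->//|hn].
by apply/orP; right; znia.
Qed.

(** The fundamental equality for a fibre that is one orbit of the conjugation: no
    residual degree occurs, as [k] is algebraically closed. *)
Definition conjugate_fibre (Q : place cB) :=
  exists P e, [/\ lies_over P Q e,
    forall P' e', lies_over P' Q e' -> P' = P \/ P' = sP P &
    (sP P = P /\ e = 2) \/ (sP P <> P /\ e = 1)].

Section Generator.
Variables (s : B) (t : A).
Hypotheses (t2 : t ^+ 2 = i s) (sgt : sg t = - t) (t0 : t != 0).
Hypothesis gen : forall z, exists a b, z = i a + i b * t.

Let two0 : (2 : A) != 0.
Proof. by rewrite -(rmorph_nat cA) fmorph_eq0. Qed.

Let twoB0 : (2 : B) != 0.
Proof. by rewrite -(rmorph_nat cB) fmorph_eq0. Qed.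

Let s0 : s != 0.
Proof. by rewrite -(fmorph_eq0 i) -t2 expf_neq0. Qed.

Let rep0 a b : i a + i b * t = 0 -> a = 0 /\ b = 0.
Proof.
move=> e.
have e' : i a - i b * t = 0.
  by rewrite -(rmorph0 sg) -e rmorphD rmorphM /= !sgi sgt mulrN.
have ea : i a = 0.
  have : (i a + i b * t) + (i a - i b * t) = 2 * i a by ring.
  by rewrite e e' addr0 => /esym/eqP; rewrite mulf_eq0 (negbTE two0) => /eqP.
have := e; rewrite ea add0r => /eqP; rewrite mulf_eq0 (negbTE t0) orbF fmorph_eq0.
by move: ea => /eqP; rewrite fmorph_eq0 => /eqP -> /eqP.
Qed.

Let rep_inj a b a' b' : i a + i b * t = i a' + i b' * t -> a = a' /\ b = b'.
Proof.
move=> e; have : i (a - a') + i (b - b') * t = 0.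
  by rewrite !rmorphB mulrBl addrACA -opprD e subrr.
by move=> /rep0[/eqP ea /eqP eb]; rewrite !subr_eq0 in ea eb; split; apply/eqP.
Qed.

Lemma norm_rep a b : (i a + i b * t) * sg (i a + i b * t) = i (a ^+ 2 - b ^+ 2 * s).
Proof.
by rewrite rmorphD rmorphM /= !sgi sgt rmorphB !expr2 !rmorphM /= -t2; ring.
Qed.

Lemma norm_ex z : exists n, z * sg z = i n.
Proof. by have [a [b ->]] := gen z; rewrite norm_rep; eexists. Qed.

(** The values of [P] on [i B] are not all 0: an element of value 1 has its trace and
    its norm in [i B].  They form the multiples of the least positive one, which is
    the ramification index. *)
Lemma place_restrict P : exists Q e, lies_over P Q e.
Proof.
have [b0 [b00 Pb0]] : exists b, b != 0 /\ 0 < P (i b).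
  apply: contrapT => no.
  have Pi0 b : P (i b) = 0.
    have [->|b0] := eqVneq b 0; first by rewrite rmorph0 place_val0.
    case: (ltgtP 0 (P (i b))) => // h; exfalso; apply: no; first by exists b.
    by exists b^-1; rewrite invr_eq0 b0 fmorphV valV oppr_gt0.
  have [z z0 Pz] := uniformizer P; have [a [b zE]] := gen z.
  have := norm_rep a b; rewrite -zE.
  have -> : sg z = i (2 * a) - z.
    by rewrite zE rmorphD rmorphM /= !sgi sgt rmorphM rmorph_nat; ring.
  move=> /(congr1 P); rewrite Pi0 valM //; last first.
    apply/eqP => h; have : z = i (2 * a) by apply/eqP; rewrite eq_sym -subr_eq0 h.
    by move=> /(congr1 P); rewrite Pi0 Pz.
  have : vge P 0 (i (2 * a) - z).
    apply: vgeB; first by rewrite -(Pi0 (2 * a)) vge_val.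
    by apply: vge_le (vge_val P z); rewrite Pz.
  rewrite /vge Pz => /orP[/eqP ->|]; first by rewrite place_val0.
  by zlia.
pose pos (n : nat) := `[< exists b, b != 0 /\ P (i b) = n.+1%:Z >].
have pos_ex : exists n, pos n.
  exists (`|P (i b0)|.-1)%N; apply/asboolP; exists b0; split=> //; zlia.
case: (ex_minnP pos_ex) => m /asboolP[u [u0 Pu]] m_min.
set e : int := m.+1%:Z in Pu.
have e_gt0 : 0 < e by [].
have Pmod b : P (i b) = e * (P (i b) %/ e)%Z.
  have [->|b0'] := eqVneq b 0; first by rewrite rmorph0 place_val0 div0z mulr0.
  have eE := divz_eq (P (i b)) e.
  have r0 : 0 <= (P (i b) %% e)%Z by apply: modz_ge0; zlia.
  have re : (P (i b) %% e)%Z < e by apply: ltz_pmod.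
  suff r1 : (P (i b) %% e)%Z = 0 by zlia.
  set q := (P (i b) %/ e)%Z in eE *; set r := (P (i b) %% e)%Z in eE r0 re *.
  apply: contrapT => rn.
  have Pr : P (i (b * u ^ (- q))) = r.
    rewrite rmorphM /= valM ?fmorph_eq0 ?expfz_neq0 // fmorphXz valXz Pu.
    by rewrite eE; zlia.
  have := m_min `|r|.-1%N; rewrite leqNgt.
  have -> : (`|r|.-1 < m)%N by move: re r0 rn; rewrite /e; zlia.
  move=> h; suff : false by []; apply: h; apply/asboolP.
  exists (b * u ^ (- q)); rewrite mulf_neq0 ?expfz_neq0 //; split=> //.
  by rewrite Pr; zlia.
pose v b := (P (i b) %/ e)%Z.
have vE b : P (i b) = e * v b by exact: Pmod.
have v0 : v 0 = 0 by rewrite /v rmorph0 place_val0 div0z.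
have vM y z : y != 0 -> z != 0 -> v (y * z) = v y + v z.
  move=> y0 z0; have := vE (y * z); rewrite rmorphM valM ?fmorph_eq0 // !vE; znia.
have vD y z : y != 0 -> z != 0 -> y + z != 0 -> Num.min (v y) (v z) <= v (y + z).
  move=> y0 z0 yz0.
  have := @place_valD _ _ _ P (i y) (i z); rewrite -rmorphD !fmorph_eq0 !vE.
  by move=> /(_ y0 z0 yz0); rewrite !ge_min !(ler_pM2l e_gt0).
have vC a : a != 0 -> v (cB a) = 0.
  by move=> a0; have := vE (cB a); rewrite ic place_valC //; znia.
have vS n : exists2 f, f != 0 & v f = n.
  exists (u ^ n); first exact: expfz_neq0.
  by have := vE (u ^ n); rewrite fmorphXz valXz Pu; znia.
by exists (Place v0 vM vD vC vS), e; split.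
Qed.

Let sg_rep a b : sg (i a + i b * t) = i a - i b * t.
Proof. by rewrite rmorphD rmorphM /= !sgi sgt mulrN. Qed.

Let mul_rep a b a' b' : (i a + i b * t) * (i a' + i b' * t) =
  i (a * a' + b * b' * s) + i (a * b' + a' * b) * t.
Proof. rewrite !rmorphD !rmorphM /= -t2; ring. Qed.

Let norm_neq0 a b : i a + i b * t != 0 -> a ^+ 2 - b ^+ 2 * s != 0.
Proof.
move=> z0; rewrite -(fmorph_eq0 i) -norm_rep mulf_neq0 //.
by rewrite fmorph_eq0.
Qed.

(** When [s] is a uniformizer downstairs, [t] is one upstairs.  The two terms of
    [i a + i b t] have values of different parity, so that the smaller one decides.
    The ring [R] of the elements with [a] and [b] regular is local. *)
Lemma conjugate_fibre_ramified (Q : place cB) : Q s = 1 -> conjugate_fibre Q.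
Proof.
move=> Qs.
pose R z := exists a b, [/\ vge Q 0 a, vge Q 0 b & z = i a + i b * t].
pose U z := exists a b, [/\ a != 0, Q a = 0, vge Q 0 b & z = i a + i b * t].
have uge a : Q a = 0 -> vge Q 0 a by move=> e; rewrite -e vge_val.
have sge : vge Q 1 s by rewrite -Qs vge_val.
have Rt : R t.
  by exists 0, 1; rewrite vge0 uge ?place_val1 // rmorph0 rmorph1 add0r mul1r.
have RD x y : R x -> R y -> R (x + y).
  move=> [a [b [ha hb ->]]] [a' [b' [ha' hb' ->]]]; exists (a + a'), (b + b').
  by rewrite !vgeD // !rmorphD; split=> //; ring.
have RM x y : R x -> R y -> R (x * y).
  move=> [a [b [ha hb ->]]] [a' [b' [ha' hb' ->]]]; rewrite mul_rep.
  exists (a * a' + b * b' * s), (a * b' + a' * b); split=> //.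
    apply: vgeD; first exact: vgeM0.
    by apply: vgeM0; [apply: vgeM0 | apply: vge_le sge].
  by apply: vgeD; apply: vgeM0.
have UR x : U x -> R x.
  by move=> [a [b [_ /uge ha hb ->]]]; exists a, b.
have UM x y : U x -> U y -> U (x * y).
  move=> [a [b [a0 ha hb ->]]] [a' [b' [a0' ha' hb' ->]]]; rewrite mul_rep.
  have aa0 : a * a' != 0 by rewrite mulf_neq0.
  have aaQ : Q (a * a') = 0 by rewrite valM // ha ha'.
  have [] := @val_addr _ _ _ Q (a * a') (b * b' * s) aa0.
    by rewrite aaQ add0r; apply: vgeM0 => //; apply: vgeM0.
  move=> h1 h2.
  exists (a * a' + b * b' * s), (a * b' + a' * b); rewrite h2 aaQ; split=> //.
  by apply: vgeD; apply: vgeM0 => //; apply: uge.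
have UB b : b != 0 -> Q b = 0 -> U (i b).
  by move=> b0 Qb; exists b, 0; rewrite vge0 rmorph0 mul0r addr0.
have UC a : a != 0 -> U (cA a).
  by move=> a0; rewrite -ic; apply: UB; rewrite ?fmorph_eq0 ?place_valC.
have U0 : ~ U 0.
  move=> [a [b [a0 _ _ /esym /rep0[ea _]]]]; by rewrite ea eqxx in a0.
have Ut x : R x -> ~ U (t * x).
  move=> [a [b [ha hb ->]]] [a' [b' [a0' ha' _]]].
  have -> : t * (i a + i b * t) = i (b * s) + i a * t.
    by rewrite rmorphM /= -t2; ring.
  move=> /rep_inj[e _]; have := vge1_val0 a0' ha'.
  by rewrite -e (vgeM0 hb sge).
have tpow n : i (s ^ n) = t ^ (2 * n) by rewrite fmorphXz -t2 -exprz_exp.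
have tU z : z != 0 -> exists (n : int) a b, [/\ U a, U b & z = t ^ n * (a / b)].
  have [a [b ->]] := gen z => z0.
  have U1 : U 1 by rewrite -(rmorph1 cA); apply: UC; rewrite oner_eq0.
  have [ha|ha] : (a != 0 /\ vge Q (Q a) b) \/ (b != 0 /\ vge Q (Q b + 1) a).
    have [a0|a0] := eqVneq a 0.
      right; rewrite a0 vge0; split=> //; apply/eqP => b0.
      by move: z0; rewrite a0 b0 !rmorph0 mul0r addr0 eqxx.
    have [->|b0] := eqVneq b 0; first by left; rewrite vge0.
    by rewrite !vgeE //; case: (lerP (Q a) (Q b)) => h; [left | right; split=> //; zlia].
  - case: ha => a0 hb; exists (2 * Q a), (i (s ^ (- Q a) * a) + i (s ^ (- Q a) * b) * t), 1.
    split=> //.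
      exists (s ^ (- Q a) * a), (s ^ (- Q a) * b).
      rewrite mulf_neq0 ?expfz_neq0 // val_scale //; split=> //.
      apply: (vge_le (m := - Q a + Q a)); first zlia.
      by apply: vgeM hb; rewrite vgeE ?expfz_neq0 // valXz Qs; zlia.
    rewrite divr1 !rmorphM /= !tpow mulrDr !mulrA -expfzDr //.
    have -> : 2 * Q a + 2 * - Q a = 0 by zlia.
    by rewrite expr0z !mul1r.
  - case: ha => b0 ha.
    exists (2 * Q b + 1), (i (s ^ (- Q b) * b) + i (s ^ (- Q b - 1) * a) * t), 1.
    split=> //.
      exists (s ^ (- Q b) * b), (s ^ (- Q b - 1) * a).
      rewrite mulf_neq0 ?expfz_neq0 // val_scale //; split=> //.
      apply: (vge_le (m := (- Q b - 1) + (Q b + 1))); first zlia.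
      by apply: vgeM ha; rewrite vgeE ?expfz_neq0 // valXz Qs; zlia.
    have e1 : t ^ (2 * Q b + 1) * t ^ (2 * - Q b) = t.
      by rewrite -expfzDr // (_ : 2 * Q b + 1 + _ = 1) ?expr1z //; zlia.
    have e2 : t ^ (2 * Q b + 1) * t ^ (2 * (- Q b - 1)) * t = 1.
      by rewrite -expfzDr // (_ : 2 * Q b + 1 + _ = -1) ?mulVf //; zlia.
    rewrite divr1 !rmorphM /= !tpow.
    transitivity (t ^ (2 * Q b + 1) * t ^ (2 * - Q b) * i b +
      t ^ (2 * Q b + 1) * t ^ (2 * (- Q b - 1)) * t * i a); last by ring.
    by rewrite e1 e2; ring.
have [P [PU Pt Puniq]] := place_of_units t0 Rt RD RM UR UM UC U0 Ut tU.
have PQ : lies_over P Q 2.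
  split=> // b; have [->|b0] := eqVneq b 0.
    by rewrite rmorph0 !place_val0 mulr0.
  have sn0 n : s ^ n != 0 by apply: expfz_neq0.
  have e : b = s ^ Q b * (s ^ (- Q b) * b).
    by rewrite mulrA -expfzDr // subrr expr0z mul1r.
  rewrite {1}e rmorphM valM ?fmorph_eq0 ?mulf_neq0 // (PU (i (s ^ (- Q b) * b))) ?addr0.
    by rewrite tpow valXz Pt mul1r.
  by apply: UB; [rewrite mulf_neq0 | apply: val_scale].
have uniq P' e' : lies_over P' Q e' -> P' = P.
  move=> H; have [e0 h] := H.
  have P't : 2 * P' t = e'.
    by have := congr1 P' t2; rewrite h Qs valX; zlia.
  apply: Puniq; last by zlia.
  move=> z [a [b [a0 ha hb ->]]].
  have Pa : P' (i a) = 0 by rewrite h ha mulr0.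
  have [] := @val_addr _ _ _ P' (i a) (i b * t); rewrite ?fmorph_eq0 //.
    rewrite Pa add0r; apply: vgeM0; first exact: (lies_over_vge H).
    by rewrite vgeE //; zlia.
  by move=> _ ->.
exists P, 2; split=> //; first by move=> P' e' /uniq; left.
by left; split=> //; apply: uniq (lies_over_conj PQ).
Qed.

(** When [s] takes the nonzero value [d^2], the elements [t - d] and [t + d] vanish at
    two different points over [Q].  The same ring [R] now has two maximal ideals, and
    [U] is the complement of that of the point [t = d].  An element vanishing there to
    higher order than at the conjugate point is the quotient of its norm, which is
    downstairs, by its conjugate, which is in [U]. *)
Lemma conjugate_fibre_unramified (Q : place cB) (d : k) :
  Q s = 0 -> d != 0 -> vge Q 1 (s - cB d ^+ 2) -> conjugate_fibre Q.
Proof.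
move=> Qs d0 sd; have [u u0 Qu] := uniformizer Q.
have sd' : vge Q 0 s by rewrite -Qs vge_val.
pose D := cB d; rewrite -/D in sd; have D0 : D != 0 by rewrite fmorph_eq0.
have QD : Q D = 0 by apply: place_valC.
have Dge : vge Q 0 D by apply: vgeC.
pose R z := exists a b, [/\ vge Q 0 a, vge Q 0 b & z = i a + i b * t].
pose U z := exists a b, [/\ vge Q 0 a, vge Q 0 b,
  ~~ vge Q 1 (a + b * D) & z = i a + i b * t].
have uge a : Q a = 0 -> vge Q 0 a by move=> e; rewrite -e vge_val.
have UB b : b != 0 -> Q b = 0 -> U (i b).
  move=> b0 Qb; exists b, 0; rewrite vge0 uge // rmorph0 !mul0r !addr0.
  by rewrite vge1_val0.
have Ru : R (i u).
  exists u, 0; rewrite vge0 rmorph0 mul0r addr0; split=> //.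
  by rewrite vgeE // Qu.
have RD x y : R x -> R y -> R (x + y).
  move=> [a [b [ha hb ->]]] [a' [b' [ha' hb' ->]]]; exists (a + a'), (b + b').
  by rewrite !vgeD // !rmorphD; split=> //; ring.
have RM x y : R x -> R y -> R (x * y).
  move=> [a [b [ha hb ->]]] [a' [b' [ha' hb' ->]]]; rewrite mul_rep.
  exists (a * a' + b * b' * s), (a * b' + a' * b); split=> //.
    by apply: vgeD; apply: vgeM0 => //; apply: vgeM0.
  by apply: vgeD; apply: vgeM0.
have UR x : U x -> R x by move=> [a [b [ha hb _ ->]]]; exists a, b.
have UM x y : U x -> U y -> U (x * y).
  move=> [a [b [ha hb hab ->]]] [a' [b' [ha' hb' hab' ->]]].
  exists (a * a' + b * b' * s), (a * b' + a' * b); rewrite mul_rep; split=> //.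
  - by apply: vgeD; apply: vgeM0 => //; apply: vgeM0.
  - by apply: vgeD; apply: vgeM0.
  - have [n1 v1] := unit_val (vgeD ha (vgeM0 hb Dge)) hab.
    have [n2 v2] := unit_val (vgeD ha' (vgeM0 hb' Dge)) hab'.
    have [] := @val_addr _ _ _ Q ((a + b * D) * (a' + b' * D)) (b * b' * (s - D ^+ 2)).
    + by rewrite mulf_neq0.
    + by rewrite valM // v1 v2; apply: vgeM0 => //; apply: vgeM0.
    rewrite valM // v1 v2 addr0 => n3 v3.
    have := vge1_val0 n3 v3; congr (~~ vge Q 1 _); ring.
have U1 : U 1.
  by rewrite -(rmorph1 i); apply: UB; rewrite ?oner_eq0 ?place_val1.
have UC a : a != 0 -> U (cA a).
  by move=> a0; rewrite -ic; apply: UB; rewrite ?fmorph_eq0 ?place_valC.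
have U0 : ~ U 0.
  move=> [a [b [_ _ hab /esym /rep0[ea eb]]]]; move: hab.
  by rewrite ea eb mul0r addr0 vge0.
have Ut x : R x -> ~ U (i u * x).
  move=> [a [b [ha hb ->]]] [a' [b' [_ _ hab']]].
  have -> : i u * (i a + i b * t) = i (u * a) + i (u * b) * t.
    by rewrite !rmorphM /=; ring.
  move=> /rep_inj[ea eb]; move: hab'; rewrite -ea -eb => /negP; apply.
  have -> : u * a + u * b * D = (a + b * D) * u by ring.
  apply: vgeM0; last by rewrite vgeE // Qu.
  by apply: vgeD => //; apply: vgeM0.
have two1 : Q (2 : B) = 0 by rewrite -(rmorph_nat cB) place_valC.
have half z : vge Q 1 (2 * z) -> vge Q 1 z.
  have [->|z0] := eqVneq z 0; first by rewrite vge0.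
  by rewrite !vgeE ?mulf_neq0 // valM // two1 add0r.
have un0 n : u ^ n != 0 by apply: expfz_neq0.
have tU z : z != 0 -> exists (n : int) a b,
    [/\ U a, U b & z = i u ^ n * (a / b)].
  have [a [b ->]] := gen z => z0.
  have [n [ha hb nab]] : exists n, [/\ vge Q n a, vge Q n b &
      ~~ (vge Q (n + 1) a && vge Q (n + 1) b)].
    have [a0|a0] := eqVneq a 0.
      have b0 : b != 0.
        apply: contraNneq z0 => ->; by rewrite a0 !rmorph0 mul0r addr0.
      exists (Q b); rewrite a0 !vge0 vge_val; split=> //=.
      by rewrite vgeE //; zlia.
    have [b0|b0] := eqVneq b 0.
      exists (Q a); rewrite b0 !vge0 vge_val; split=> //=.
      by rewrite vgeE //; zlia.
    exists (Num.min (Q a) (Q b)); rewrite !vgeE // minEle.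
    by case: ifP => h; split; zlia.
  pose a0 := u ^ (- n) * a; pose b0 := u ^ (- n) * b.
  have zE : i a + i b * t = i u ^ n * (i a0 + i b0 * t).
    rewrite /a0 /b0 !rmorphM /= fmorphXz -invr_expz.
    by field; rewrite expfz_neq0 ?fmorph_eq0.
  have sc m x : vge Q (n + m) x -> vge Q m (u ^ (- n) * x).
    move=> h; apply: (vge_le (m := - n + (n + m))); first zlia.
    by apply: vgeM h; rewrite vgeE // valXz Qu mul1r.
  have sc' x : ~~ vge Q (n + 1) x -> ~~ vge Q 1 (u ^ (- n) * x).
    apply: contra => h.
    have -> : x = u ^ n * (u ^ (- n) * x).
      by rewrite mulrA -expfzDr // subrr expr0z mul1r.
    by apply: vgeM h; rewrite vgeE // valXz Qu mul1r.
  have ha0 : vge Q 0 a0 by apply: sc; rewrite addr0.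
  have hb0 : vge Q 0 b0 by apply: sc; rewrite addr0.
  have nab0 : ~~ (vge Q 1 a0 && vge Q 1 b0).
    by move: nab; rewrite !negb_and => /orP[/sc' -> //|/sc' ->]; rewrite orbT.
  rewrite {}zE in z0 *.
  have z00 : i a0 + i b0 * t != 0.
    by apply: contraNneq z0 => ->; rewrite mulr0.
  (* Now [a0] and [b0] do not both vanish at [Q], hence neither do both values
     [a0 + b0 d] and [a0 - b0 d]. *)
  have [h1|h1] := boolP (vge Q 1 (a0 + b0 * D)); last first.
    exists n, (i a0 + i b0 * t), 1; split=> //; last by rewrite divr1.
    by exists a0, b0.
  have h2 : ~~ vge Q 1 (a0 - b0 * D).
    apply: contra nab0 => h2; apply/andP; split; apply: half.
      have -> : 2 * a0 = (a0 + b0 * D) + (a0 - b0 * D) by ring.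
      exact: vgeD.
    have -> : 2 * b0 = D^-1 * ((a0 + b0 * D) - (a0 - b0 * D)) by field.
    by apply: vgeM0; [rewrite vgeE ?invr_eq0 // valV QD | apply: vgeB].
  pose N := a0 ^+ 2 - b0 ^+ 2 * s; have N0 : N != 0 by apply: norm_neq0.
  exists (n + Q N), (i (u ^ (- Q N) * N)), (i a0 - i b0 * t); split.
  - by apply: UB; [rewrite mulf_neq0 | apply: val_scale].
  - exists a0, (- b0); rewrite vgeN mulNr rmorphN mulNr; split=> //.
  have z01 : i a0 - i b0 * t != 0 by rewrite -sg_rep fmorph_eq0.
  rewrite expfzDr ?fmorph_eq0 // -mulrA; congr (_ * _).
  have NE : i N = (i a0 + i b0 * t) * (i a0 - i b0 * t) by rewrite -sg_rep norm_rep.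
  rewrite (rmorphM i (u ^ (- Q N))) /= fmorphXz NE -invr_expz; field.
  by rewrite z01 expfz_neq0 ?fmorph_eq0.
have iu0 : i u != 0 by rewrite fmorph_eq0.
have [P [PU Pt Puniq]] := place_of_units iu0 Ru RD RM UR UM UC U0 Ut tU.
have PQ : lies_over P Q 1.
  split=> // b; rewrite mul1r; have [->|b0] := eqVneq b 0.
    by rewrite rmorph0 !place_val0.
  have e : b = u ^ Q b * (u ^ (- Q b) * b).
    by rewrite mulrA -expfzDr // subrr expr0z mul1r.
  rewrite {1}e rmorphM valM ?fmorph_eq0 ?mulf_neq0 // (PU (i (u ^ (- Q b) * b))) ?addr0.
    by rewrite fmorphXz valXz Pt mul1r.
  by apply: UB; [rewrite mulf_neq0 | apply: val_scale].
have tni b : t <> i b.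
  move=> e; have /rep0[_ /eqP] : i (- b) + i 1 * t = 0.
    by rewrite rmorphN rmorph1 mul1r e addNr.
  by rewrite oner_eq0.
have tD0 : t + i D != 0.
  by apply/eqP => /eqP; rewrite addr_eq0 -rmorphN => /eqP /tni.
have tD0' : t - i D != 0 by apply/eqP => /eqP; rewrite subr_eq0 => /eqP /tni.
have tDE : (t - i D) * (t + i D) = i (s - D ^+ 2).
  by rewrite rmorphB rmorphXn /= -t2; ring.
have PtD : P (t + i D) = 0.
  apply: PU; exists D, 1; rewrite mul1r rmorph1 mul1r; split=> //;
    last exact: addrC.
    by apply: uge; rewrite place_val1.
  have -> : D + D = 2 * D by ring.
  by apply: contra (vge1_val0 D0 QD); apply: half.
have near P' e' : lies_over P' Q e' -> vge P' 1 (t - i D) -> P' = P.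
  move=> h ht; apply: Puniq; last by case: h => h1 ->; rewrite Qu; zlia.
  move=> z [a [b [ha hb hab ->]]].
  have [n1 v1] := unit_val (vgeD ha (vgeM0 hb Dge)) hab.
  have v2 : P' (i (a + b * D)) = 0 by case: h => _ ->; rewrite v1 mulr0.
  have -> : i a + i b * t = i (a + b * D) + i b * (t - i D).
    by rewrite rmorphD rmorphM /=; ring.
  have [] := @val_addr _ _ _ P' (i (a + b * D)) (i b * (t - i D)).
  - by rewrite fmorph_eq0.
  - by rewrite v2 add0r; apply: vgeM0 ht; apply: (lies_over_vge h).
  by move=> _ ->.
exists P, 1; split=> //.
  move=> P' e' h; have e0 : 0 < e' by case: h.
  have : vge P' 1 ((t - i D) * (t + i D)).
    rewrite tDE; case: h => _ h; rewrite /vge fmorph_eq0 h.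
    by case/orP: sd => [->//|sd]; apply/orP; right; znia.
  rewrite vgeE ?mulf_neq0 // valM // => h1.
  case: (lerP 1 (P' (t - i D))) => h2.
    by left; apply: near h _; rewrite vgeE.
  right; rewrite -[LHS]conj_placeK; congr pull_place.
  apply: near (lies_over_conj h) _; rewrite vgeE //= rmorphB sgt sgi.
  rewrite -opprD valN; move: h1 h2.
  by move: (P' (t + i D)) (P' (t - i D)) => m n; zlia.
right; split=> // eP.
have : P (i (s - D ^+ 2)) = 0.
  rewrite -tDE valM // PtD addr0 -[in LHS]eP /= rmorphB sgt sgi.
  by rewrite -opprD valN.
have : i (s - D ^+ 2) != 0 by rewrite -tDE mulf_neq0.
by rewrite fmorph_eq0; case: PQ => _ -> n0; move: sd; rewrite vgeE //; zlia.
Qed.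
End Generator.

Variables (s : B) (t : A).
Hypotheses (t2 : t ^+ 2 = i s) (sgt : sg t = - t) (t0 : t != 0).
Hypothesis gen : forall z, exists a b, z = i a + i b * t.
Hypothesis residue : forall (Q : place cB) z, z != 0 -> Q z = 0 ->
  exists2 a, a != 0 & vge Q 1 (z - cB a).

(** Multiplying [t] by a power of a uniformizer brings the value of [s] to 0 or 1. *)
Lemma conjugate_fibre_everywhere Q : conjugate_fibre Q.
Proof.
have [u u0 Qu] := uniformizer Q.
have s0 : s != 0 by rewrite -(fmorph_eq0 i) -t2 expf_neq0.
pose j := (Q s %/ 2)%Z.
pose s' := s * (u ^ (- j)) ^+ 2; pose t' := t * i (u ^ (- j)).
have uj0 : u ^ (- j) != 0 by apply: expfz_neq0.
have t2' : t' ^+ 2 = i s' by rewrite /t' /s' exprMn t2 (rmorphM i s) (rmorphXn i).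
have sgt' : sg t' = - t' by rewrite rmorphM /= sgt sgi mulNr.
have t0' : t' != 0 by rewrite mulf_neq0 // fmorph_eq0.
have gen' z : exists a b, z = i a + i b * t'.
  have [a [b ->]] := gen z; exists a, (b / u ^ (- j)).
  by rewrite fmorph_div /t'; field; rewrite fmorph_eq0.
have Qs' : Q s' = Q s - 2 * j.
  by rewrite valM ?expf_neq0 // valX valXz Qu; zlia.
have s0' : s' != 0 by rewrite mulf_neq0 ?expf_neq0.
have [e|e] : Q s' = 0 \/ Q s' = 1.
- by rewrite Qs' /j; zlia.
- have [a a0 sa] := residue s0' e.
  have [d] : exists d, root ('X^2 - a%:P) d.
    by apply/closed_rootP; rewrite size_XnsubC.
  rewrite rootE !hornerE subr_eq0 => /eqP ad.
  apply: (conjugate_fibre_unramified t2' sgt' t0' gen' (d := d)) => //.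
    by apply: contraNneq a0 => d0; rewrite -ad d0 expr0n.
  by rewrite -rmorphXn /= ad.
- exact: (conjugate_fibre_ramified t2' sgt' t0' gen').
Qed.

Let restr (P : place cA) : place cB := projT1 (cid (place_restrict t2 sgt gen P)).
Let over Q : place cA := projT1 (cid (conjugate_fibre_everywhere Q)).

Let restrP P : exists e, lies_over P (restr P) e.
Proof. by rewrite /restr; case: cid. Qed.

Let overP Q : exists e, [/\ lies_over (over Q) Q e,
    forall P' e', lies_over P' Q e' -> P' = over Q \/ P' = sP (over Q) &
    (sP (over Q) = over Q /\ e = 2) \/ (sP (over Q) <> over Q /\ e = 1)].
Proof. by rewrite /over; case: cid. Qed.

(** In the ramified case the two places coincide and count twice, which is the right
    multiplicity. *)
Definition conorm := divisor_map (fun Q => << over Q >> + << sP (over Q) >> : divisor cA).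
Definition norm_divisor := divisor_map (fun P => << restr P >> : divisor cB).

Lemma lies_over_restr P Q e : lies_over P Q e -> restr P = Q.
Proof. by have [e' h] := restrP P => /(lies_over_uniq h)[]. Qed.

Lemma norm_conorm D : norm_divisor (conorm D) = D *+ 2.
Proof.
pose f : {additive divisor cB -> divisor cB} := norm_divisor \o conorm.
apply: (divisor_ext (f := f) (g := idfun \+ idfun)) => Q.
rewrite /f /= /conorm /norm_divisor divisor_mapU raddfD /= !divisor_mapU.
have [e [h _ _]] := overP Q.
by rewrite (lies_over_restr h) (lies_over_restr (lies_over_conj h)).
Qed.

Lemma conorm_norm D : conorm (norm_divisor D) = D + iso_div sgc sgK D.
Proof.
pose f : {additive divisor cA -> divisor cA} := conorm \o norm_divisor.
apply: (divisor_ext (f := f) (g := idfun \+ iso_div sgc sgK)) => P.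
rewrite /f /= /conorm /norm_divisor /iso_div !divisor_mapU.
have [e' hP] := restrP P; have [e [_ h _]] := overP (restr P).
case: (h _ _ hP) => eP; first by rewrite -eP.
by rewrite -[over _]conj_placeK -eP conj_placeK addrC.
Qed.

Lemma coeff_conorm P Q e D : lies_over P Q e ->
  coeff P (conorm D) = e * coeff Q D.
Proof.
move=> hP.
pose f : {additive divisor cB -> int} := coeff P \o conorm.
rewrite -coeffZ.
pose g : {additive divisor cB -> int} := coeff Q \o ( *:%R e).
apply: (divisor_ext (f := f) (g := g)) => Q'.
rewrite /f /g /= /conorm divisor_mapU raddfD /= coeffZ !coeffU !mul1r.
have [e' [hQ' uniq ram]] := overP Q'.
have [eQ|nQ] := eqVneq Q' Q.
  subst Q'; have ePe : e' = e.
    case: (uniq _ _ hP) => eP; rewrite eP in hP.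
      by case: (lies_over_uniq hQ' hP).
    by case: (lies_over_uniq (lies_over_conj hQ') hP).
  rewrite -ePe mulr1; case: (uniq _ _ hP) => ->; rewrite eqxx.
    by case: ram => [[-> ->]|[/eqP/negbTE -> ->]]; rewrite ?eqxx.
  case: ram => [[-> ->]|[/eqP/negbTE ram ->]]; rewrite ?eqxx // eq_sym ram //.
rewrite mulr0.
have no P' : lies_over P' Q' e' -> (P' == P) = false.
  move=> h'; apply/eqP => eP; rewrite eP in h'; move/eqP: nQ; apply.
  by case: (lies_over_uniq h' hP).
by rewrite (no _ hQ') (no _ (lies_over_conj hQ')).
Qed.

Lemma conorm_class_map : class_map conorm.
Proof.
split=> D.
  move=> dD; rewrite (deg_divisor_map (e := 2)) ?dD ?mul0r // => Q.
  by rewrite degD !degU.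
move=> /asboolP[b b0 bD]; apply/asboolP; exists (i b); rewrite ?fmorph_eq0 //.
move=> P; have [e h] := restrP P.
by rewrite (coeff_conorm _ h) bD; case: h => _ ->.
Qed.

(** The norm of a function has the norm of its divisor: after pulling back, this says
    that the divisor of [z sg(z)] is the sum of that of [z] and its conjugate. *)
Lemma norm_class_map : class_map norm_divisor.
Proof.
split=> D.
  by move=> dD; rewrite (deg_divisor_map (e := 1)) ?dD // => P; rewrite degU.
move=> /asboolP[z z0 zD]; apply/asboolP.
have [n zn] := norm_ex t2 sgt gen z.
have n0 : n != 0 by rewrite -(fmorph_eq0 i) -zn mulf_neq0 ?fmorph_eq0.
exists n => // Q; have [e [h _ _]] := overP Q.
have e0 : e != 0 by case: h => e0 _; rewrite gt_eqF.
apply: (mulfI e0); rewrite -(coeff_conorm _ h) conorm_norm raddfD /=.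
rewrite (coeff_iso_div sgc sgc sgK sgK) !zD /=.
by case: h => _ <-; rewrite -zn valM ?fmorph_eq0.
Qed.

Theorem conorm_norm_maps : exists (up : {additive divisor cB -> divisor cA})
    (dn : {additive divisor cA -> divisor cB}),
  [/\ class_map up, class_map dn, forall D, dn (up D) = D *+ 2 &
      forall D, up (dn D) = D + iso_div sgc sgK D].
Proof.
exists conorm, norm_divisor; split.
- exact: conorm_class_map.
- exact: norm_class_map.
- exact: norm_conorm.
- exact: conorm_norm.
Qed.
End QuadraticExtension.

(** * Evaluation and residues *)

HB.lock Definition ev (k K : fieldType) (c : {rmorphism k -> K}) (x : K) :
  {poly k} -> K := horner_eval x \o map_poly c.

HB.lock Definition ev2 (k K : fieldType) (c : {rmorphism k -> K}) (x y : K) :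
  {poly {poly k}} -> K :=
  horner_eval y \o horner_eval x%:P \o map_poly (map_poly c).

Section Evaluation.
Variables (k K : fieldType) (c : {rmorphism k -> K}).
Local Notation ev := (ev c).
Local Notation ev2 := (ev2 c).

Lemma ev_is_zmod_morphism x : zmod_morphism (ev x).
Proof. by rewrite ev.unlock; apply: raddfB. Qed.
Lemma ev_is_monoid_morphism x : monoid_morphism (ev x).
Proof. by rewrite ev.unlock; split; [apply: rmorph1 | apply: rmorphM]. Qed.
HB.instance Definition _ (x : K) :=
  GRing.isZmodMorphism.Build _ _ (ev x) (ev_is_zmod_morphism x).
HB.instance Definition _ (x : K) :=
  GRing.isMonoidMorphism.Build _ _ (ev x) (ev_is_monoid_morphism x).

Lemma ev2_is_zmod_morphism x y : zmod_morphism (ev2 x y).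
Proof. by rewrite ev2.unlock; apply: raddfB. Qed.
Lemma ev2_is_monoid_morphism x y : monoid_morphism (ev2 x y).
Proof. by rewrite ev2.unlock; split; [apply: rmorph1 | apply: rmorphM]. Qed.
HB.instance Definition _ (x y : K) :=
  GRing.isZmodMorphism.Build _ _ (ev2 x y) (ev2_is_zmod_morphism x y).
HB.instance Definition _ (x y : K) :=
  GRing.isMonoidMorphism.Build _ _ (ev2 x y) (ev2_is_monoid_morphism x y).

Lemma ev2B x y p q : ev2 x y (p - q) = ev2 x y p - ev2 x y q.
Proof. exact: ev2_is_zmod_morphism. Qed.

Lemma ev2M x y p q : ev2 x y (p * q) = ev2 x y p * ev2 x y q.
Proof. exact: (ev2_is_monoid_morphism x y).2. Qed.

Lemma ev2D x y p q : ev2 x y (p + q) = ev2 x y p + ev2 x y q.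
Proof. by rewrite -[p in RHS](addrK q) ev2B subrK. Qed.

Lemma evE x p : ev x p = (map_poly c p).[x].
Proof. by rewrite ev.unlock. Qed.

Lemma evX x : ev x 'X = x.
Proof. by rewrite evE map_polyX hornerX. Qed.

Lemma evC x a : ev x a%:P = c a.
Proof. by rewrite evE map_polyC hornerC. Qed.

Lemma ev2X x y : ev2 x y 'X = x.
Proof. by rewrite ev2.unlock /= /horner_eval map_polyX hornerX hornerC. Qed.

Lemma ev2C x y p : ev2 x y p%:P = ev y p.
Proof. by rewrite ev2.unlock evE /= /horner_eval map_polyC hornerC. Qed.

Lemma ev2E x y G : ev2 x y G = (map_poly (ev y) G).[x].
Proof.
rewrite ev2.unlock ev.unlock /= /horner_eval -[X in _ = _.[X]](hornerC x y).
rewrite -[RHS]/((map_poly (horner_eval y \o map_poly c) G).[horner_eval y x%:P]).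
by rewrite map_poly_comp horner_map.
Qed.

Lemma ev2_swap x y G : ev2 x y (swapXY G) = ev2 y x G.
Proof. by rewrite ev2.unlock /= /horner_eval -swapXY_map horner2_swapXY. Qed.
End Evaluation.

Lemma ev_split (k : closedFieldType) (K : fieldType) (c : {rmorphism k -> K}) x p :
  exists2 rs : seq k, ev c x p = c (lead_coef p) * \prod_(a <- rs) (x - c a) &
  p = lead_coef p *: \prod_(a <- rs) ('X - a%:P).
Proof.
have [rs pE] := closed_field_poly_normal p; exists rs => //.
rewrite [in LHS]pE -mul_polyC rmorphM /= evC rmorph_prod; congr (_ * _).
by apply: eq_bigr => a _; rewrite rmorphB /= evX evC.
Qed.

Lemma ltz_mul_nat (a : int) (i m : nat) : 0 < a -> (i < m)%N ->
  a * i%:Z + 1 <= a * m%:Z.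
Proof. by nia. Qed.

Lemma ltz_nmul_nat (a : int) (i m : nat) : a < 0 -> (i < m)%N ->
  a * m%:Z + 1 <= a * i%:Z.
Proof. by nia. Qed.

Section ValuationSums.
Variables (k K : fieldType) (c : {rmorphism k -> K}) (P : place c).

Lemma vge_sum n (I : Type) (r : seq I) (p : pred I) (F : I -> K) :
  (forall i, p i -> vge P n (F i)) -> vge P n (\sum_(i <- r | p i) F i).
Proof.
move=> h; apply: (big_ind (vge P n)) => //; first exact: vge0.
by move=> *; apply: vgeD.
Qed.

Lemma sum_strict_min n (F : 'I_n -> K) j : F j != 0 ->
  (forall i, i != j -> vge P (P (F j) + 1) (F i)) -> \sum_i F i != 0.
Proof.
move=> Fj h; rewrite (bigD1 j) //=.
by case: (@val_addr _ _ _ P (F j) (\sum_(i | i != j) F i)) => //; apply: vge_sum.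
Qed.

(** Distinct powers of an element of nonzero value have distinct values, so that
    residually transcendental elements stay independent of it. *)
Lemma residually_free (z t : K) (G : {poly {poly k}}) :
  (forall g : {poly k}, g != 0 -> ev c z g != 0 /\ P (ev c z g) = 0) ->
  t != 0 -> P t != 0 -> G != 0 -> ev2 c t z G != 0.
Proof.
move=> zfree t0 Pt G0; rewrite ev2E.
have inj : injective (ev c z).
  apply: raddf_inj => g e; apply/eqP; apply: contraT => /zfree[].
  by rewrite e eqxx.
set q := map_poly (ev c z) G.
have q0 : q != 0.
  apply: contra_neq G0 => e; apply/polyP => i; apply: inj.
  by rewrite -coef_map -/q e !coef0 rmorph0.
have qv i : q`_i != 0 -> P q`_i = 0.
  rewrite coef_map /= => qi; case: (zfree G`_i) => //.
  by apply: contraNneq qi => ->; rewrite rmorph0.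
have Ptn n : P (t ^+ n) = P t * n%:Z by rewrite valX; zlia.
have main (j : 'I_(size q)) : q`_j != 0 ->
   (forall i : 'I_(size q), i != j -> q`_i != 0 ->
      P t * j%:Z + 1 <= P t * i%:Z) -> q.[t] != 0.
  move=> qj h; rewrite horner_coef; apply: (@sum_strict_min _ _ j).
    by rewrite mulf_neq0 ?expf_neq0.
  move=> i ij; have [qi|qi] := eqVneq q`_i 0; first by rewrite qi mul0r vge0.
  rewrite vgeE ?mulf_neq0 ?expf_neq0 // !valM ?expf_neq0 // !qv // !Ptn !add0r.
  exact: h.
have szq : (0 < size q)%N by rewrite size_poly_gt0.
case: (ltrP 0 (P t)) => Pt0; last first.
  have lt : ((size q).-1 < size q)%N by rewrite prednK.
  apply: (main (Ordinal lt)) => /=; first by rewrite -lead_coefE lead_coef_eq0.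
  move=> i; rewrite -val_eqE /= => ne _.
  have : (i < (size q).-1)%N by rewrite ltn_neqAle ne -ltnS prednK /=.
  by apply: ltz_nmul_nat; rewrite lt_neqAle Pt.
have ex : exists i, q`_i != 0.
  by exists (size q).-1; rewrite -lead_coefE lead_coef_eq0.
case: (ex_minnP ex) => j qj jmin.
have jlt : (j < size q)%N.
  by rewrite ltnNge; apply: contraNN qj => /leq_sizeP ->.
apply: (main (Ordinal jlt)) => //= i ij /jmin ji.
have : (j < i)%N by rewrite ltn_neqAle ji andbT eq_sym -[j]/(val (Ordinal jlt)) val_eqE.
exact: ltz_mul_nat.
Qed.
End ValuationSums.

Section Residue.
Variables (k : closedFieldType) (K : fieldType) (c : {rmorphism k -> K}) (x : K).
Hypothesis x_free : forall g : {poly k}, g != 0 -> ev c x g != 0.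
Hypothesis x_alg : forall z, exists2 G : {poly {poly k}}, G != 0 & ev2 c z x G = 0.

Lemma prod_val0 (P : place c) z (g : {poly k}) :
  (forall a, z - c a != 0 /\ P (z - c a) = 0) -> g != 0 ->
  ev c z g != 0 /\ P (ev c z g) = 0.
Proof.
move=> h g0; have [rs -> _] := ev_split c z g.
have lg : c (lead_coef g) != 0 by rewrite fmorph_eq0 lead_coef_eq0.
have [p0 Pp] : \prod_(a <- rs) (z - c a) != 0 /\ P (\prod_(a <- rs) (z - c a)) = 0.
  apply: (big_ind (fun w => w != 0 /\ P w = 0)) => //.
    by rewrite oner_eq0 place_val1.
  by move=> u v [u0 Pu] [v0 Pv]; rewrite mulf_neq0 // valM // Pu Pv.
by rewrite mulf_neq0 // valM // Pp place_valC ?lead_coef_eq0.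
Qed.

(** If [z] had no residue in [k], all nonzero polynomials in [z] would be units at [P],
    and [z] would be algebraically independent of every element of nonzero value.  One
    of the elements [x - a] has nonzero value, for otherwise the same argument would
    make [x] independent of a uniformizer; but [z] is algebraic over [k(x)]. *)
Theorem residue_in_constants (P : place c) z : z != 0 -> P z = 0 ->
  exists2 a, a != 0 & vge P 1 (z - c a).
Proof.
move=> z0 Pz; apply: contrapT => no.
have zfree a : z - c a != 0 /\ P (z - c a) = 0.
  have [->|a0] := eqVneq a 0; first by rewrite rmorph0 subr0.
  have nv : ~~ vge P 1 (z - c a) by apply/negP => h; apply: no; exists a.
  by apply: unit_val nv; apply: vgeB; [rewrite -Pz vge_val | apply: vgeC].
have [a Pa] : exists a, P (x - c a) != 0.
  apply: contrapT => none.
  have xfree a : x - c a != 0 /\ P (x - c a) = 0.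
    split; first by have := x_free (negbT (polyXsubC_eq0 a)); rewrite rmorphB /= evX evC.
    by apply/eqP; apply: contraT => h; case: none; exists a.
  have [t t0 Pt] := uniformizer P; have [G G0 /eqP] := x_alg t.
  apply/negP; apply: (residually_free (P := P)) => //; last by rewrite Pt.
  by move=> g; apply: prod_val0.
have xa0 : x - c a != 0 by apply: contraNneq Pa => ->; rewrite place_val0.
have [G G0 e] := x_alg z.
have S0 : swapXY G \Po ('X + a%:P%:P) != 0.
  by rewrite comp_poly_eq0 ?swapXY_eq0 // size_XaddC.
have := residually_free (fun g => @prod_val0 P z g zfree) xa0 Pa S0.
rewrite ev2E map_comp_poly horner_comp rmorphD /= map_polyX map_polyC /= evC.
by rewrite hornerD hornerX hornerC subrK -ev2E ev2_swap e eqxx.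
Qed.
End Residue.

(** * The rational function field *)

Lemma frac_ex (R : idomainType) (z : {fraction R}) :
  exists a b, b != 0 /\ z = FracField.tofrac a / FracField.tofrac b.
Proof.
elim/quotW: z => x; exists \n_x, \d_x; split; first exact: denom_ratioP.
apply: (mulIf (x := FracField.tofrac \d_x)).
  by rewrite tofrac_eq0 denom_ratioP.
rewrite divfK ?tofrac_eq0 ?denom_ratioP //.
rewrite -[_ * _]/(FracField.mul _ _); unlock FracField.tofrac.
rewrite -FracField.pi_mul; apply/eqmodP => /=.
rewrite FracField.equivfE /FracField.mulf.
by rewrite !numden_Ratio ?oner_eq0 ?mulr1 ?denom_ratioP // mulrC.
Qed.

Lemma frac_cross (K : fieldType) (t p q p' q' : K) : q != 0 -> q' != 0 ->
  t * (p / q) = p' / q' -> t * p * q' = p' * q.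
Proof. by move=> q0 q0' /eqP; rewrite mulrA eqr_div // => /eqP. Qed.

Lemma expfz_sub (K : fieldType) (t : K) m n : t != 0 ->
  t ^ (m%:Z - n%:Z) = t ^+ m / t ^+ n.
Proof. by move=> t0; rewrite expfzDr // -invr_expz -!exprnP. Qed.

Lemma frac_scale (K : fieldType) (t u p q : K) : q != 0 -> u != 0 ->
  p * t / (q * u) = t / u * (p / q).
Proof. by move=> *; field; apply/andP. Qed.

Section RationalField.
Variables (k : closedFieldType) (kx : fieldType) (j : {rmorphism {poly k} -> kx}).
Hypothesis j_eq0 : forall p, (j p == 0) = (p == 0).
Hypothesis j_gen : forall z, exists a b, b != 0 /\ z = j a / j b.
Local Notation "p %:F" := (j p) (at level 1, format "p %:F").

Definition cx : {rmorphism k -> kx} := j \o polyC.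

Lemma ev_rat (p : {poly k}) : ev cx 'X%:F p = p%:F.
Proof.
elim/poly_ind: p => [|p a IH]; first by rewrite !rmorph0.
by rewrite !rmorphD !rmorphM /= IH evX evC.
Qed.

Let j_inj : injective j.
Proof. by apply: raddf_inj => p /eqP; rewrite j_eq0 => /eqP. Qed.

Definition rat_linear (Q : place cx) a := Q ('X - a%:P)%:F.

Lemma rat_linear_neq0 (a : k) : ('X - a%:P)%:F != 0.
Proof. by rewrite j_eq0 polyXsubC_eq0. Qed.

Lemma rat_linear_sub a b : ('X - a%:P)%:F = ('X - b%:P)%:F + cx (b - a).
Proof. by rewrite -[cx _]/((b - a)%:P%:F) -rmorphD polyCB addrA subrK. Qed.

Lemma rat_poly_val (Q : place cx) (p : {poly k}) : p != 0 ->
  exists2 rs : seq k, Q p%:F = \sum_(a <- rs) rat_linear Q a &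
    p = lead_coef p *: \prod_(a <- rs) ('X - a%:P).
Proof.
move=> p0; have [rs _ pE] := ev_split cx 'X%:F p; exists rs => //.
have h (s : seq k) : (\prod_(a <- s) ('X - a%:P))%:F != 0 /\
   Q (\prod_(a <- s) ('X - a%:P))%:F = \sum_(a <- s) rat_linear Q a.
  elim: s => [|a s [IH0 IH]].
    by rewrite !big_nil rmorph1 oner_eq0 place_val1.
  rewrite !big_cons rmorphM /= mulf_neq0 ?rat_linear_neq0 //; split=> //.
  by rewrite valM ?rat_linear_neq0 // IH.
rewrite {1}pE -mul_polyC rmorphM /= valM; last exact: (h rs).1.
  by rewrite (h rs).2 (place_valC Q) ?lead_coef_eq0 // add0r.
by rewrite j_eq0 polyC_eq0 lead_coef_eq0.
Qed.

Lemma rat_place_ext (Q Q' : place cx) : rat_linear Q =1 rat_linear Q' -> Q = Q'.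
Proof.
move=> e.
have ep p : Q p%:F = Q' p%:F.
  have [->|p0] := eqVneq p 0; first by rewrite rmorph0 !place_val0.
  have [rs -> pE] := rat_poly_val Q p0.
  have [rs' -> pE'] := rat_poly_val Q' p0.
  have perm : perm_eq rs rs'.
    apply: prod_XsubC_eq.
    have l0 : lead_coef p != 0 by rewrite lead_coef_eq0.
    by apply: (scalerI l0); rewrite -pE -pE'.
  by rewrite (perm_big _ perm); apply: eq_bigr => a _; apply: e.
apply: place_ext => z; have [a [b [b0 ->]]] := j_gen z.
rewrite mulf_eq0 invr_eq0 !j_eq0 negb_or => /andP[a0 _].
by rewrite !valM ?invr_eq0 ?j_eq0 // !valV !ep.
Qed.

(** The linear polynomials generate the multiplicative group modulo constants, and a
    place takes the value 1. *)
Lemma rat_linear_gcd (Q : place cx) (e : int) :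
  (forall a, exists m, rat_linear Q a = e * m) -> e = 1 \/ e = -1.
Proof.
move=> h.
have hp p : p != 0 -> exists m, Q p%:F = e * m.
  move=> /(rat_poly_val Q)[rs -> _].
  apply: (big_ind (fun n => exists m, n = e * m)) => //.
    by exists 0; rewrite mulr0.
  by move=> _ _ [m ->] [n ->]; exists (m + n); rewrite mulrDr.
have [z z0] := uniformizer Q; have [a [b [b0 zE]]] := j_gen z.
have a0 : a != 0 by apply: contraNneq z0 => a0; rewrite zE a0 rmorph0 mul0r.
rewrite zE valM ?invr_eq0 ?j_eq0 // valV.
have [m ->] := hp a a0; have [n ->] := hp b b0.
rewrite -mulrBr; move: (m - n) => x ex.
have x0 : x != 0 by apply/eqP => x0; move: ex; rewrite x0; zlia.
by case: (ltrP 0 x) => hx; [left | right]; znia.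
Qed.

Lemma rat_finite_place (Q : place cx) : 0 <= Q 'X%:F ->
  exists2 a, rat_linear Q a = 1 & forall b, b != a -> rat_linear Q b = 0.
Proof.
move=> QX.
have ge0 a : 0 <= rat_linear Q a.
  have : vge Q 0 ('X - a%:P)%:F.
    rewrite rmorphB; apply: vgeB; last exact: (vgeC Q).
    by rewrite vgeE // j_eq0 polyX_eq0.
  by rewrite vgeE // rat_linear_neq0.
have [a Qa] : exists a, rat_linear Q a != 0.
  apply: contrapT => no; have [] := @rat_linear_gcd Q 0; last by [].
    move=> a; exists 0; rewrite mulr0; apply/eqP; apply: contraT => h.
    by case: no; exists a.
  by [].
have others b : b != a -> rat_linear Q b = 0.
  move=> ba; have ab0 : a - b != 0 by rewrite subr_eq0 eq_sym.
  have Qab : Q (cx (a - b)) = 0 by apply: place_valC.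
  have [] := @val_addr _ _ _ Q (cx (a - b)) ('X - a%:P)%:F.
  - by rewrite fmorph_eq0.
  - by rewrite Qab vgeE ?rat_linear_neq0 //; have := ge0 a; move: Qa; rewrite /rat_linear; zlia.
  by rewrite Qab addrC -rat_linear_sub.
exists a => //.
have [//|//|] := @rat_linear_gcd Q (rat_linear Q a); last first.
  by have := ge0 a; zlia.
move=> b; have [->|ba] := eqVneq b a; first by exists 1; rewrite mulr1.
by exists 0; rewrite others // mulr0.
Qed.

Lemma rat_infinite_place (Q : place cx) : Q 'X%:F < 0 ->
  forall a, rat_linear Q a = -1.
Proof.
move=> QX.
have all a : rat_linear Q a = Q 'X%:F.
  have [] := @val_addr _ _ _ Q 'X%:F (cx (- a)).
  - by rewrite j_eq0 polyX_eq0.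
  - by apply: vge_le (vgeC Q (- a)); zlia.
  by rewrite -rmorphD /= polyCN.
have [||e] := @rat_linear_gcd Q (Q 'X%:F).
- by move=> a; exists 1; rewrite mulr1.
- by move: QX; zlia.
- by move=> a; rewrite all.
Qed.

(** The divisor of a product of linear polynomials can be prescribed freely at the
    finite places; the place at infinity absorbs the degree. *)
Lemma rat_principal (D : divisor cx) : deg D = 0 -> principal D.
Proof.
have [f f0 fD] : exists2 f, f != 0 & forall Q : place cx,
    Q f = coeff Q D - (if 0 <= Q 'X%:F then 0 else deg D).
  elim/freeg_ind_dom0: D => [|n Q0 D _ _ [f f0 IH]].
    exists 1; first exact: oner_neq0.
    by move=> Q; rewrite place_val1 coeff0 deg0 if_same subr0.
  have [g g0 gE] : exists2 g, g != 0 & forall Q : place cx,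
      Q g = (Q0 == Q)%:R - (if 0 <= Q 'X%:F then 0 else 1).
    case: (lerP 0 (Q0 'X%:F)) => fin0.
      have [a Qa Qb] := rat_finite_place fin0.
      exists ('X - a%:P)%:F; first exact: rat_linear_neq0.
      move=> Q; case: ifP => [fin|/negbT]; last first.
        rewrite -ltNge => inf; rewrite -[LHS]/(rat_linear Q a).
        rewrite rat_infinite_place //; case: eqP => // e; move: fin0; rewrite e.
        by move: inf; zlia.
      have [a' Qa' Qb'] := rat_finite_place fin; rewrite subr0.
      rewrite -[LHS]/(rat_linear Q a).
      have [aa|aa] := eqVneq a a'.
        subst a'; rewrite Qa'; suff -> : Q0 = Q by rewrite eqxx.
        apply: rat_place_ext => b; have [->|ba] := eqVneq b a; first by rewrite Qa.
        by rewrite Qb // Qb'.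
      rewrite Qb' //; case: eqP => // e; subst Q0.
      by have := Qb' _ aa; rewrite Qa.
    exists 1; first exact: oner_neq0.
    move=> Q; rewrite place_val1; case: ifP => [fin|/negbT].
      by case: eqP => // e; move: fin0; rewrite e; zlia.
    rewrite -ltNge => inf; suff -> : Q0 = Q by rewrite eqxx.
    by apply: rat_place_ext => a; rewrite !rat_infinite_place.
  exists (g ^ n * f); first by rewrite mulf_neq0 ?expfz_neq0.
  move=> Q; rewrite valM ?expfz_neq0 // valXz gE IH degD degU coeffD coeffU.
  by case: ifP => _; ring.
move=> dD; apply/asboolP; exists f => // Q.
by rewrite fD dD if_same subr0.
Qed.

Lemma rat_finite_place_ex (a : k) : exists Q : place cx,
  forall m (q : {poly k}), ~~ root q a -> Q (q * ('X - a%:P) ^+ m)%:F = m.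
Proof.
pose U (z : kx) := exists p q : {poly k},
  [/\ ~~ root p a, ~~ root q a & z = p%:F / q%:F].
pose R (z : kx) := exists p q : {poly k}, ~~ root q a /\ z = p%:F / q%:F.
have r0 (p : {poly k}) : ~~ root p a -> p%:F != 0.
  by rewrite j_eq0; apply: contraNneq => ->; rewrite root0.
have r1 : ~~ root (1 : {poly k}) a by rewrite root1.
have t0 := rat_linear_neq0 a.
have Rt : R ('X - a%:P)%:F.
  by exists ('X - a%:P), 1; rewrite rmorph1 divr1.
have RD x y : R x -> R y -> R (x + y).
  move=> [p [q [q0 ->]]] [p' [q' [q0' ->]]].
  exists (p * q' + p' * q), (q * q'); rewrite rootM negb_or q0 q0'; split=> //.
  by rewrite addf_div ?r0 // rmorphD !rmorphM.
have RM x y : R x -> R y -> R (x * y).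
  move=> [p [q [q0 ->]]] [p' [q' [q0' ->]]].
  exists (p * p'), (q * q'); rewrite rootM negb_or q0 q0'; split=> //.
  by rewrite mulf_div !rmorphM.
have UR x : U x -> R x by move=> [p [q [p0 q0 ->]]]; exists p, q.
have UM x y : U x -> U y -> U (x * y).
  move=> [p [q [p0 q0 ->]]] [p' [q' [p0' q0' ->]]].
  exists (p * p'), (q * q'); rewrite !rootM !negb_or p0 q0 p0' q0'; split=> //.
  by rewrite mulf_div !rmorphM.
have UC b : b != 0 -> U (cx b).
  move=> b0; exists b%:P, 1; rewrite rmorph1 divr1; split=> //.
  by rewrite rootC.
have U0 : ~ U 0.
  move=> [p [q [p0 q0 /esym/eqP]]].
  by rewrite mulf_eq0 invr_eq0 (negbTE (r0 _ p0)) (negbTE (r0 _ q0)).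
have Ut x : R x -> ~ U (('X - a%:P)%:F * x).
  move=> [p [q [q0 ->]]] [p' [q' [p0' q0' e]]].
  have : ((('X - a%:P) * p * q')%:F == (p' * q)%:F).
    rewrite !rmorphM /=; apply/eqP.
    by apply: frac_cross e; apply: r0.
  rewrite (inj_eq j_inj) => /eqP /(congr1 (fun r => root r a)).
  by rewrite !rootM root_XsubC eqxx (negbTE p0') (negbTE q0).
have fact p : p != 0 -> exists m q, ~~ root q a /\ p = q * ('X - a%:P) ^+ m.
  move=> p0; have [m [q]] := multiplicity_XsubC p a; rewrite p0 /= => ? ?.
  by exists m, q.
have tU z : z != 0 -> exists (n : int) x y,
    [/\ U x, U y & z = ('X - a%:P)%:F ^ n * (x / y)].
  have [p [q [q0 ->]]] := j_gen z => z0.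
  have p0 : p != 0 by apply: contraNneq z0 => ->; rewrite rmorph0 mul0r.
  have [m [p' [rp' ->]]] := fact p p0; have [n [q' [rq' ->]]] := fact q q0.
  exists (m%:Z - n%:Z), p'%:F, q'%:F; split.
  - by exists p', 1; rewrite rmorph1 divr1.
  - by exists q', 1; rewrite rmorph1 divr1.
  rewrite (expfz_sub _ _ t0).
  have FE r l : (r * ('X - a%:P) ^+ l)%:F = r%:F * ('X - a%:P)%:F ^+ l.
    by rewrite rmorphM rmorphXn.
  by rewrite !FE; apply: frac_scale; [apply: r0 | apply: expf_neq0].
have [Q [QU Qt _]] := place_of_units t0 Rt RD RM UR UM UC U0 Ut tU.
exists Q => m q rq.
have Uq : U q%:F by exists q, 1; rewrite rmorph1 divr1.
have tm0 : ('X - a%:P)%:F ^+ m != 0 by apply: expf_neq0.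
rewrite rmorphM rmorphXn /= (valM Q (r0 _ rq) tm0) (QU _ Uq) add0r valX Qt.
exact: natz.
Qed.

End RationalField.

(** The universal property of fraction fields, for a ring that need not embed: [f] and
    [g] only need to have the same kernel. *)
Section FractionLift.
Variables (R : comNzRingType) (K L : fieldType).
Variables (f : {rmorphism R -> K}) (g : {rmorphism R -> L}).
Hypothesis gen : forall z, exists a b, f b != 0 /\ z = f a / f b.
Hypothesis fg : forall a, f a = 0 <-> g a = 0.

Let g_neq0 a : f a != 0 -> g a != 0.
Proof. by apply: contra_neq => /fg. Qed.

Let num z := projT1 (cid (gen z)).
Let den z := projT1 (cid (projT2 (cid (gen z)))).
Let numden z : f (den z) != 0 /\ z = f (num z) / f (den z).
Proof. by rewrite /den /num; case: cid => a /= h; case: cid. Qed.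

Let lift_fun z := g (num z) / g (den z).

Let lift_funE a b : f b != 0 -> lift_fun (f a / f b) = g a / g b.
Proof.
move=> b0; have [d0 /eqP] := numden (f a / f b).
rewrite /lift_fun; set n := num _; set d := den _ in d0 *.
rewrite eqr_div // -!rmorphM -subr_eq0 -rmorphB => /eqP/fg/eqP.
rewrite rmorphB !rmorphM subr_eq0 => /eqP e.
by apply/eqP; rewrite eqr_div ?g_neq0 //= e.
Qed.

Let lift_is_zmod_morphism : zmod_morphism lift_fun.
Proof.
move=> y z; have [d0 ->] := numden y; have [d0' ->] := numden z.
rewrite -mulNr -rmorphN addf_div // -!rmorphM -rmorphD.
rewrite !lift_funE ?rmorphM ?mulf_neq0 //.
by rewrite rmorphD !rmorphM rmorphN -mulNr addf_div ?g_neq0.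
Qed.

Let lift_is_monoid_morphism : monoid_morphism lift_fun.
Proof.
split=> [|y z].
  have := @lift_funE 1 1; rewrite !rmorph1 divr1 => -> //.
    by rewrite divr1.
  exact: oner_neq0.
have [d0 ->] := numden y; have [d0' ->] := numden z.
rewrite mulf_div -!rmorphM !lift_funE ?rmorphM ?mulf_neq0 //.
by rewrite mulf_div.
Qed.

Lemma fraction_lift : exists phi : {rmorphism K -> L}, forall a, phi (f a) = g a.
Proof.
pose m1 := GRing.isZmodMorphism.Build _ _ lift_fun lift_is_zmod_morphism.
pose m2 := GRing.isMonoidMorphism.Build _ _ lift_fun lift_is_monoid_morphism.
pose phi : {rmorphism K -> L} := HB.pack lift_fun m1 m2.
exists phi => a; have := @lift_funE a 1.
by rewrite !rmorph1 !divr1; apply; apply: oner_neq0.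
Qed.
End FractionLift.

(** * Hyperelliptic function fields *)

Section EvMorphism.
Variables (k K L : fieldType) (c : {rmorphism k -> K}).
Lemma ev_rmorph (f : {rmorphism K -> L}) (cL : {rmorphism k -> L}) x p :
  (forall a, f (c a) = cL a) -> f (ev c x p) = ev cL (f x) p.
Proof.
move=> fc; elim/poly_ind: p => [|p a IH]; first by rewrite !rmorph0.
by rewrite !rmorphD !rmorphM /= IH !evX !evC fc.
Qed.

Lemma ev2_constX x y p : ev2 c x y (p ^:P) = ev c x p.
Proof. by rewrite -swapXY_polyC ev2_swap ev2C. Qed.

Lemma ev2_Y x y : ev2 c x y 'Y = y.
Proof. by rewrite ev2C evX. Qed.
End EvMorphism.

Section Hyperelliptic.
Variables (k : fieldType).

Definition hyper_eq (h : {poly k}) : {poly {poly k}} := 'Y ^+ 2 - h ^:P.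

Lemma ev2_hyper_eq (K : fieldType) (c : {rmorphism k -> K}) x y h :
  ev2 c x y (hyper_eq h) = y ^+ 2 - ev c x h.
Proof.
by rewrite /hyper_eq expr2 ev2B ev2M ev2_Y ev2_constX -expr2.
Qed.

Lemma ev2_line (K : fieldType) (c : {rmorphism k -> K}) x y A B :
  ev2 c x y (A ^:P + B ^:P * 'Y) = ev c x A + ev c x B * y.
Proof.
by rewrite ev2D ev2M ev2_Y !ev2_constX.
Qed.

Lemma swapXYD (p q : {poly {poly k}}) : swapXY (p + q) = swapXY p + swapXY q.
Proof. exact: raddfD. Qed.

Lemma swapXYM (p q : {poly {poly k}}) : swapXY (p * q) = swapXY p * swapXY q.
Proof. exact: (swapXY_is_monoid_morphism _).2. Qed.

Lemma swapXY_hyper_eq h : swapXY (hyper_eq h) = 'X^2 - h%:P.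
Proof.
rewrite /hyper_eq swapXY_is_zmod_morphism swapXY_map_polyC expr2.
by rewrite swapXYM swapXY_Y -expr2.
Qed.

Lemma swapXY_line A B :
  swapXY (A ^:P + B ^:P * 'Y) = A%:P + B%:P * 'X :> {poly {poly k}}.
Proof. by rewrite swapXYD swapXYM !swapXY_map_polyC swapXY_Y. Qed.

(** Division by the equation, which is monic of degree 2 in ['Y]; the swap makes that
    variable the outer one. *)
Lemma hyper_normal_form h (G : {poly {poly k}}) : exists Q A B,
  G = Q * hyper_eq h + (A ^:P + B ^:P * 'Y).
Proof.
pose q : {poly {poly k}} := 'X ^+ 2 - h%:P.
have q_monic : q \is monic by rewrite monicXnsubC.
have sq : size q = 3 by rewrite size_XnsubC.
pose r := Pdiv.Ring.rmodp (swapXY G) q.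
have sr : (size r <= 2)%N.
  have : (size r < size q)%N by rewrite Pdiv.Ring.ltn_rmodp -size_poly_gt0 sq.
  by rewrite sq ltnS.
exists (swapXY (Pdiv.Ring.rdivp (swapXY G) q)), r`_0, r`_1.
have rE : r = (r`_0)%:P + (r`_1)%:P * 'X.
  apply/polyP => -[|[|i]]; rewrite coefD coefC coefMX coefC ?addr0 ?add0r //.
  by rewrite nth_default // (leq_trans sr).
apply: (can_inj swapXYK).
rewrite swapXYD swapXYM swapXYK swapXY_hyper_eq swapXY_line -rE.
exact: Pdiv.RingMonic.rdivp_eq.
Qed.

Lemma ev2_normal_form (K : fieldType) (c : {rmorphism k -> K}) x y h G Q A B : y ^+ 2 = ev c x h ->
  G = Q * hyper_eq h + (A ^:P + B ^:P * 'Y) ->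
  ev2 c x y G = ev c x A + ev c x B * y.
Proof.
move=> yh ->; rewrite ev2D ev2M.
by rewrite ev2_hyper_eq ev2_line yh subrr mulr0 add0r.
Qed.

Section Equation.
Variables (K : fieldType) (c : {rmorphism k -> K}) (x y : K) (h : {poly k}).

(** The fraction field of the curve [y^2 = h(x)] in terms of normal forms
    [(A(x) + B(x) y) / C(x)], which spare polynomials in two variables. *)
Definition hyperelliptic := [/\ y ^+ 2 = ev c x h,
  forall A B, ev c x A + ev c x B * y = 0 -> A = 0 /\ B = 0 &
  forall z, exists A B C, C != 0 /\ z = (ev c x A + ev c x B * y) / ev c x C].

Hypothesis yh : y ^+ 2 = ev c x h.
Hypothesis free : forall A B, ev c x A + ev c x B * y = 0 -> A = 0 /\ B = 0.
Hypothesis gen : forall z, exists A B C, C != 0 /\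
  z = (ev c x A + ev c x B * y) / ev c x C.

Lemma hyper_x_free g : g != 0 -> ev c x g != 0.
Proof.
move=> g0; apply/eqP => e; have := @free g 0.
by rewrite e rmorph0 mul0r addr0 => /(_ erefl)[g0' _]; rewrite g0' eqxx in g0.
Qed.

Lemma hyper_y_neq0 : y != 0.
Proof.
apply/eqP => e; have := @free 0 1.
rewrite e mulr0 rmorph0 addr0 => /(_ erefl)[_ /eqP]; by rewrite oner_eq0.
Qed.

Lemma hyper_x_alg z : exists2 G : {poly {poly k}}, G != 0 & ev2 c z x G = 0.
Proof.
have [A [B [C [C0 zE]]]] := gen z.
have eC := hyper_x_free C0.
exists ((C%:P * 'X - A%:P) ^+ 2 - (B ^+ 2 * h)%:P).
  apply/eqP => /(congr1 (fun p : {poly {poly k}} => p`_2)).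
  rewrite (_ : _ - _ = (C ^+ 2)%:P * 'X ^+ 2 + (- (2 * (C * A)))%:P * 'X
     + (A ^+ 2 - B ^+ 2 * h)%:P); last first.
    by rewrite !(polyCN, polyCB, polyCM, polyC_exp, polyC_natr); ring.
  rewrite !coefD coefCM coefXn mulr1 coefMX !coefC /= !addr0 => /eqP.
  by rewrite expf_eq0 (negbTE C0).
have e2 : ev c x (B ^+ 2 * h) = (ev c x B * y) ^+ 2.
  by rewrite rmorphM rmorphXn /= -yh exprMn.
have e3 : ev2 c z x (C%:P * 'X - A%:P) = ev c x C * z - ev c x A.
  by rewrite ev2B ev2M ev2X !ev2C.
rewrite expr2 ev2B ev2M e3 ev2C e2 zE -expr2.
by rewrite mulrCA mulfV // mulr1 addrAC subrr add0r subrr.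
Qed.

Lemma hyper_conj_neq0 A B : ev c x A + ev c x B * y != 0 ->
  ev c x A - ev c x B * y != 0.
Proof.
apply: contra_neq => e; have := @free A (- B).
by rewrite rmorphN mulNr e => /(_ erefl)[-> /eqP]; rewrite oppr_eq0 => /eqP ->;
  rewrite !rmorph0 mul0r addr0.
Qed.

Lemma hyper_norm_neq0 A B : ev c x A + ev c x B * y != 0 ->
  A ^+ 2 - B ^+ 2 * h != 0.
Proof.
move=> z0; have := mulf_neq0 z0 (hyper_conj_neq0 z0).
rewrite mulrC -subr_sqr exprMn yh -!rmorphXn -rmorphM -rmorphB.
by apply: contraNneq => ->; rewrite rmorph0.
Qed.

Section Lift.
Variables (L : fieldType) (cL : {rmorphism k -> L}) (x' y' : L).
Hypotheses (yh' : y' ^+ 2 = ev cL x' h) (x'_free : forall g, g != 0 -> ev cL x' g != 0).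

(** Maps out of a hyperelliptic field are solutions of its equation.  Mere freeness of
    [x'] suffices for injectivity, since the kernel would contain a norm. *)
Lemma hyper_lift : exists phi : {rmorphism K -> L},
  [/\ forall a, phi (c a) = cL a, phi x = x' & phi y = y'].
Proof.
have nf G : exists A B, ev2 c x y G = ev c x A + ev c x B * y /\
    ev2 cL x' y' G = ev cL x' A + ev cL x' B * y'.
  have [Q [A [B GE]]] := hyper_normal_form h G; exists A, B.
  split; first exact: ev2_normal_form GE.
  exact: ev2_normal_form GE.
have [||phi phiE] := @fraction_lift {poly {poly k}} _ _ (ev2 c x y) (ev2 cL x' y').
- move=> z; have [A [B [C [C0 ->]]]] := gen z.
  exists (A ^:P + B ^:P * 'Y), (C ^:P).
  by rewrite /= ev2_line ev2_constX hyper_x_free.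
- move=> G; have [A [B [/= -> ->]]] := nf G; split.
    by move=> /free[-> ->]; rewrite !rmorph0 mul0r addr0.
  move=> e; apply/eqP; apply: contraT => /hyper_norm_neq0 /x'_free.
  rewrite rmorphB !expr2 !rmorphM /= -yh'.
  set a := ev _ _ A in e *; set b := ev _ _ B in e *.
  have -> : a * a - b * b * y' ^+ 2 = (a + b * y') * (a - b * y') by ring.
  by rewrite e mul0r eqxx.
exists phi; split.
- by move=> a; rewrite -(evC c x a) -(ev2_constX c x y) phiE /= ev2_constX evC.
- by rewrite -(ev2X c x y) phiE /= ev2X.
- by rewrite -(ev2_Y c x y) phiE /= ev2_Y.
Qed.
End Lift.

Lemma hyper_ext (L : fieldType) (f g : {rmorphism K -> L}) :
  (forall a, f (c a) = g (c a)) -> f x = g x -> f y = g y -> f =1 g.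
Proof.
move=> ec ex ey z; have [A [B [C [_ ->]]]] := gen z.
have evE p : f (ev c x p) = g (ev c x p).
  by rewrite (@ev_rmorph _ _ _ _ f (g \o c)) // (@ev_rmorph _ _ _ _ g (g \o c)) // ex.
by rewrite !fmorph_div !rmorphD !rmorphM /= !evE ey.
Qed.
End Equation.

(** The denominators are made free of [y] by multiplying with the conjugate. *)
Lemma function_field_hyper h (X : function_field (hyper_eq h)) :
  hyperelliptic (ff_const X) (ff_x X) (ff_y X) h.
Proof.
pose c := ff_const X; pose x := ff_x X; pose y := ff_y X.
have evE G : ff_eval X G = ev2 c x y G by rewrite ev2.unlock.
have yh : y ^+ 2 = ev c x h.
  have : ff_eval X (hyper_eq h) = 0 by apply/ff_rel; exists 1; rewrite mul1r.
  by rewrite evE ev2_hyper_eq => /eqP; rewrite subr_eq0 => /eqP.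
have free A B : ev c x A + ev c x B * y = 0 -> A = 0 /\ B = 0.
  move=> e; have : ff_eval X (A ^:P + B ^:P * 'Y) = 0.
    by rewrite evE ev2_line.
  move=> /ff_rel[Q]; move=> /(congr1 swapXY).
  rewrite swapXY_line swapXYM swapXY_hyper_eq => GE.
  have Q0 : swapXY Q = 0.
    apply/eqP; apply: contraT => Q0; have := congr1 (fun p : {poly {poly k}} => size p) GE.
    rewrite size_Mmonic ?monicXnsubC // size_XnsubC // addn3 /= => sz.
    have : (size (A%:P + B%:P * 'X : {poly {poly k}})%R <= 2)%N.
      rewrite (leq_trans (size_polyD _ _)) // geq_max (leq_trans (size_polyC_leq1 _)) //=.
      rewrite (leq_trans (size_polyMleq _ _)) // size_polyX addn2 /= ltnS.
      exact: size_polyC_leq1.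
    by rewrite sz ltnS; move: Q0; rewrite -size_poly_gt0; case: size.
  rewrite Q0 mul0r in GE; split.
    by have := congr1 (fun p : {poly {poly k}} => p`_0) GE; rewrite coefD coefC coefMX addr0 coef0.
  by have := congr1 (fun p : {poly {poly k}} => p`_1) GE; rewrite coefD coefC coefMX coefC coef0 add0r.
split=> // z; have [G [H [H0 ->]]] := ff_gen z.
rewrite !evE in H0 *.
have [Q [A [B GE]]] := hyper_normal_form h G.
have [Q' [A' [B' HE]]] := hyper_normal_form h H.
rewrite (ev2_normal_form yh GE); rewrite (ev2_normal_form yh HE) in H0 *.
exists (A * A' - B * B' * h), (B * A' - A * B'), (A' ^+ 2 - B' ^+ 2 * h).
split; first exact: hyper_norm_neq0 H0.
have conj0 := hyper_conj_neq0 free H0.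
rewrite !rmorphB !expr2 !rmorphM /= -yh.
set a := ev c x A; set b := ev c x B; set a' := ev c x A' in H0 conj0 *.
set b' := ev c x B' in H0 conj0 *.
have -> : a' * a' - b' * b' * y ^+ 2 = (a' + b' * y) * (a' - b' * y) by ring.
by rewrite -/y; field; rewrite H0 conj0.
Qed.
End Hyperelliptic.

Lemma hyper_residue (k : closedFieldType) (K : fieldType) (c : {rmorphism k -> K})
    x y h (P : place c) z : hyperelliptic c x y h -> z != 0 -> P z = 0 ->
  exists2 a, a != 0 & vge P 1 (z - c a).
Proof.
move=> [yh free gen]; apply: (residue_in_constants (x := x)).
  exact: hyper_x_free free.
exact: hyper_x_alg yh free gen.
Qed.

Lemma iso_div_irrelevance (k A : fieldType) (cA : {rmorphism k -> A})
    (sg : {rmorphism A -> A}) (p1 p2 : forall a, sg (cA a) = cA a)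
    (q1 q2 : involutive sg) : iso_div p1 q1 = iso_div p2 q2.
Proof. by rewrite (Prop_irrelevance p1 p2) (Prop_irrelevance q1 q2). Qed.

(** The elements [i a + i b t] form a field, so that they are everything as soon as
    they include the generators [x] and [y]. *)
Section GeneratedBy.
Variables (k A B : fieldType) (c : {rmorphism k -> A}) (cB : {rmorphism k -> B}).
Variables (x y : A) (h : {poly k}).
Variables (i : {rmorphism B -> A}) (sg : {rmorphism A -> A}) (s : B) (t : A).
Hypotheses (ic : forall a, i (cB a) = c a) (sgi : forall b, sg (i b) = i b).
Hypotheses (t2 : t ^+ 2 = i s) (sgt : sg t = - t).
Hypothesis gen : forall z, exists P Q C, C != 0 /\
  z = (ev c x P + ev c x Q * y) / ev c x C.

Let S z := exists a b, z = i a + i b * t.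

Let SD w z : S w -> S z -> S (w + z).
Proof.
move=> [a [b ->]] [a' [b' ->]]; exists (a + a'), (b + b').
by rewrite !rmorphD /=; ring.
Qed.

Let SM w z : S w -> S z -> S (w * z).
Proof.
move=> [a [b ->]] [a' [b' ->]]; exists (a * a' + b * b' * s), (a * b' + a' * b).
by rewrite !rmorphD !rmorphM /= -t2; ring.
Qed.

Let SV z : S z -> S z^-1.
Proof.
move=> [a [b zE]]; have [->|z0] := eqVneq z 0.
  by exists 0, 0; rewrite invr0 rmorph0 mul0r addr0.
have szE : sg z = i a - i b * t.
  by rewrite zE rmorphD rmorphM /= !sgi sgt mulrN.
have sz0 : i a - i b * t != 0 by rewrite -szE fmorph_eq0.
pose n := a * a - b * b * s.
have nE : i n = z * (i a - i b * t).
  by rewrite zE rmorphB !rmorphM /= -t2; ring.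
have n0 : i n != 0 by rewrite nE mulf_neq0.
exists (a / n), (- b / n); rewrite !rmorphM rmorphN /= !fmorphV nE.
by field; rewrite z0 sz0.
Qed.

Let Si b : S (i b).
Proof. by exists b, 0; rewrite rmorph0 mul0r addr0. Qed.

Lemma generated_by_quadratic : S x -> S y -> forall z, S z.
Proof.
move=> Sx Sy z; have Sev p : S (ev c x p).
  elim/poly_ind: p => [|p a IH]; first by rewrite rmorph0 -(rmorph0 i); apply: Si.
  rewrite rmorphD rmorphM /= evX evC -ic.
  by apply: SD; [apply: SM | apply: Si].
have [P [Q [C [_ ->]]]] := gen z.
by apply: SM; [apply: SD; [|apply: SM] | apply: SV].
Qed.
End GeneratedBy.

(** * The hyperelliptic involution *)

Section HyperellipticInvolution.
Variables (k : closedFieldType) (K kx : fieldType) (c : {rmorphism k -> K}).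
Variable j : {rmorphism {poly k} -> kx}.
Hypothesis two_neq0 : (2 : k) != 0.
Hypothesis j_eq0 : forall p, (j p == 0) = (p == 0).
Hypothesis j_gen : forall z, exists a b, b != 0 /\ z = j a / j b.
Variables (x y : K) (h : {poly k}).
Hypothesis hyp : hyperelliptic c x y h.

Lemma rational_subfield : exists i : {rmorphism kx -> K}, forall p, i (j p) = ev c x p.
Proof.
have [_ free _] := hyp.
apply: (@fraction_lift {poly k} kx K j (ev c x)).
  by move=> z; have [a [b [b0 ->]]] := j_gen z; exists a, b; rewrite j_eq0.
move=> a; split; first by move/eqP; rewrite j_eq0 => /eqP ->; rewrite rmorph0.
by move=> e; apply/eqP; rewrite j_eq0; apply: contraT => /(hyper_x_free free);
  rewrite e eqxx.
Qed.

Lemma rat_residue (Q : place (cx j)) z : z != 0 -> Q z = 0 ->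
  exists2 a, a != 0 & vge Q 1 (z - cx j a).
Proof.
have evj p : ev (cx j) (j 'X) p = j p by exact: ev_rat.
apply: (residue_in_constants (x := j 'X)).
  by move=> g g0; rewrite evj j_eq0.
move=> {}z; have [a [b [b0 ->]]] := j_gen z.
exists (b%:P * 'X - a%:P).
  apply/eqP => /(congr1 (fun p : {poly {poly k}} => p`_1)).
  by rewrite coefB coefCM coefX mulr1 coefC subr0 coef0 => /eqP; rewrite (negbTE b0).
rewrite ev2B ev2M ev2X !ev2C !evj mulrC divfK ?subrr //.
by rewrite j_eq0.
Qed.

Lemma hyper_involution : exists io : {rmorphism K -> K},
  [/\ forall a, io (c a) = c a, io x = x, io y = - y & involutive io].
Proof.
have [yh free gen] := hyp.
have xfree := hyper_x_free free.
have [|io [ioc iox ioy]] := hyper_lift yh free gen (cL := c) (y' := - y) _ xfree.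
  by rewrite sqrrN.
exists io; split=> //.
have := @hyper_ext _ _ c x y gen K (io \o io) idfun; apply=> /=.
- by move=> a; rewrite !ioc.
- by rewrite !iox.
- by rewrite ioy rmorphN ioy opprK.
Qed.

Lemma rational_quadratic (io : {rmorphism K -> K}) :
  (forall a, io (c a) = c a) -> io x = x -> io y = - y ->
  exists i : {rmorphism kx -> K},
    [/\ forall g, i (j g) = ev c x g, forall a, i (cx j a) = c a,
        forall b, io (i b) = i b & forall z, exists a b, z = i a + i b * y].
Proof.
move=> ioc iox ioy; have [yh free gen] := hyp.
have [i iE] := rational_subfield; exists i.
have ic a : i (cx j a) = c a by rewrite /cx /= iE evC.
have ioi b : io (i b) = i b.
  have [p [q [_ ->]]] := j_gen b.
  by rewrite !fmorph_div !iE !(ev_rmorph _ _ ioc) iox.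
have t2 : y ^+ 2 = i (j h) by rewrite iE.
split=> //; apply: (generated_by_quadratic ic ioi t2 ioy gen).
  by exists (j 'X), 0; rewrite iE evX rmorph0 mul0r addr0.
by exists 0, 1; rewrite rmorph0 rmorph1 mul1r add0r.
Qed.

(** [D + iota D] is pulled back from a divisor of degree 0 on the projective line, and
    all those are principal. *)
Theorem involution_neg (io : {rmorphism K -> K}) (ioc : forall a, io (c a) = c a)
    (ioK : involutive io) : io x = x -> io y = - y ->
  forall D, deg D = 0 -> principal (D + iso_div ioc ioK D).
Proof.
move=> iox ioy D dD; have [yh free gen] := hyp.
have [i [iE ic ioi genS]] := rational_quadratic ioc iox ioy.
have t2 : y ^+ 2 = i (j h) by rewrite iE.
have t0 : y != 0 := hyper_y_neq0 free.
have [up [dn [upc dnc _ upE]]] :=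
  conorm_norm_maps two_neq0 ic ioi ioK t2 ioy t0 genS rat_residue.
rewrite (iso_div_irrelevance _ (sgc ic ioi) _ ioK) -upE.
by apply: (proj2 upc); apply: rat_principal => //; apply: (proj1 dnc).
Qed.

(** This lets the multiplicities of the roots of a polynomial be read off from the
    divisor of its value at [x]. *)
Lemma place_above_rational (a : k) : exists (P : place c) (e : int),
  (e = 1 \/ e = 2) /\
  forall m (q : {poly k}), ~~ root q a -> P (ev c x (q * ('X - a%:P) ^+ m)) = e * m%:Z.
Proof.
have [yh free gen] := hyp.
have [io [ioc iox ioy ioK]] := hyper_involution.
have [i [iE ic ioi genS]] := rational_quadratic ioc iox ioy.
have t2 : y ^+ 2 = i (j h) by rewrite iE.
have [Q QE] := rat_finite_place_ex j_eq0 j_gen a.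
have [P [e [[e0 lie] _ ram]]] := conjugate_fibre_everywhere two_neq0 ic ioi ioK t2 ioy
  (hyper_y_neq0 free) genS rat_residue Q.
exists P, e; split; first by case: ram => -[_ ->]; [right | left].
by move=> m q rq; rewrite -iE lie QE.
Qed.
End HyperellipticInvolution.

(** * The two quotients of an even model, and inversion *)

Lemma ev_comp (k K : fieldType) (c : {rmorphism k -> K}) x g q :
  ev c x (g \Po q) = ev c (ev c x q) g.
Proof.
elim/poly_ind: g => [|g a IH]; first by rewrite comp_poly0 !rmorph0.
by rewrite comp_polyD comp_polyM comp_polyX comp_polyC !rmorphD !rmorphM /= IH !evC evX.
Qed.

Lemma iso_div_comp (k A : fieldType) (cA : {rmorphism k -> A})
    (f1 f2 f3 : {rmorphism A -> A}) (c1 : forall a, f1 (cA a) = cA a)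
    (c2 : forall a, f2 (cA a) = cA a) (c3 : forall a, f3 (cA a) = cA a)
    (K1 : involutive f1) (K2 : involutive f2) (K3 : involutive f3) D :
  (forall z, f3 z = f2 (f1 z)) -> iso_div c3 K3 D = iso_div c1 K1 (iso_div c2 K2 D).
Proof.
move=> e; pose g : {additive divisor cA -> divisor cA} :=
  iso_div c1 K1 \o iso_div c2 K2.
apply: (divisor_ext (f := iso_div c3 K3) (g := g)) => P.
rewrite /g /= /iso_div !divisor_mapU; congr << _ >>.
by apply: place_ext => z _ /=; rewrite e.
Qed.

Lemma inversion_id1 (K : fieldType) (x : K) v : x != 0 ->
  x * (x ^+ v.*2.+1 + 1) / (x ^+ v.+1) ^+ 2 = x^-1 ^+ v.*2.+1 + 1.
Proof.
move=> x0; rewrite exprVn -exprM muln2 doubleS !exprS.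
by field; rewrite x0 expf_neq0.
Qed.

Lemma inversion_id2 (K : fieldType) (x : K) v : x != 0 ->
  (x ^+ v.*2.+1 + 1) / (x ^+ v.+1) ^+ 2 = x^-1 * (x^-1 ^+ v.*2.+1 + 1).
Proof.
move=> x0; rewrite exprVn -exprM muln2 doubleS !exprS.
by field; rewrite x0 expf_neq0.
Qed.

Section Decomposition.
Variables (k : closedFieldType) (A B C : fieldType) (p : nat).
Hypotheses (p_prime : prime p) (p_gt2 : (2 < p)%N) (two_neq0 : (2 : k) != 0).
Variables (cA : {rmorphism k -> A}) (cB : {rmorphism k -> B}) (cC : {rmorphism k -> C}).
Variables (xA yA : A) (xB yB : B) (xC yC : C) (h : {poly k}).
Hypothesis hypA : hyperelliptic cA xA yA (h \Po 'X^2).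
Hypothesis hypB : hyperelliptic cB xB yB h.
Hypothesis hypC : hyperelliptic cC xC yC ('X * h).

Let xA0 : xA != 0.
Proof.
have [_ freeA _] := hypA.
by have := hyper_x_free freeA (negbT (polyX_eq0 k)); rewrite evX.
Qed.

Lemma ev_sqr g : ev cA (xA ^+ 2) g = ev cA xA (g \Po 'X^2).
Proof. by rewrite ev_comp rmorphXn /= evX. Qed.

Lemma sqr_free g : g != 0 -> ev cA (xA ^+ 2) g != 0.
Proof.
move=> g0; have [_ freeA _] := hypA; rewrite ev_sqr.
by apply: (hyper_x_free freeA); rewrite comp_poly_eq0 ?size_polyXn.
Qed.

(** [sigma] for [b = false] and [tau] for [b = true]. *)
Lemma sign_automorphism (b : bool) : exists sg : {rmorphism A -> A},
  [/\ forall a, sg (cA a) = cA a, sg xA = - xA, sg yA = (-1) ^+ b * yA & involutive sg].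
Proof.
have [yA2 freeA genA] := hypA.
have evN g : ev cA (- xA) g = ev cA xA (g \Po - 'X).
  by rewrite ev_comp rmorphN /= evX.
have [||sg [sc sx sy]] := hyper_lift yA2 freeA genA (cL := cA) (x' := - xA)
    (y' := (-1) ^+ b * yA).
- by rewrite exprMn sqrr_sign mul1r yA2 !ev_comp !rmorphXn /= !evX sqrrN.
- move=> g g0; rewrite evN; apply: (hyper_x_free freeA).
  by rewrite comp_poly_eq0 // size_polyN size_polyX.
exists sg; split=> //.
have := @hyper_ext _ _ cA xA yA genA A (sg \o sg) idfun; apply=> /=.
- by move=> a; rewrite !sc.
- by rewrite sx rmorphN sx opprK.
- by rewrite sy rmorphM rmorph_sign sy mulrA -expr2 sqrr_sign mul1r.
Qed.

(** The fixed field of an involution with [x |-> -x], generated by [x^2] and a second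
    fixed element [y'], is a hyperelliptic field [E]; the extension is generated by
    [x], a square root of [x^2]. *)
Lemma even_subfield (E : fieldType) (cE : {rmorphism k -> E}) xE yE hE y'
    (sg : {rmorphism A -> A}) (sgc : forall a, sg (cA a) = cA a) (sgK : involutive sg) :
  hyperelliptic cE xE yE hE -> y' ^+ 2 = ev cA (xA ^+ 2) hE ->
  sg xA = - xA -> sg y' = y' ->
  (forall i : {rmorphism E -> A}, i xE = xA ^+ 2 -> i yE = y' ->
     exists a b, yA = i a + i b * xA) ->
  exists (up : {additive divisor cE -> divisor cA})
    (dn : {additive divisor cA -> divisor cE}),
  [/\ class_map up, class_map dn, forall D, dn (up D) = D *+ 2 &
      forall D, up (dn D) = D + iso_div sgc sgK D].
Proof.
move=> hypE y'2 sx sy' gy; have [yA2 freeA genA] := hypA.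
have [yE2 freeE genE] := hypE.
have [i [ic ix iy]] := hyper_lift yE2 freeE genE y'2 sqr_free.
have sgi b : sg (i b) = i b.
  have := @hyper_ext _ _ cE xE yE genE A (sg \o i) i; apply=> /=.
  - by move=> a; rewrite ic sgc.
  - by rewrite ix rmorphXn sx sqrrN.
  - by rewrite iy sy'.
have t2 : xA ^+ 2 = i xE by rewrite ix.
have genS : forall z, exists a b, z = i a + i b * xA.
  apply: (generated_by_quadratic ic sgi t2 sx genA); last exact: gy.
  by exists 0, 1; rewrite rmorph0 rmorph1 mul1r add0r.
have res (Q : place cE) z : z != 0 -> Q z = 0 ->
    exists2 a, a != 0 & vge Q 1 (z - cE a) by apply: hyper_residue hypE.
have [up [dn [upc dnc dnup updn]]] :=
  conorm_norm_maps two_neq0 ic sgi sgK t2 sx xA0 genS res.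
exists up, dn; split=> // D.
by rewrite updn; congr (_ + _); rewrite (iso_div_irrelevance _ sgc _ sgK).
Qed.

(** With [iota = sigma tau], a divisor invariant under one of [sigma] and [tau] is sent
    to its [iota]-conjugate by the other, hence to the opposite class. *)
Theorem torsion_basis_decomposition b m (dB : 'I_b -> divisor cB) (dC : 'I_m -> divisor cC) :
  torsion_basis p dB -> torsion_basis p dC ->
  exists d : 'I_(b + m) -> divisor cA, torsion_basis p d.
Proof.
move=> tB tC; have [yA2 freeA genA] := hypA.
have [sg [sgc sgx sgy sgK]] := sign_automorphism false.
have [tau [tauc taux tauy tauK]] := sign_automorphism true.
rewrite expr0 mul1r in sgy; rewrite expr1 mulN1r in tauy.
have [io [ioc iox ioy ioK]] := hyper_involution hypA.
have [|i _ iy|fB [gB [fBc gBc gfB fgB]]] := @even_subfield _ _ xB yB h yA sg sgc sgK hypB _ sgx sgy.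
- by rewrite yA2 ev_sqr.
- by exists yB, 0; rewrite rmorph0 mul0r addr0 iy.
have [||i ix iy|fC [gC [fCc gCc gfC fgC]]] :=
    @even_subfield _ _ xC yC ('X * h) (xA * yA) tau tauc tauK hypC _ taux.
- by rewrite exprMn yA2 rmorphM /= evX ev_sqr.
- by rewrite rmorphM /= taux tauy mulrNN.
- exists 0, (yC / xC); rewrite rmorph0 add0r fmorph_div /= ix iy.
  by field.
have e1 : forall z, sg z = tau (io z).
  have := @hyper_ext _ _ cA xA yA genA A sg (tau \o io); apply=> /=.
  - by move=> a; rewrite ioc tauc sgc.
  - by rewrite iox taux.
  - by rewrite ioy rmorphN tauy opprK.
have e2 : forall z, tau z = sg (io z).
  have := @hyper_ext _ _ cA xA yA genA A tau (sg \o io); apply=> /=.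
  - by move=> a; rewrite ioc tauc sgc.
  - by rewrite iox sgx.
  - by rewrite ioy rmorphN sgy.
have neg D : deg D = 0 -> principal (D + iso_div ioc ioK D).
  pose j : {rmorphism {poly k} -> {fraction {poly k}}} := @FracField.tofrac _.
  have j_eq0 q : (j q == 0) = (q == 0) by apply: tofrac_eq0.
  have j_gen z : exists a b, b != 0 /\ z = j a / j b by apply: frac_ex.
  exact: (involution_neg two_neq0 j_eq0 j_gen hypA).
exists (fun i : 'I_(b + m) => match split i with inl j => fB (dB j) | inr j => fC (dC j) end).
apply: (torsion_basis_sum p_prime p_gt2 fBc gBc fCc gCc gfB gfC) => //.
- move=> D [dD _]; rewrite fgB (iso_div_comp ioc tauc sgc ioK tauK sgK) //.
  have -> : iso_div tauc tauK (fC D) = fC D.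
    by apply: (addrI (fC D)); rewrite -fgC gfC raddfMn mulr2n.
  by apply: neg; apply: (proj1 fCc).
- move=> D [dD _]; rewrite fgC (iso_div_comp ioc sgc tauc ioK sgK tauK) //.
  have -> : iso_div sgc sgK (fB D) = fB D.
    by apply: (addrI (fB D)); rewrite -fgB gfB raddfMn mulr2n.
  by apply: neg; apply: (proj1 fBc).
move=> D [dD _]; rewrite fgB fgC (iso_div_comp ioc sgc tauc ioK sgK tauK) //.
set S := iso_div sgc sgK D.
have -> : D *+ 2 - (D + S + (D + iso_div ioc ioK S)) = - (S + iso_div ioc ioK S).
  by rewrite addrACA -mulr2n opprD addrA subrr add0r.
have : S + iso_div ioc ioK S \in @principal _ _ cA.
  by apply: neg; apply: (proj1 (iso_div_class_map sgc sgc sgK sgK)).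
by rewrite -rpredN.
Qed.
End Decomposition.

Section Inversion.
Variables (k : closedFieldType) (A C : fieldType) (p v : nat).
Variables (cA : {rmorphism k -> A}) (cC : {rmorphism k -> C}).
Variables (xA yA : A) (xC yC : C).
Let h : {poly k} := 'X ^+ v.*2.+1 + 1.
Hypothesis hypA : hyperelliptic cA xA yA h.
Hypothesis hypC : hyperelliptic cC xC yC ('X * h).

(** The factors [1/x - a] of a polynomial in [1/x] do not vanish. *)
Lemma inv_free (K : fieldType) (c : {rmorphism k -> K}) x :
  (forall g, g != 0 -> ev c x g != 0) -> forall g, g != 0 -> ev c x^-1 g != 0.
Proof.
move=> free g g0; have [rs -> _] := ev_split c x^-1 g.
rewrite mulf_neq0 ?fmorph_eq0 ?lead_coef_eq0 //.
elim/big_ind: _ => [||a _]; first exact: oner_neq0.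
  by move=> *; apply: mulf_neq0.
have x0 : x != 0 by have := free 'X (negbT (polyX_eq0 k)); rewrite evX.
apply/eqP => /eqP; rewrite subr_eq0 => /eqP e.
have := free ('X - a^-1%:P) (negbT (polyXsubC_eq0 _)).
by rewrite rmorphB /= evX evC fmorphV -e invrK subrr eqxx.
Qed.

(** For an odd exponent [2 v + 1], the substitution [(x, y) |-> (1/x, y / x^(v+1))]
    exchanges the two models. *)
Theorem torsion_basis_inversion r (d : 'I_r -> divisor cA) :
  torsion_basis p d -> exists d' : 'I_r -> divisor cC, torsion_basis p d'.
Proof.
have [yA2 freeA genA] := hypA; have [yC2 freeC genC] := hypC.
have fA := hyper_x_free freeA; have fC := hyper_x_free freeC.
have xA0 : xA != 0 by have := fA _ (negbT (polyX_eq0 k)); rewrite evX.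
have xC0 : xC != 0 by have := fC _ (negbT (polyX_eq0 k)); rewrite evX.
have evh (K : fieldType) (c : {rmorphism k -> K}) x :
    ev c x h = x ^+ v.*2.+1 + 1.
  by rewrite /h rmorphD rmorphXn rmorph1 /= evX.
have [||f [fc fx fy]] := hyper_lift yA2 freeA genA (cL := cC) (x' := xC^-1)
    (y' := yC / xC ^+ v.+1).
- rewrite expr_div_n yC2 rmorphM /= evX !evh.
  exact: inversion_id1.
- exact: inv_free.
have [||g [gc gx gy]] := hyper_lift yC2 freeC genC (cL := cA) (x' := xA^-1)
    (y' := yA / xA ^+ v.+1).
- rewrite expr_div_n yA2 rmorphM /= evX !evh.
  exact: inversion_id2.
- exact: inv_free.
apply: (torsion_basis_field_iso (f := f) (g := g)) => //.
  have := @hyper_ext _ _ cC xC yC genC C (f \o g) idfun; apply=> /=.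
  - by move=> a; rewrite gc fc.
  - by rewrite gx fmorphV fx invrK.
  - by rewrite gy fmorph_div rmorphXn /= fx fy exprVn invrK divfK ?expf_neq0.
have := @hyper_ext _ _ cA xA yA genA A (g \o f) idfun; apply=> /=.
- by move=> a; rewrite fc gc.
- by rewrite fx fmorphV gx invrK.
- by rewrite fy fmorph_div rmorphXn /= gx gy exprVn invrK divfK ?expf_neq0.
Qed.
End Inversion.

(** * Derivations in characteristic [p] *)

Lemma pth_powerD (R : comNzRingType) p (u v : R) : p \in [pchar R] ->
  (u + v) ^+ p = u ^+ p + v ^+ p.
Proof.
by move=> pR; have := pFrobenius_autD_comm pR (mulrC u v); rewrite !pFrobenius_autE.
Qed.

Section PthPowers.
Variables (k : closedFieldType) (p : nat).
Hypothesis pcharp : p \in [pchar k].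

Let p_prime : prime p := pcharf_prime pcharp.

Lemma pth_root (a : k) : exists b, b ^+ p = a.
Proof.
have [b] : exists b, root ('X^p - a%:P) b.
  apply/closed_rootP; rewrite size_XnsubC ?prime_gt0 //.
  by rewrite eqSS -lt0n prime_gt0.
by rewrite rootE !hornerE subr_eq0 => /eqP; exists b.
Qed.

Lemma nat_neq0_pchar (R : nzRingType) n : p \in [pchar R] -> (0 < n < p)%N -> (n%:R : R) != 0.
Proof.
move=> pR /andP[n0 np]; rewrite -(dvdn_pcharf pR) gtnNdvd //.
Qed.

(** Only exponents divisible by [p] occur, and the coefficients have [p]-th roots.  The
    induction splits off the constant term and divides the rest by ['X^p]. *)
Lemma deriv0_pth_power (P : {poly k}) : P^`() = 0 -> exists Q, P = Q ^+ p.
Proof.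
have [n] := ubnP (size P); elim: n P => // n IH P szP dP.
have coefP i : P`_i.+1 *+ i.+1 = 0 by rewrite -coef_deriv dP coef0.
have [P1|P1] := leqP (size P) 1.
  have [a ->] : exists a, P = a%:P by exists P`_0; apply: size1_polyC.
  by have [b <-] := pth_root a; exists b%:P; rewrite polyC_exp.
have tP : take_poly p P = (P`_0)%:P.
  apply/polyP=> -[|i]; rewrite coef_take_poly coefC ?prime_gt0 //=.
  case: ifP => // ip; apply/eqP; have /eqP := coefP i.
  by rewrite -mulr_natr mulf_eq0 (negbTE (nat_neq0_pchar pcharp _)) ?orbF ?ip.
have [||R RE] := IH (drop_poly p P).
- rewrite size_drop_poly; have := prime_gt0 p_prime; move: szP P1; zlia.
- apply/polyP=> i; rewrite coef_deriv coef_drop_poly coef0 addSn.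
  have := coefP (i + p)%N; rewrite -addSn mulrnDr.
  by rewrite -[X in _ + X]mulr_natr (pcharf0 pcharp) mulr0 addr0.
have [b bE] := pth_root P`_0.
exists (b%:P + R * 'X).
have pP : p \in [pchar {poly k}] by rewrite pchar_poly.
by rewrite -(poly_take_drop p P) tP RE pth_powerD //
  exprMn -polyC_exp bE.
Qed.
End PthPowers.

Section DerivationPowers.
Variables (K : fieldType) (p : nat) (D : {additive K -> K}).
Hypothesis pcharK : p \in [pchar K].
Hypothesis DM : forall u v, D (u * v) = D u * v + u * D v.

Lemma derivation1 : D 1 = 0.
Proof.
have := DM 1 1; rewrite !mulr1 !mul1r => /eqP.
by rewrite -subr_eq subrr eq_sym => /eqP.
Qed.

Lemma derivationX w n : D (w ^+ n) = (w ^+ n.-1 * D w) *+ n.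
Proof.
elim: n => [|n IH]; first by rewrite expr0 derivation1.
case: n IH => [|n] IH; first by rewrite expr0 mul1r expr1.
by rewrite exprS DM IH mulrnAr mulrA -exprS mulrC -mulrS.
Qed.

Lemma derivation_pth w : D (w ^+ p) = 0.
Proof. by rewrite derivationX (mulrn_pchar pcharK). Qed.

Lemma derivation_mul_pth u w n : iter n D (u * w ^+ p) = iter n D u * w ^+ p.
Proof. by elim: n => //= n ->; rewrite DM derivation_pth mulr0 addr0. Qed.

Lemma iterD0 n : iter n D 0 = 0.
Proof. by elim: n => //= n ->; rewrite raddf0. Qed.

Lemma iterDD n u v : iter n D (u + v) = iter n D u + iter n D v.
Proof. by elim: n => //= n ->; rewrite raddfD. Qed.
End DerivationPowers.

(** Jacobson's formula for the [p]-th iterate of a derivation on an [f] with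
    [D f = w f].  Replacing [w] by [s w], with [s] a polynomial variable, makes
    [D^n f / f] the value at [s = 1] of a polynomial [Q n].  Its derivative in [s] is
    a sum with coefficients ['C(n, j.+1)], so that for [n = p] a single term
    survives and [Q p] can only contain [s] and [s^p]. *)
Section Jacobson.
Variables (K : fieldType) (p : nat) (D : {additive K -> K}).
Hypothesis pcharp : p \in [pchar K].
Hypothesis DM : forall u v, D (u * v) = D u * v + u * D v.

Let p_prime : prime p := pcharf_prime pcharp.

Let D1 : D 1 = 0. Proof. exact: (derivation1 DM). Qed.

Variable w : K.

Let E (q : {poly K}) := map_poly D q + w *: ('X * q).
Let Q n := iter n E 1.

Let E_coef q i : (E q)`_i = D q`_i + w * (if i == 0%N then 0 else q`_i.-1).
Proof. by rewrite coefD coef_map coefZ coefXM. Qed.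

Let ED q r : E (q + r) = E q + E r.
Proof. by rewrite /E raddfD mulrDr scalerDr addrACA. Qed.

Let E0 : E 0 = 0.
Proof. by rewrite /E raddf0 mulr0 scaler0 addr0. Qed.

Let EZ g q : E (g *: q) = D g *: q + g *: E q.
Proof.
apply/polyP=> i; rewrite E_coef coefD !coefZ E_coef DM mulrDr !addrA.
by congr (_ + _); case: eqP => _; rewrite ?mulr0 // ?coefZ mulrCA.
Qed.

Let EMn q n : E (q *+ n) = E q *+ n.
Proof. by elim: n => [|n IH]; rewrite ?mulr0n ?E0 // !mulrS ED IH. Qed.

Let deriv_E q : (E q)^`() = E q^`() + w *: q.
Proof.
apply/polyP=> i; rewrite coef_deriv E_coef coefD E_coef coefZ !coef_deriv /=.
rewrite raddfMn mulrnDl -addrA; congr (_ + _).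
case: i => [|i] /=; first by rewrite mulr0 add0r mulr1n.
by rewrite -mulrDr -mulrSr mulrnAr.
Qed.

Let deriv_Q n : (Q n)^`() =
  \sum_(j < n) (iter j D w *: Q (n - j.+1)) *+ 'C(n, j.+1).
Proof.
elim: n => [|n IH]; first by rewrite big_ord0 /Q /= derivC.
have QS m : Q m.+1 = E (Q m) by [].
rewrite QS deriv_E IH (big_morph E ED E0).
under eq_bigr => j _ do rewrite EMn EZ -QS subnSK // mulrnDl.
rewrite big_split /= -addrA [X in _ + X]addrC.
under [in RHS]eq_bigr => j _ do rewrite binS mulrnDr subSS.
rewrite [in RHS]big_split /= [RHS]addrC addrA; congr (_ + _); last first.
  by rewrite big_ord_recr /= bin_small // mulr0n addr0.
by rewrite big_ord_recl /= bin0 mulr1n subn0 addrC; congr (_ + _).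
Qed.

Let size_Q n : (size (Q n) <= n.+1)%N.
Proof.
apply/leq_sizeP => i; elim: n i => [|n IH] [|i] //= ni.
  by rewrite coefC.
rewrite E_coef /= IH ?raddf0 ?add0r ?IH ?mulr0 //; exact: ltnW.
Qed.

Let coefQn n : (Q n)`_n = w ^+ n.
Proof.
elim: n => [|n IH]; first by rewrite coefC.
have /leq_sizeP/(_ n.+1 (leqnn _)) h := size_Q n.
by rewrite E_coef /= h raddf0 add0r IH exprS.
Qed.

Let coefQ0 n : (0 < n)%N -> (Q n)`_0 = 0.
Proof.
case: n => // n _; elim: n => [|n IH]; rewrite E_coef /= mulr0 addr0.
  by rewrite coefC D1.
by rewrite IH raddf0.
Qed.

Let deriv_Qp : (Q p)^`() = (iter p.-1 D w)%:P.
Proof.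
rewrite deriv_Q; have [q pE] : exists q, p = q.+1.
  by exists p.-1; rewrite prednK // prime_gt0.
rewrite pE big_ord_recr /= big1 => [|j _].
  by rewrite add0r -pE binn subnn mulr1n alg_polyC.
have : (p %| 'C(p, j.+1))%N.
  by apply: prime_dvd_bin; rewrite //= [in X in (_ < X)%N]pE ltnS ltn_ord.
rewrite [in 'C(_, _)]pE.
have pP : p \in [pchar {poly K}] by rewrite pchar_poly.
by case/dvdnP=> m ->; rewrite mulnC mulrnA (mulrn_pchar pP) mul0rn.
Qed.

Let Q1 : (Q p).[1] = iter p.-1 D w + w ^+ p.
Proof.
have p1 := prime_gt1 p_prime.
have -> : Q p = iter p.-1 D w *: 'X + w ^+ p *: 'X^p.
  apply/polyP=> i; rewrite coefD !coefZ coefX coefXn.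
  have [->|i0] := eqVneq i 0%N.
    by rewrite coefQ0 ?prime_gt0 // (ltn_eqF (prime_gt0 p_prime)) !mulr0 addr0.
  have [->|i1] := eqVneq i 1%N.
    rewrite (ltn_eqF p1) mulr0 mulr1 addr0.
    have := congr1 (fun q : {poly K} => q`_0) deriv_Qp.
    by rewrite coef_deriv coefC.
  have [->|ip] := eqVneq i p; first by rewrite mulr0 mulr1 add0r coefQn.
  rewrite !mulr0 addr0; have [ipl|pil] := ltnP i p; last first.
    by have /leq_sizeP -> // := size_Q p; rewrite ltn_neqAle eq_sym ip.
  have := congr1 (fun q : {poly K} => q`_i.-1) deriv_Qp.
  have i_gt0 : (0 < i)%N by rewrite lt0n.
  rewrite coef_deriv coefC prednK //.
  have -> : (i.-1 == 0)%N = false by move: i0 i1; zlia.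
  move=> /eqP; rewrite -mulr_natr mulf_eq0 (negbTE (nat_neq0_pchar pcharp _)) ?i_gt0 //.
  by rewrite orbF => /eqP.
by rewrite hornerD !hornerZ hornerX hornerXn expr1n !mulr1.
Qed.

Theorem jacobson_formula f : D f = w * f ->
  iter p D f = (iter p.-1 D w + w ^+ p) * f.
Proof.
move=> Df; rewrite -Q1; elim: p => [|n IH] /=; first by rewrite hornerC mul1r.
have DE (q : {poly K}) : (map_poly D q).[1] = D q.[1].
  have sz : (size (map_poly D q) <= size q)%N by apply: size_poly.
  rewrite (horner_coef_wide _ sz) horner_coef raddf_sum.
  by apply: eq_bigr => i _; rewrite coef_map /= !expr1n !mulr1.
by rewrite IH DM Df hornerD hornerZ hornerM hornerX mul1r DE mulrDl mulrCA mulrA.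
Qed.
End Jacobson.

(** * The derivation of a hyperelliptic function field *)

Lemma quotient_rule_add (K : fieldType) (n1 n2 d1 d2 c1 c2 e1 e2 : K) :
  c1 != 0 -> c2 != 0 ->
  ((d1 * c2 + n1 * e2 - (d2 * c1 + n2 * e1))
   - (n1 * c2 - n2 * c1) / (c1 * c2) * (e1 * c2 + c1 * e2)) / (c1 * c2) =
  (d1 - n1 / c1 * e1) / c1 - (d2 - n2 / c2 * e2) / c2.
Proof. by move=> *; field; apply/andP. Qed.

Lemma quotient_rule_mul (K : fieldType) (n1 n2 d1 d2 c1 c2 e1 e2 : K) :
  c1 != 0 -> c2 != 0 ->
  ((d1 * n2 + n1 * d2) - n1 * n2 / (c1 * c2) * (e1 * c2 + c1 * e2)) / (c1 * c2) =
  (d1 - n1 / c1 * e1) / c1 * (n2 / c2) + n1 / c1 * ((d2 - n2 / c2 * e2) / c2).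
Proof. by move=> *; field; apply/andP. Qed.

Section HyperellipticDerivation.
Variables (k K : fieldType) (c : {rmorphism k -> K}) (x y : K) (h : {poly k}).
Hypothesis hyp : hyperelliptic c x y h.
Hypothesis two_neq0 : (2 : k) != 0.

Local Notation ev := (ev c x).

Let yh : y ^+ 2 = ev h. Proof. by case: hyp. Qed.
Let free A B : ev A + ev B * y = 0 -> A = 0 /\ B = 0.
Proof. by have [_ f _] := hyp; apply: f. Qed.
Let gen z : exists A B C, C != 0 /\ z = (ev A + ev B * y) / ev C.
Proof. by case: hyp. Qed.
Let ev0 g : g != 0 -> ev g != 0. Proof. exact: (hyper_x_free (@free)). Qed.
Let y0 : y != 0. Proof. exact: (hyper_y_neq0 (@free)). Qed.
Let two0 : (2 : K) != 0. Proof. by rewrite -(rmorph_nat c) fmorph_eq0. Qed.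

Let num A B := ev A + ev B * y.
(* The derivative of [A + B y], as [2 y y' = h'], and the quotient rule. *)
Let delta A B := ev A^`() + (ev B^`() + ev B * (ev h^`() / (2 * y ^+ 2))) * y.
Let dquo A B C := (delta A B - num A B / ev C * ev C^`()) / ev C.

Let deltaD A B A' B' : delta (A + A') (B + B') = delta A B + delta A' B'.
Proof. by rewrite /delta !derivD !rmorphD /=; ring. Qed.

Let deltaN A B : delta (- A) (- B) = - delta A B.
Proof. by rewrite /delta !derivN !rmorphN /=; ring. Qed.

Let deltaC A B C : delta (A * C) (B * C) = delta A B * ev C + num A B * ev C^`().
Proof. by rewrite /delta /num !derivM !rmorphD !rmorphM /=; ring. Qed.

Let deltaM A B A' B' :
  delta (A * A' + B * B' * h) (A * B' + B * A') =
  delta A B * num A' B' + num A B * delta A' B'.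
Proof.
rewrite /delta /num !(derivD, derivM) !(rmorphD, rmorphM) /= -yh.
by field; rewrite y0 two0.
Qed.

Let numM A B A' B' : num (A * A' + B * B' * h) (A * B' + B * A') = num A B * num A' B'.
Proof. by rewrite /num !(rmorphD, rmorphM) /= -yh; ring. Qed.

Let numC A B C : num (A * C) (B * C) = num A B * ev C.
Proof. by rewrite /num !rmorphM /=; ring. Qed.

Let numD A B A' B' : num (A + A') (B + B') = num A B + num A' B'.
Proof. by rewrite /num !rmorphD /=; ring. Qed.

Let numN A B : num (- A) (- B) = - num A B.
Proof. by rewrite /num !rmorphN /=; ring. Qed.

Let num_inj A B A' B' : num A B = num A' B' -> A = A' /\ B = B'.
Proof.
move=> e; have : num (A - A') (B - B') = 0 by rewrite numD numN e subrr.
by move=> /free[/eqP eA /eqP eB]; rewrite !subr_eq0 in eA eB; split; apply/eqP.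
Qed.

Let dquo_eq A B C A' B' C' : C != 0 -> C' != 0 ->
  num A B / ev C = num A' B' / ev C' -> dquo A B C = dquo A' B' C'.
Proof.
move=> C0 C0' e; have eC := ev0 C0; have eC' := ev0 C0'.
have /num_inj[eA eB] : num (A * C') (B * C') = num (A' * C) (B' * C).
  by rewrite !numC; apply/eqP; rewrite -eqr_div // e.
have : delta (A * C') (B * C') = delta (A' * C) (B' * C) by rewrite eA eB.
rewrite !deltaC /dquo -e => ed; apply/eqP; rewrite eqr_div //; apply/eqP.
have n1 : num A B = num A B / ev C * ev C by rewrite divfK.
have n2 : num A' B' = num A B / ev C * ev C' by rewrite e divfK.
move: ed; rewrite n2 {1}n1; set z := num A B / ev C => ed.
rewrite !mulrBl; apply/eqP; rewrite -subr_eq0; apply/eqP.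
set u := delta A B * ev C' in ed *; set v := delta A' B' * ev C in ed *.
have -> : u = v + z * ev C' * ev C^`() - z * ev C * ev C'^`() by rewrite -ed addrK.
by ring.
Qed.

Let quot_ex z : exists t : {poly k} * {poly k} * {poly k},
  t.2 != 0 /\ z = num t.1.1 t.1.2 / ev t.2.
Proof. by have [A [B [C [C0 e]]]] := gen z; exists (A, B, C). Qed.

Let rep z := projT1 (cid (quot_ex z)).
Let der z := dquo (rep z).1.1 (rep z).1.2 (rep z).2.

Let derE A B C : C != 0 -> der (num A B / ev C) = dquo A B C.
Proof.
move=> C0; rewrite /der /rep; case: cid => -[[A' B'] C'] /= [C0' e].
by apply: dquo_eq.
Qed.

Let der_is_zmod_morphism : zmod_morphism der.
Proof.
move=> u v; have [A [B [C [C0 ->]]]] := gen u; have [A' [B' [C' [C0' ->]]]] := gen v.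
rewrite -!/(num _ _); have eC := ev0 C0; have eC' := ev0 C0'.
have -> : num A B / ev C - num A' B' / ev C' =
    num (A * C' - A' * C) (B * C' - B' * C) / ev (C * C').
  by rewrite numD numN !numC -mulNr addf_div // mulNr rmorphM.
rewrite !derE ?mulf_neq0 // /dquo numD numN !numC deltaD deltaN !deltaC.
by rewrite derivM rmorphD !rmorphM /=; apply: quotient_rule_add.
Qed.

Let derM u v : der (u * v) = der u * v + u * der v.
Proof.
have [A [B [C [C0 ->]]]] := gen u; have [A' [B' [C' [C0' ->]]]] := gen v.
rewrite -!/(num _ _); have eC := ev0 C0; have eC' := ev0 C0'.
rewrite mulf_div -numM -rmorphM !derE ?mulf_neq0 // /dquo numM deltaM.
by rewrite derivM rmorphD !rmorphM /=; apply: quotient_rule_mul.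
Qed.

Let der_num A B : der (num A B) = delta A B.
Proof.
have := @derE A B 1 (oner_neq0 _); rewrite rmorph1 divr1 /dquo => ->.
by rewrite -[1]/(1%:P) derivC rmorph0 mulr0 subr0 rmorph1 divr1.
Qed.

(** The extension of [d/dx]. *)
Lemma hyper_derivation : exists D : {additive K -> K},
  [/\ forall u v, D (u * v) = D u * v + u * D v,
      forall g, D (ev g) = ev g^`() & D y = ev h^`() / (2 * ev h) * y].
Proof.
pose m := GRing.isZmodMorphism.Build _ _ der der_is_zmod_morphism.
pose D : {additive K -> K} := HB.pack der m.
exists D; split=> [//|g|].
  have := der_num g 0; rewrite /num /delta deriv0 rmorph0 !mul0r !addr0.
  by rewrite mul0r addr0.
have := der_num 0 1; rewrite /num /delta -[1]/(1%:P) derivC deriv0 rmorph0 rmorph1.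
by rewrite !add0r !mul1r yh.
Qed.
End HyperellipticDerivation.

Lemma clear_denominator_pth (K : fieldType) (a b e y : K) p q :
  p = q.*2.+1 -> e != 0 ->
  (a + b * y) / e * (e ^+ p * (y ^+ 2) ^+ p) =
  a * e ^+ p.-1 * (y ^+ 2) ^+ p + b * e ^+ p.-1 * (y ^+ 2) ^+ q.+1 * y ^+ p.
Proof.
move=> pE e0.
have yE : (y ^+ 2) ^+ q.+1 * y ^+ p = (y ^+ 2) ^+ p * y.
  by rewrite -!exprM -exprSr -exprD; congr (_ ^+ _); rewrite pE; zlia.
have -> : e ^+ p = e * e ^+ p.-1 by rewrite pE -exprS.
by rewrite -[in RHS](mulrA (b * _)) yE; field.
Qed.

Section HyperellipticFrobenius.
Variables (k : closedFieldType) (K : fieldType) (c : {rmorphism k -> K}).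
Variables (x y : K) (h : {poly k}) (p : nat) (D : {additive K -> K}).
Hypotheses (pchark : p \in [pchar k]) (p_odd : odd p).
Hypothesis hyp : hyperelliptic c x y h.
Hypothesis DM : forall u v, D (u * v) = D u * v + u * D v.
Hypothesis Dev : forall g, D (ev c x g) = ev c x g^`().
Local Notation ev := (ev c x).

Let free A B : ev A + ev B * y = 0 -> A = 0 /\ B = 0.
Proof. by have [_ f _] := hyp; apply: f. Qed.
Let y0 : y != 0. Proof. exact: (hyper_y_neq0 (@free)). Qed.

Lemma pcharK : p \in [pchar K].
Proof. by rewrite (fmorph_pchar c). Qed.

(** As [p] is odd, [y] is [y^p] up to a factor in [k(x)], and denominators can be
    turned into [p]-th powers, which are constants for the derivation. *)
Lemma Frobenius_basis z : exists g P Q,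
  g != 0 /\ z * g ^+ p = ev P + ev Q * y ^+ p.
Proof.
have [yh _ gen] := hyp; have [A [B [C [C0 ->]]]] := gen z.
have eC : ev C != 0 := hyper_x_free (@free) C0.
have [q pE] : exists q, p = q.*2.+1.
  by exists p./2; rewrite -[LHS]odd_double_half p_odd.
exists (ev C * y ^+ 2), (A * C ^+ p.-1 * h ^+ p), (B * C ^+ p.-1 * h ^+ q.+1).
rewrite mulf_neq0 ?expf_neq0 //; split=> //.
rewrite !rmorphM /= !rmorphXn /= -yh exprMn.
exact: clear_denominator_pth.
Qed.

(** [d/dx] iterated [p] times vanishes on polynomials, since [p] divides [p!], and
    [p]-th powers are constants. *)
Lemma derivation_iter_pchar z : iter p D z = 0.
Proof.
have [g [P [Q [g0 zE]]]] := Frobenius_basis z.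
have iter_ev n G : iter n D (ev G) = ev G^`(n).
  by elim: n => // n IH; rewrite iterS IH Dev -derivnS.
have evp G : iter p D (ev G) = 0.
  rewrite iter_ev nderivn_def.
  have /dvdnP[m ->] : (p %| p`!)%N.
    by rewrite dvdn_fact // leqnn prime_gt0 ?(pcharf_prime pchark).
  have pP : p \in [pchar {poly k}] by rewrite pchar_poly.
  by rewrite mulnC mulrnA (mulrn_pchar pP) mul0rn rmorph0.
have -> : z = ev P * g^-1 ^+ p + ev Q * (y / g) ^+ p.
  have gp : g ^+ p != 0 by apply: expf_neq0.
  by rewrite -[z](mulfK gp) zE expr_div_n exprVn mulrDl mulrA.
by rewrite iterDD !(derivation_mul_pth pcharK DM) !evp !mul0r addr0.
Qed.

(** In the basis of 1 and [y^p] over [k(x)] the derivation acts on coefficients, where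
    the kernel consists of [p]-th powers. *)
Lemma derivation_kernel z : D z = 0 -> exists w, z = w ^+ p.
Proof.
move=> Dz; have [g [P [Q [g0 zE]]]] := Frobenius_basis z.
have Dp u v : D (u * v ^+ p) = D u * v ^+ p.
  exact: (derivation_mul_pth pcharK DM u v 1).
have := congr1 D zE; rewrite Dp Dz mul0r raddfD /= Dp !Dev.
have [yh _ _] := hyp.
have [q pE] : exists q, p = q.*2.+1.
  by exists p./2; rewrite -[LHS]odd_double_half p_odd.
have -> : y ^+ p = ev (h ^+ q) * y.
  by rewrite rmorphXn /= -yh -exprM mul2n -exprSr pE.
rewrite mulrA -rmorphM => /esym /free[dP /eqP].
have h0 : h != 0.
  by apply: contraNneq (expf_neq0 2 y0) => h0; rewrite yh h0 rmorph0.
rewrite mulf_eq0 (negbTE (expf_neq0 q h0)) orbF => /eqP dQ.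
have [R PE] := deriv0_pth_power pchark dP; have [S QE] := deriv0_pth_power pchark dQ.
exists ((ev R + ev S * y) / g); rewrite expr_div_n.
have gp : g ^+ p != 0 by apply: expf_neq0.
apply: (mulIf gp); rewrite divfK // zE PE QE (pth_powerD _ _ pcharK).
by rewrite exprMn !rmorphXn.
Qed.

Lemma log_derivative_Cartier f w : f != 0 -> D f = w * f ->
  iter p.-1 D w = - w ^+ p.
Proof.
move=> f0 Df; have := jacobson_formula pcharK DM Df.
rewrite derivation_iter_pchar => /esym/eqP; rewrite mulf_eq0 (negbTE f0) orbF.
by rewrite addr_eq0 => /eqP.
Qed.
End HyperellipticFrobenius.

(** Elements on which a constant-linear operator [E] is the negative Frobenius are
    independent over the constants as soon as they are over the prime field.  Logarithmic
    derivatives are such elements, with [E] the [p-1]-st iterate of the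
    derivation, which plays the role of the Cartier operator. *)
Section CartierDependence.
Variables (k : closedFieldType) (K : fieldType) (c : {rmorphism k -> K}) (p : nat).
Hypothesis pchark : p \in [pchar k].
Variable E : K -> K.
Hypothesis E0 : E 0 = 0.
Hypothesis ED : forall u v, E (u + v) = E u + E v.
Hypothesis EZ : forall a u, E (c a * u) = c a * E u.

Let pcharK' : p \in [pchar K]. Proof. by rewrite (fmorph_pchar c). Qed.
Let p_prime : prime p := pcharf_prime pchark.

(** The prime field already provides [p] roots of ['X^p - 'X]. *)
Lemma prime_field_root (a : k) : a ^+ p = a -> exists n : nat, a = n%:R.
Proof.
move=> ap; apply: contrapT => no.
pose P : {poly k} := 'X^p - 'X.
have szP : size P = p.+1.
  by rewrite size_polyDl ?size_polyXn // size_polyN size_polyX ltnS prime_gt1.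
have P0 : P != 0 by rewrite -size_poly_gt0 szP.
pose rs := a :: [seq (n%:R : k) | n <- iota 0 p].
have := @max_poly_roots _ P rs P0; rewrite szP /= size_map size_iota ltnn => H.
suff : false by []; apply: H.
  rewrite /root !hornerE ap subrr eqxx /=.
  apply/allP => _ /mapP[n _ ->]; rewrite /root !hornerE.
  by rewrite -(pFrobenius_autE pchark) pFrobenius_aut_nat subrr.
apply/andP; split; first by apply/mapP => -[n _ e]; apply: no; exists n.
rewrite map_inj_in_uniq ?iota_uniq // => m n; rewrite !mem_iota !add0n /= => mp np.
wlog le : m n mp np / (m <= n)%N.
  by move=> H; case/orP: (leq_total m n) => h e; [|apply/esym]; apply: H.
move=> /eqP; rewrite eq_sym -subr_eq0 -natrB // -(dvdn_pcharf pchark) => d.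
apply/eqP; rewrite eqn_leq le -subn_eq0 /=; apply: contraLR d => nm.
by rewrite gtnNdvd ?lt0n // (leq_ltn_trans (leq_subr _ _)).
Qed.

Lemma pth_powersum r (u : 'I_r -> K) : (\sum_i u i) ^+ p = \sum_i u i ^+ p.
Proof.
rewrite -(pFrobenius_autE pcharK') raddf_sum; apply: eq_bigr => i _.
by rewrite /= pFrobenius_autE.
Qed.

(** Normalize a coefficient to 1.  Applying [E] to the relation and comparing with its
    [p]-th power gives a relation with coefficients [b_i], where [b_i^p = a_i^p - a_i].
    It has smaller support, and it is trivial only if all [a_i] lie in the prime
    field. *)
Theorem Cartier_dependence r (w : 'I_r -> K) (a : 'I_r -> k) j :
  (forall i, E (w i) = - w i ^+ p) -> \sum_i c (a i) * w i = 0 -> a j != 0 ->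
  exists n : 'I_r -> nat, \sum_i w i *+ n i = 0 /\ exists i, ~~ (p %| n i)%N.
Proof.
move=> Ew; have [m] := ubnP #|[pred i | a i != 0]|.
elim: m => // m IH in a j *; rewrite ltnS => card_a rel aj.
wlog aj1 : a card_a rel aj / a j = 1.
  move=> H; apply: (H (fun i => a i / a j)); rewrite ?divff ?oner_neq0 //.
    apply: leq_trans card_a; apply: subset_leq_card; apply/fintype.subsetP=> i.
    by rewrite !inE; apply: contra_neq => ->; rewrite mul0r.
  rewrite (eq_bigr (fun i => c (a j)^-1 * (c (a i) * w i))); last first.
    by move=> i _; rewrite rmorphM; ring.
  by rewrite -mulr_sumr rel mulr0.
have [/forallP ap|] := boolP [forall i, a i ^+ p == a i].
  have /choice[n nE] i : exists n : nat, a i = n%:R by apply/prime_field_root/eqP.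
  exists n; split.
    by rewrite -[RHS]rel; apply: eq_bigr => i _; rewrite nE rmorph_nat mulr_natl.
  by exists j; rewrite (dvdn_pcharf pchark) -nE.
rewrite negb_forall => /existsP[l al].
have /choice[b bE] i : exists b, b ^+ p = a i ^+ p - a i by apply: pth_root.
have b_eq0 i : (b i == 0) = (a i ^+ p == a i).
  by rewrite -[RHS]subr_eq0 -bE expf_eq0 prime_gt0.
apply: (IH b l); last by rewrite b_eq0.
  apply: leq_trans card_a; apply: proper_card; apply/properP; split.
    apply/fintype.subsetP => i; rewrite !inE b_eq0; apply: contraNneq => ->.
    by rewrite expr0n eqn0Ngt prime_gt0.
  by exists j; rewrite !inE ?aj // b_eq0 aj1 expr1n eqxx.
have rel1 : \sum_i c (a i) * w i ^+ p = 0.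
  have := congr1 E rel; rewrite (big_morph E ED E0) E0.
  under eq_bigr => i _ do rewrite EZ Ew mulrN.
  by rewrite sumrN => /eqP; rewrite oppr_eq0 => /eqP.
have rel2 : \sum_i c (a i) ^+ p * w i ^+ p = 0.
  have := congr1 (fun z => z ^+ p) rel; rewrite pth_powersum expr0n eqn0Ngt prime_gt0 //= => e.
  by rewrite -[RHS]e; apply: eq_bigr => i _; rewrite exprMn.
apply/eqP; suff : (\sum_i c (b i) * w i) ^+ p == 0.
  by rewrite expf_eq0 prime_gt0.
rewrite pth_powersum.
apply/eqP; rewrite -[RHS](subrr 0) -[X in _ = X - _]rel2 -[X in _ = _ - X]rel1 -sumrB.
by apply: eq_bigr => i _; rewrite exprMn -mulrBl -!rmorphXn -rmorphB bE.
Qed.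
End CartierDependence.

(** * Polynomials and the multiplicities of their roots *)

Section Multiplicities.
Variable k : closedFieldType.
Implicit Types N Q M : {poly k}.

Lemma multiplicity_coprime M (a b : k) m : a != b ->
  ~~ root M b -> ~~ root (M * ('X - a%:P) ^+ m) b.
Proof.
move=> ab Mb; rewrite rootM negb_or Mb /=; case: m => [|m]; first by rewrite root1.
by rewrite root_exp_XsubC eq_sym.
Qed.

Lemma exists_root N : (1 < size N)%N -> exists a, root N a.
Proof. by move=> sN; apply/closed_rootP; rewrite gtn_eqF. Qed.

Lemma dvdp_by_multiplicity N Q : N != 0 ->
  (forall a m M, ~~ root M a -> N = M * ('X - a%:P) ^+ m -> ('X - a%:P) ^+ m %| Q) ->
  N %| Q.
Proof.
have [n] := ubnP (size N); elim: n N Q => // n IH N Q; rewrite ltnS => sN N0 mult.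
have [s1|] := leqP (size N) 1.
  have e1 : size N = 1%N by apply/eqP; rewrite eqn_leq s1 size_poly_gt0.
  move/eqP: e1 => /size_poly1P[b b0 ->].
  apply/dvdpP; exists (b^-1 *: Q).
  by rewrite mulrC mul_polyC scalerA mulfV // scale1r.
move=> /exists_root[a ra].
have [m [M]] := multiplicity_XsubC N a; rewrite N0 /= => Ma NE.
case: m NE => [|m] NE.
  by move: ra; rewrite NE expr0 mulr1 (negbTE Ma).
have := mult _ _ _ Ma NE; rewrite exprSr => /dvdpP[Q1 QE].
have XaN0 : 'X - a%:P != 0 :> {poly k} by rewrite polyXsubC_eq0.
have N1E : N = M * ('X - a%:P) ^+ m * ('X - a%:P) by rewrite NE exprSr mulrA.
rewrite N1E QE mulrA dvdp_mul2r //.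
apply: IH.
- by move: sN; rewrite N1E size_Mmonic ?monicXsubC ?size_XsubC //; [rewrite addn2|
    apply: contraNneq N0 => e; rewrite N1E e mul0r].
- by apply: contraNneq N0 => e; rewrite N1E e mul0r.
move=> b l L Lb LE; have [eab|nab] := eqVneq a b.
  subst b; have := mult a l.+1 L Lb; rewrite N1E LE -mulrA -exprSr => /(_ erefl).
  by rewrite QE mulrA exprSr dvdp_mul2r.
have := mult b l (L * ('X - a%:P)) (multiplicity_coprime 1 nab Lb).
rewrite N1E LE mulrAC => /(_ erefl); rewrite QE mulrA Gauss_dvdpl //.
by apply: coprimep_expl; rewrite coprimep_XsubC root_XsubC.
Qed.

Lemma deriv0_by_multiplicity p N : p \in [pchar k] -> N != 0 ->
  (forall a m M, ~~ root M a -> N = M * ('X - a%:P) ^+ m -> (p %| m)%N) ->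
  N^`() = 0.
Proof.
move=> pk; have [n] := ubnP (size N); elim: n N => // n IH N; rewrite ltnS => sN N0 mult.
have [s1|] := leqP (size N) 1.
  by have [b ->] : exists b, N = b%:P; [exists N`_0; apply: size1_polyC | apply: derivC].
move=> /exists_root[a ra].
have [m [M]] := multiplicity_XsubC N a; rewrite N0 /= => Ma NE.
have m0 : (0 < m)%N.
  by rewrite lt0n; apply: contraTneq ra => m0; rewrite NE m0 mulr1.
have M0 : M != 0 by apply: contraNneq Ma => ->; rewrite root0.
have dM : M^`() = 0.
  apply: IH => //.
    apply: leq_trans sN; rewrite NE size_Mmonic ?monic_exp ?monicXsubC //.
    by rewrite size_exp_XsubC addnS /= -[X in (X < _)%N]addn0 ltn_add2l.
  move=> b l L Lb LE; have [eab|nab] := eqVneq a b.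
    subst b; case: l LE => // l LE; move: Ma.
    by rewrite LE exprSr mulrA rootM root_XsubC eqxx orbT.
  by apply: (mult b l _ (multiplicity_coprime m nab Lb)); rewrite NE LE mulrAC.
have /dvdnP[q mE] := mult _ _ _ Ma NE.
have pP : p \in [pchar {poly k}] by rewrite pchar_poly.
by rewrite NE derivM dM mul0r add0r deriv_exp mE mulrnA (mulrn_pchar pP) mulr0.
Qed.
End Multiplicities.

Lemma size_wronskian (k : fieldType) (a b g : {poly k}) :
  a != 0 -> b != 0 -> (1 < size g)%N ->
  (size (2 * g * (a * b^`() - a^`() * b) + a * b * g^`())%R
    <= size a + size b + size g - 3)%N.
Proof.
move=> a0 b0 g1; have g0 : g != 0 by rewrite -size_poly_gt0 ltnW.
have a1 : (0 < size a)%N by rewrite size_poly_gt0.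
have b1 : (0 < size b)%N by rewrite size_poly_gt0.
have dA := lt_size_deriv a0; have dB := lt_size_deriv b0.
have dh := lt_size_deriv g0.
have m1 := size_polyMleq a b^`(); have m2 := size_polyMleq a^`() b.
have m3 := size_polyMleq a b; have m4 := size_polyMleq (a * b) g^`().
have m5 : (size (a * b^`() - a^`() * b)%R <= size a + size b - 2)%N.
  rewrite (leq_trans (size_polyD _ _)) // size_polyN geq_max; apply/andP; split.
    by apply: leq_trans m1 _; zlia.
  by apply: leq_trans m2 _; zlia.
have m6 : (size (2 * g)%R <= size g)%N.
  apply: leq_trans (size_polyMleq _ _) _.
  have : (size (2 : {poly k})%R <= 1)%N by rewrite -polyC_natr size_polyC_leq1.
  by zlia.
have m7 := size_polyMleq (2 * g) (a * b^`() - a^`() * b).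
rewrite (leq_trans (size_polyD _ _)) // geq_max; apply/andP; split.
  by apply: leq_trans m7 _; zlia.
by apply: leq_trans m4 _; zlia.
Qed.

(** * Logarithmic derivatives and the finiteness of the torsion *)

Section LogDerivative.
Variables (k : closedFieldType) (K : fieldType) (c : {rmorphism k -> K}).
Variables (x y : K) (h : {poly k}) (p : nat).
Hypotheses (pchark : p \in [pchar k]) (p_gt2 : (2 < p)%N).
Hypothesis hyp : hyperelliptic c x y h.
Hypothesis h_simple : forall a, root h a -> ~~ root h^`() a.
Local Notation ev := (ev c x).

Let p_prime : prime p := pcharf_prime pchark.

Let two_neq0 : (2 : k) != 0.
Proof. by rewrite (nat_neq0_pchar pchark). Qed.

Let free A B : ev A + ev B * y = 0 -> A = 0 /\ B = 0.
Proof. by have [_ f _] := hyp; apply: f. Qed.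

Lemma place_above (a : k) : exists (P : place c) (e : int),
  (e = 1 \/ e = 2) /\
  forall m (q : {poly k}), ~~ root q a -> P (ev (q * ('X - a%:P) ^+ m)) = e * m%:Z.
Proof.
pose j : {rmorphism {poly k} -> {fraction {poly k}}} := @FracField.tofrac _.
have j_eq0 q : (j q == 0) = (q == 0) by apply: tofrac_eq0.
have j_gen z : exists a b, b != 0 /\ z = j a / j b by apply: frac_ex.
exact: (place_above_rational two_neq0 j_eq0 j_gen hyp).
Qed.

(** Ramification does not disturb divisibility by the odd prime [p]. *)
Lemma dvdn_ramified (e n : int) (m : nat) : e = 1 \/ e = 2 ->
  e * m%:Z = n * p%:Z -> (p %| m)%N.
Proof.
move=> e12 en; suff : (p %| m.*2)%N.
  rewrite -muln2 Gauss_dvdl // prime_coprime // gtnNdvd //.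
have [n' n'E] : exists n' : int, m.*2%:Z = n' * p%:Z.
  by case: e12 en => -> en; [exists (2 * n) | exists n]; zlia.
have : (p%:Z %| m.*2%:Z)%Z by rewrite n'E dvdz_mull.
by rewrite dvdzE.
Qed.

(** The functions whose divisor is [p] times a divisor. *)
Definition pth_divisible (f : K) := forall P : place c, exists n, P f = n * p%:Z.

Lemma pth_divisibleM f g : f != 0 -> g != 0 ->
  pth_divisible f -> pth_divisible g -> pth_divisible (f * g).
Proof.
move=> f0 g0 hf hg P; have [n nE] := hf P; have [m mE] := hg P.
by exists (n + m); rewrite valM // nE mE mulrDl.
Qed.

Lemma pth_divisibleX g : pth_divisible (g ^+ p).
Proof. by move=> P; exists (P g); rewrite valX; zlia. Qed.

Section Numerator.
Variables (A B : {poly k}).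
Let f := ev A + ev B * y.
Hypothesis f0 : f != 0.
Hypothesis f_div : pth_divisible f.

Let N := A ^+ 2 - B ^+ 2 * h.
Let yh : y ^+ 2 = ev h. Proof. by case: hyp. Qed.
Let N0 : N != 0. Proof. exact: hyper_norm_neq0 yh (@free) _ _ f0. Qed.

Let evN : ev N = f * (ev A - ev B * y).
Proof. by rewrite rmorphB !expr2 !rmorphM /= -yh /f; ring. Qed.

Lemma conj_pth_divisible : pth_divisible (ev A - ev B * y).
Proof.
move=> P; have [io [ioc iox ioy ioK]] := hyper_involution hyp.
have [n nE] := f_div (pull_place ioc ioK P); exists n.
rewrite -nE /= /f rmorphD rmorphM /= !(ev_rmorph _ _ ioc) iox ioy.
by rewrite mulrN.
Qed.

Let conj0 : ev A - ev B * y != 0. Proof. exact: hyper_conj_neq0 (@free) _ _ f0. Qed.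

(** The norm is a polynomial in [x] all of whose roots have multiplicity divisible
    by [p]. *)
Lemma norm_deriv0 : N^`() = 0.
Proof.
apply: (deriv0_by_multiplicity pchark N0) => a m M Ma NE.
have [P [e [e12 PE]]] := place_above a.
have [n nE] := f_div P; have [n' n'E] := conj_pth_divisible P.
apply: (dvdn_ramified (n := n + n') e12).
by rewrite -(PE m M) // -NE evN valM // nE n'E mulrDl.
Qed.

(* [N] is [G^2 M0], with [M0] the norm of the primitive part [A0 + B0 y].  The
   logarithmic derivative of [f] is [Q0 / M0] times [y / (2 h)], plus half that of
   [N], which is 0; it remains to see that [M0] divides [Q0]. *)
Let G := gcdp A B.
Let A0 := A %/ G.
Let B0 := B %/ G.
Let M0 := A0 ^+ 2 - B0 ^+ 2 * h.
Let Q0 := 2 * h * (A0 * B0^`() - A0^`() * B0) + A0 * B0 * h^`().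

Let G_neq0 : G != 0.
Proof.
rewrite gcdp_eq0 negb_and; case: eqVneq => //= A00; apply: contraNneq f0 => B00.
by rewrite /f A00 B00 rmorph0 mul0r addr0.
Qed.

Let AE : A = A0 * G. Proof. by rewrite divpK ?dvdp_gcdl. Qed.
Let BE : B = B0 * G. Proof. by rewrite divpK ?dvdp_gcdr. Qed.

Let NE : N = G ^+ 2 * M0.
Proof. by rewrite /N /M0 {1}AE {1}BE; ring. Qed.

Let M0_neq0 : M0 != 0.
Proof. by apply: contraNneq N0 => e; rewrite NE e mulr0. Qed.

Let no_common_root a : root A0 a -> root B0 a -> False.
Proof.
have : coprimep A0 B0.
  apply: coprimep_div_gcd; rewrite -negb_and; apply/negP => /andP[/eqP A00 /eqP B00].
  by move: f0; rewrite /f A00 B00 rmorph0 mul0r addr0 eqxx.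
by move=> /coprimep_root h1 rA rB; have := h1 _ rA; rewrite -rootE rB.
Qed.

Let identity : B0 * Q0 = 2 * A0^`() * M0 - A0 * M0^`().
Proof.
rewrite /Q0 /M0 derivB derivM !expr2 !derivM; ring.
Qed.

Let evf0 : f = ev G * (ev A0 + ev B0 * y).
Proof. by rewrite /f {1}AE {1}BE !rmorphM /=; ring. Qed.

Let root_M0 a : root M0 a -> ~~ root B0 a.
Proof.
move=> rM; apply/negP => rB; apply: (@no_common_root a) => //.
move: rM; rewrite rootE /M0 !expr2 hornerD hornerN !hornerM.
by rewrite (eqP rB) !mul0r subr0 mulf_eq0 orbb.
Qed.

(* At a point where [y] does not vanish only one of the two conjugate factors of
   the primitive norm is non-unit, so the multiplicity of the norm there inherits
   divisibility by [p]. *)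
Let mult_unramified a m M : ~~ root h a -> ~~ root M a ->
  M0 = M * ('X - a%:P) ^+ m -> (p %| m)%N.
Proof.
move=> ha Ma M0E; have [P [e [e12 PE]]] := place_above a.
have e0 : 0 < e by case: e12 => ->.
have ge0 q : vge P 0 (ev q).
  have [->|q0] := eqVneq q 0; first by rewrite rmorph0 vge0.
  have [l [q' q'E qE]] := multiplicity_XsubC q a; rewrite q0 /= in q'E.
  by rewrite qE /vge PE //; apply/orP; right; znia.
have unit q : vge P 1 (ev q) -> root q a.
  move=> v; apply: contraT => qa; have := PE 0%N _ qa.
  rewrite expr0 mulr1 mulr0 => e1; move: v; rewrite vgeE ?e1 //.
  by apply: (hyper_x_free (@free)); apply: contraNneq qa => ->; rewrite root0.
have Py : P y = 0.
  have := PE 0%N _ ha; rewrite expr0 mulr1 mulr0 -yh valX; zlia.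
have vy : vge P 0 y by rewrite -Py vge_val.
have half z : vge P 1 (2 * z) -> vge P 1 z.
  have [->|z0] := eqVneq z 0; first by rewrite vge0.
  have t0 : (2 : K) != 0 by rewrite -(rmorph_nat c) fmorph_eq0.
  rewrite !vgeE ?mulf_neq0 // valM // -[2](rmorph_nat c) (place_valC P two_neq0).
  by rewrite add0r.
set u := ev A0 + ev B0 * y; set v := ev A0 - ev B0 * y.
have fE : f = ev G * u by exact: evf0.
have vE : ev A - ev B * y = ev G * v.
  by rewrite /v {1}AE {1}BE !rmorphM /=; ring.
have uvE : ev M0 = u * v by rewrite rmorphB !expr2 !rmorphM /= -yh /u /v; ring.
have G0 : ev G != 0 by apply: (hyper_x_free (@free)).
have u0 : u != 0 by apply: contraNneq f0 => e1; rewrite fE e1 mulr0.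
have v0 : v != 0 by apply: contraNneq conj0 => e1; rewrite vE e1 mulr0.
have uge : vge P 0 u by apply: vgeD => //; apply: vgeM0.
have vge' : vge P 0 v by apply: vgeB => //; apply: vgeM0.
have [n nE] := f_div P; have [n' n'E] := conj_pth_divisible P.
rewrite fE valM // in nE; rewrite vE valM // in n'E.
have Puv : e * m%:Z = P u + P v by rewrite -(PE m M) // -M0E uvE valM.
have [Pu|Pv] : P u = 0 \/ P v = 0.
  have [u1|/unit_val-/(_ uge)[_]] := boolP (vge P 1 u); last by left.
  have [v1|/unit_val-/(_ vge')[_]] := boolP (vge P 1 v); last by right.
  exfalso; apply: (@no_common_root a); apply: unit; apply: half.
    have -> : 2 * ev A0 = u + v by rewrite /u /v; ring.
    exact: vgeD.
  have -> : 2 * ev B0 = y^-1 * (u - v).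
    by rewrite /u /v; field; apply: (hyper_y_neq0 (@free)).
  apply: vgeM0; last exact: vgeB.
  by rewrite vgeE ?invr_eq0 ?(hyper_y_neq0 (@free)) // valV Py.
- apply: (dvdn_ramified (n := n' - n) e12); rewrite Puv Pu mulrBl -nE -n'E Pu.
  by zlia.
- apply: (dvdn_ramified (n := n - n') e12); rewrite Puv Pv mulrBl -nE -n'E Pv.
  by zlia.
Qed.

(* At a root of [h] the norm [M0] has at most a simple root, as [h] has simple roots,
   and [Q0] vanishes.  At other points the multiplicity is divisible by [p], so that
   the derivative of [M0] vanishes to the same order, and the identity above applies. *)
Let M0_dvd : M0 %| Q0.
Proof.
apply: (dvdp_by_multiplicity M0_neq0) => a m M Ma M0E.
case: m M0E => [|m] M0E; first by rewrite expr0 dvd1p.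
have rM0 : root M0 a by rewrite M0E rootM root_exp_XsubC eqxx orbT.
have [ha|ha] := boolP (root h a).
  have rA : root A0 a.
    move: rM0; rewrite rootE /M0 !expr2 hornerD hornerN !hornerM.
    by rewrite (eqP ha) mulr0 subr0 mulf_eq0 orbb.
  have rB : B0.[a] != 0 := root_M0 rM0.
  have -> : m = 0%N.
    case: m M0E => // m M0E; exfalso; have := h_simple ha; apply/negP; rewrite negbK.
    have : root M0^`() a.
      have -> : M0 = M * ('X - a%:P) ^+ m * ('X - a%:P) * ('X - a%:P).
        by rewrite M0E 2!exprSr !mulrA.
      by rewrite derivM rootE hornerD !hornerM !hornerXsubC subrr !(mulr0, mul0r) addr0.
    rewrite /M0 derivB derivM !expr2 !derivM !rootE !hornerE.
    rewrite (eqP rA) (eqP ha) !(mulr0, mul0r, add0r, sub0r, addr0) oppr_eq0.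
    by rewrite !mulf_eq0 (negbTE rB).
  rewrite expr1 dvdp_XsubCl rootE /Q0 !hornerE (eqP ha) (eqP rA).
  by rewrite !(mulr0, mul0r, addr0).
have /dvdnP[q mE] := mult_unramified ha Ma M0E.
have dM0 : ('X - a%:P) ^+ m.+1 %| M0^`().
  have pP : p \in [pchar {poly k}] by rewrite pchar_poly.
  have d0 : (('X - a%:P) ^+ m.+1)^`() = 0.
    by rewrite deriv_exp mE mulrnA (mulrn_pchar pP).
  by rewrite M0E derivM d0 mulr0 addr0; apply: dvdp_mull.
have : ('X - a%:P) ^+ m.+1 %| B0 * Q0.
  by rewrite identity dvdp_sub // dvdp_mull // M0E dvdp_mull.
rewrite Gauss_dvdpr //; apply: coprimep_expl; rewrite coprimep_sym coprimep_XsubC.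
exact: root_M0.
Qed.

Let S := Q0 %/ M0.
Let QS : Q0 = S * M0. Proof. by rewrite divpK. Qed.

(* The two terms of [M0] have degrees of different parity, so they cannot cancel. *)
Lemma log_size : ~~ odd (size h) -> (size S <= size h)%N.
Proof.
move=> h_even; have [->|S0] := eqVneq S 0; first by rewrite size_poly0.
have Q0_neq0 : Q0 != 0 by rewrite QS mulf_neq0.
have A00 : A0 != 0.
  by apply: contraNneq Q0_neq0 => e; rewrite /Q0 e deriv0 !mul0r subrr mulr0 add0r.
have B00 : B0 != 0.
  by apply: contraNneq Q0_neq0 => e; rewrite /Q0 e deriv0 !mulr0 mul0r subrr mulr0 add0r.
have h0 : h != 0.
  apply: contraNneq (expf_neq0 2 (hyper_y_neq0 (@free))) => e.
  by rewrite yh e rmorph0.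
have sA2 : size (A0 ^+ 2) = (size A0).*2.-1 by rewrite expr2 size_mul // addnn.
have sB2 : size (B0 ^+ 2 * h) = ((size B0).*2.-1 + size h).-1.
  by rewrite size_mul ?expf_neq0 // expr2 size_mul // addnn.
have a1 : (0 < size A0)%N by rewrite size_poly_gt0.
have b1 : (0 < size B0)%N by rewrite size_poly_gt0.
have h1 : (0 < size h)%N by rewrite size_poly_gt0.
have h_gt1 : (1 < size h)%N by move: h_even h1; zlia.
have sM : (maxn (size A0).*2.-1 ((size B0).*2.-1 + size h).-1 <= size M0)%N.
  have : size (A0 ^+ 2) != size (B0 ^+ 2 * h).
    by rewrite sA2 sB2; move: h_even a1 b1 h1; zlia.
  rewrite -sA2 -sB2 /M0; case: (ltngtP (size (A0 ^+ 2))) => // lt _.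
    by rewrite addrC size_polyDl size_polyN.
  by rewrite size_polyDl ?size_polyN.
have sQ : (size Q0 <= size A0 + size B0 + size h - 3)%N.
  by apply: size_wronskian; rewrite // (leq_trans _ h_gt1).
have := size_mul S0 M0_neq0; rewrite -QS => sE.
have s1 : (0 < size S)%N by rewrite size_poly_gt0.
rewrite sE in sQ; move: sQ sM; rewrite geq_max.
move: (size S) (size M0) (size A0) (size B0) (size h) s1 a1 b1 h1 => s n a b e.
by clear; move=> s1 a1 b1 e1 sQ /andP[n1 n2]; lia.
Qed.

Lemma log_derivative_num (D : {additive K -> K}) :
  (forall u v, D (u * v) = D u * v + u * D v) ->
  (forall g, D (ev g) = ev g^`()) -> D y = ev h^`() / (2 * ev h) * y ->
  2 * ev h * D f = ev S * y * f.
Proof.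
move=> DM Dev Dy; apply: (mulIf conj0).
have y0 := hyper_y_neq0 (@free).
have t0 : (2 : K) != 0 by rewrite -(rmorph_nat c) fmorph_eq0.
have Df : 2 * ev h * D f = 2 * ev h * ev A^`() +
    (2 * ev h * ev B^`() + ev B * ev h^`()) * y.
  rewrite /f raddfD /= DM !Dev Dy -yh; field; by rewrite t0 y0.
pose Q := 2 * h * (A * B^`() - A^`() * B) + A * B * h^`().
have QE : Q = S * N.
  have -> : Q = G ^+ 2 * Q0.
    have id (a b g : {poly k}) :
        2 * h * (a * g * (b * g)^`() - (a * g)^`() * (b * g)) + a * g * (b * g) * h^`()
        = g ^+ 2 * (2 * h * (a * b^`() - a^`() * b) + a * b * h^`()).
      by rewrite !derivM; ring.
    by rewrite /Q0 -id -AE -BE.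
  by rewrite QS NE; ring.
have : ev Q * y + ev h * ev N^`() = ev S * y * ev N.
  by rewrite norm_deriv0 rmorph0 mulr0 addr0 QE rmorphM; ring.
have eQ : ev Q = 2 * ev h * (ev A * ev B^`() - ev A^`() * ev B) +
    ev A * ev B * ev h^`() by rewrite /Q; ring.
have eN : ev N^`() = 2 * ev A * ev A^`() - 2 * ev B * ev B^`() * y ^+ 2
    - ev B ^+ 2 * ev h^`().
  by rewrite yh /N derivB derivM !expr2 !derivM; ring.
rewrite evN mulrA => <-; rewrite Df eQ eN -!yh; ring.
Qed.

Lemma log_derivative_num_ex (D : {additive K -> K}) : ~~ odd (size h) ->
  (forall u v, D (u * v) = D u * v + u * D v) ->
  (forall g, D (ev g) = ev g^`()) -> D y = ev h^`() / (2 * ev h) * y ->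
  exists2 T : {poly k}, (size T <= size h)%N & 2 * ev h * D f = ev T * y * f.
Proof.
by move=> he DM Dev Dy; exists S; [apply: log_size | apply: log_derivative_num].
Qed.
End Numerator.

(** A function becomes a numerator [A + B y] after multiplication with the [p]-th power
    of its denominator, which does not change the logarithmic derivative. *)
Lemma log_derivative_ex (D : {additive K -> K}) f : ~~ odd (size h) ->
  (forall u v, D (u * v) = D u * v + u * D v) ->
  (forall g, D (ev g) = ev g^`()) -> D y = ev h^`() / (2 * ev h) * y ->
  f != 0 -> pth_divisible f ->
  exists2 T : {poly k}, (size T <= size h)%N & 2 * ev h * D f = ev T * y * f.
Proof.
move=> he DM Dev Dy f0 fdiv.
have pcharK' : p \in [pchar K] by rewrite (fmorph_pchar c).
have [_ _ gen] := hyp; have [A [B [C [C0 fE]]]] := gen f.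
have eC : ev C != 0 := hyper_x_free (@free) C0.
have fC : f * ev C ^+ p = ev (A * C ^+ p.-1) + ev (B * C ^+ p.-1) * y.
  rewrite fE !rmorphM /= rmorphXn /= -[X in _ ^+ X](prednK (prime_gt0 p_prime)) exprS.
  by field.
have Cp0 : ev C ^+ p != 0 by apply: expf_neq0.
have [||T sT TE] := @log_derivative_num_ex (A * C ^+ p.-1) (B * C ^+ p.-1) _ _ D he DM Dev Dy.
- by rewrite -fC mulf_neq0.
- by rewrite -fC; apply: pth_divisibleM => //; apply: pth_divisibleX.
exists T => //; apply: (mulIf Cp0).
have Dp : D (f * ev C ^+ p) = D f * ev C ^+ p.
  exact: (derivation_mul_pth pcharK' DM f (ev C) 1).
transitivity (2 * ev h * D (f * ev C ^+ p)); first by rewrite Dp /=; ring.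
by rewrite fC TE -fC /=; ring.
Qed.

(** The polynomials [T i] of the logarithmic derivatives live in a space of dimension
    [size h]. *)
Theorem torsion_rank_bound r (d : 'I_r -> divisor c) : ~~ odd (size h) ->
  (forall i, torsion p (d i)) -> independent p d -> (r <= size h)%N.
Proof.
move=> he dT dI; rewrite leqNgt; apply/negP => r_gt.
have [D [DM Dev Dy]] := hyper_derivation hyp two_neq0.
have pK : p \in [pchar K] by rewrite (fmorph_pchar c).
have [yh _ _] := hyp.
have y0 := hyper_y_neq0 (@free).
have two0 : (2 : K) != 0 by rewrite -(rmorph_nat c) fmorph_eq0.
have eh0 : 2 * ev h != 0 by rewrite mulf_neq0 // -yh expf_neq0.
have /choice[f fP] i : exists f, f != 0 /\ forall P : place c, coeff P (d i) *+ p = P f.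
  have [_ /asboolP[f f0 fd]] := dT i.
  by exists f; split=> // P; rewrite -fd coeffMn.
have /choice[T TP] i : exists T : {poly k}, (size T <= size h)%N /\
    2 * ev h * D (f i) = ev T * y * f i.
  have [fi0 fd] := fP i.
  have [T sT TE] : exists2 T : {poly k}, (size T <= size h)%N &
      2 * ev h * D (f i) = ev T * y * f i; last by exists T.
  apply: log_derivative_ex => // P; exists (coeff P (d i)).
  by rewrite -fd; zlia.
pose w i := ev (T i) * y / (2 * ev h).
have Df i : D (f i) = w i * f i.
  by apply: (mulfI eh0); rewrite (TP i).2 /w; move: (2 * ev h) eh0 => e e0; field.
pose M : 'M[k]_(r, size h) := \matrix_(i, j) (T i)`_j.
have [a0 aM aM0] : exists2 v : 'rV[k]_r, v != 0 & v *m M = 0.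
  have /rowV0Pn[v vM v0] : kermx M != 0.
    rewrite -mxrank_eq0 mxrank_ker subn_eq0 -ltnNge.
    by rewrite (leq_ltn_trans (rank_leq_col M)).
  by exists v => //; apply/sub_kermxP.
pose a i := a0 ord0 i.
have [j aj] : exists j, a j != 0.
  apply: contrapT => no; move/eqP: aM; apply; apply/rowP => i; rewrite mxE.
  by apply/eqP; apply: contraT => h1; case: no; exists i.
have relT : \sum_i a i *: T i = 0.
  apply/polyP => l; rewrite coef0 coef_sum; have [lh|hl] := ltnP l (size h).
    have := congr1 (fun v : 'rV_(size h) => v ord0 (Ordinal lh)) aM0.
    rewrite !mxE => e; rewrite -[RHS]e.
    by apply: eq_bigr => i _; rewrite coefZ mxE.
  rewrite big1 // => i _; rewrite coefZ nth_default ?mulr0 //.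
  exact: leq_trans (TP i).1 hl.
have rel : \sum_i c (a i) * w i = 0.
  transitivity (ev (\sum_i a i *: T i) * y / (2 * ev h)).
    rewrite rmorph_sum !mulr_suml; apply: eq_bigr => i _.
    by rewrite -mul_polyC rmorphM /= evC /w !mulrA.
  by rewrite relT rmorph0 !mul0r.
have Dc b : D (c b) = 0 by rewrite -(evC c x) Dev derivC rmorph0.
have EZ b u : iter p.-1 D (c b * u) = c b * iter p.-1 D u.
  by elim: p.-1 => //= n ->; rewrite DM Dc mul0r add0r.
have Ew i : iter p.-1 D (w i) = - w i ^+ p.
  apply: (log_derivative_Cartier pchark _ hyp DM Dev (fP i).1 (Df i)).
  by case: (even_prime p_prime) p_gt2 => [->|].
have [n [nw [l ln]]] := Cartier_dependence pchark (iterD0 D p.-1) (iterDD D p.-1) EZ Ew rel aj.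
(* The relation over the prime field makes the logarithmic derivative of [F] vanish. *)
pose F := \prod_i f i ^+ n i.
have F0 : F != 0 by apply/prodf_neq0 => i _; rewrite expf_neq0 ?(fP i).1.
have DF : D F = (\sum_i w i *+ n i) * F.
  rewrite /F; apply: (big_ind2 (fun u v => D u = v * u)) => [|u v u' v' e e'|i _].
  - by rewrite (derivation1 DM) mul0r.
  - by rewrite DM e e'; ring.
  rewrite (derivationX DM) Df; case: (n i) => [|m]; first by rewrite !mulr0n mul0r.
  by rewrite /= exprSr mulrnAl mulrCA.
have [g gE] : exists g, F = g ^+ p.
  apply: (derivation_kernel pchark _ hyp DM Dev); last by rewrite DF nw mul0r.
  by case: (even_prime p_prime) p_gt2 => [->|].
have g0 : g != 0 by apply: contraNneq F0 => e; rewrite gE e expr0n gtn_eqF // prime_gt0.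
have prF (P : place c) : P F = \sum_i P (f i) *+ n i.
  suff [] : F != 0 /\ P F = \sum_i P (f i) *+ n i by [].
  rewrite /F; apply: (big_ind2 (fun u v => u != 0 /\ P u = v)).
  - by rewrite oner_neq0 place_val1.
  - by move=> u v u' v' [u0 <-] [u0' <-]; rewrite mulf_neq0 // valM.
  - by move=> i _; rewrite expf_neq0 ?(fP i).1 // valX.
have /dI /(_ l) : \sum_i d i *+ n i \in @principal _ _ c.
  apply/asboolP; exists g => // P.
  have p0 : (p%:Z : int) != 0 by have := prime_gt0 p_prime; zlia.
  apply: (mulIf p0); have := valX P g p; rewrite -gE prF -[RHS]mulr_natr.
  rewrite natz => <-; rewrite raddf_sum /= mulr_suml; apply: eq_bigr => i _.
  by rewrite raddfMn /= -(fP i).2 -[coeff P (d i) *+ p]mulr_natr natz mulrnAl.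
by move=> pn; rewrite pn in ln.
Qed.
End LogDerivative.

(** * The curves F_n and H_n *)

Section Fermat.
Variables (k : closedFieldType) (p : nat).
Hypotheses (pchark : p \in [pchar k]) (p_gt2 : (2 < p)%N).

Let p_prime : prime p := pcharf_prime pchark.

Definition fermat_poly N : {poly k} := 'X ^+ N + 1.

Lemma fermat_simple_root N a : (0 < N)%N -> coprime N p ->
  root (fermat_poly N) a -> a != 0 /\ ~~ root (fermat_poly N)^`() a.
Proof.
move=> N0 Np; rewrite /fermat_poly rootE hornerD hornerXn hornerC => /eqP e.
have a0 : a != 0.
  by apply/eqP => a0; move/eqP: e; rewrite a0 expr0n gtn_eqF // add0r oner_eq0.
split=> //; rewrite rootE derivD derivXn derivC addr0 hornerMn hornerXn.
rewrite -mulr_natr mulf_neq0 ?expf_neq0 // -(dvdn_pcharf pchark).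
by rewrite -prime_coprime // coprime_sym.
Qed.

Lemma fermat_twist_simple_root N a : (0 < N)%N -> coprime N p ->
  root ('X * fermat_poly N) a -> ~~ root ('X * fermat_poly N)^`() a.
Proof.
move=> N0 Np; rewrite rootM rootX derivM derivX mul1r.
case/orP => [/eqP ->|ra]; rewrite rootE hornerD hornerM hornerX.
  by rewrite mul0r addr0 /fermat_poly hornerD hornerXn hornerC expr0n gtn_eqF //
    add0r oner_neq0.
have [a0] := fermat_simple_root N0 Np ra; rewrite rootE => d0.
by rewrite (eqP ra) add0r mulf_neq0.
Qed.

Lemma fermat_poly_comp N : fermat_poly (2 * N) = fermat_poly N \Po 'X^2.
Proof. by rewrite /fermat_poly rmorphD rmorphXn /= comp_polyX comp_polyC exprM. Qed.

Lemma size_fermat_poly N : (0 < N)%N -> size (fermat_poly N) = N.+1.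
Proof. by move=> N0; rewrite size_polyDl size_polyXn ?size_poly1. Qed.

(** The size of [h] is one more than its degree, which is therefore odd. *)
Lemma odd_model_basis (K : fieldType) (c : {rmorphism k -> K}) x y h :
  hyperelliptic c x y h -> (forall a, root h a -> ~~ root h^`() a) ->
  ~~ odd (size h) -> exists r (d : 'I_r -> divisor c), torsion_basis p d.
Proof.
move=> hyp hs he; apply: (bounded_torsion_basis p_prime (m := size h)) => r d.
exact: (torsion_rank_bound pchark p_gt2 hyp hs he).
Qed.

Lemma function_field_curve (h : {poly k}) E (X : function_field E) :
  E = hyper_eq h -> hyperelliptic (ff_const X) (ff_x X) (ff_y X) h.
Proof. by move=> e; subst E; apply: function_field_hyper. Qed.

Lemma fermat_poly_map N : (fermat_poly N) ^:P = 'X ^+ N + 1.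
Proof. by rewrite rmorphD rmorph1 /= map_polyXn. Qed.

Lemma eqF_hyper_eq u n : eqF k u n = hyper_eq (fermat_poly (2 ^ n * u)).
Proof. by rewrite /eqF /hyper_eq fermat_poly_map. Qed.

Lemma eqH_hyper_eq u n : eqH k u n = hyper_eq ('X * fermat_poly (2 ^ n * u)).
Proof. by rewrite /eqH /hyper_eq rmorphM /= map_polyX fermat_poly_map. Qed.
End Fermat.

Theorem corollary3p6 (p u : nat)
    (p_prime : prime p) (p_gt2 : (2 < p)%N)
    (u_gt0 : (0 < u)%N) (u_odd : odd u) (u_p : coprime u p)
    (* k is an algebraic closure of F_p *)
    (k : closedFieldType) (iota : {rmorphism 'F_p -> k})
    (iota_alg : integralRange iota)
    (F : forall n : nat, function_field (eqF k u n))
    (H : forall n : nat, function_field (eqH k u n)) :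
  [/\ prank p (F 0%N) = prank p (H 0%N),
      forall n : nat, (1 <= n)%N ->
        (prank p (H n.-1))%:Z = (prank p (F n))%:Z - (prank p (F n.-1))%:Z,
      forall n : nat, (1 <= n)%N ->
        prank p (F n) = (prank p (F 0%N) + \sum_(0 <= i < n) prank p (H i))%N
    & prank p (F 1%N) = (2 * prank p (F 0%N))%N].
Proof.
have pchark : p \in [pchar k] by rewrite (fmorph_pchar iota) pchar_Fp.
have two_neq0 : (2 : k) != 0 by rewrite (nat_neq0_pchar pchark).
pose N n := (2 ^ n * u)%N.
have N_gt0 n : (0 < N n)%N by rewrite muln_gt0 expn_gt0.
have N_p n : coprime (N n) p.
  rewrite coprimeMl u_p andbT coprime_sym coprimeXr // prime_coprime //.
  by rewrite dvdn_prime2 // gtn_eqF.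
have hypF n : hyperelliptic (ff_const (F n)) (ff_x (F n)) (ff_y (F n)) (fermat_poly k (N n)).
  by apply: function_field_curve; apply: eqF_hyper_eq.
have hypH n : hyperelliptic (ff_const (H n)) (ff_x (H n)) (ff_y (H n))
    ('X * fermat_poly k (N n)).
  by apply: function_field_curve; apply: eqH_hyper_eq.
pose rank (K : fieldType) (c : {rmorphism k -> K}) r :=
  exists d : 'I_r -> divisor c, torsion_basis p d.
have [rF0 [dF0 bF0]] : exists r, rank _ (ff_const (F 0%N)) r.
  apply: (odd_model_basis pchark p_gt2 (hypF 0%N)).
    by move=> a ra; case: (fermat_simple_root pchark (N_gt0 0%N) (N_p 0%N) ra).
  by rewrite size_fermat_poly // /N expn0 mul1n /= u_odd.
have rH0 : rank _ (ff_const (H 0%N)) rF0.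
  have uE : N 0%N = (u./2).*2.+1 by rewrite /N expn0 mul1n -[LHS]odd_double_half u_odd.
  have hF := hypF 0%N; have hH := hypH 0%N; rewrite uE in hF hH.
  exact: (torsion_basis_inversion hF hH bF0).
have rH n : exists r, rank _ (ff_const (H n)) r.
  case: n => [|n]; first by exists rF0.
  apply: (odd_model_basis pchark p_gt2 (hypH n.+1)).
    by move=> a; apply: (fermat_twist_simple_root pchark (N_gt0 n.+1) (N_p n.+1)).
  rewrite size_mul ?polyX_eq0 //; last by rewrite -size_poly_gt0 size_fermat_poly.
  by rewrite size_polyX size_fermat_poly // /N expnS -mulnA mul2n /= odd_double.
have rFS n rf rh : rank _ (ff_const (F n)) rf -> rank _ (ff_const (H n)) rh ->
    rank _ (ff_const (F n.+1)) (rf + rh)%N.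
  move=> [dF bF] [dH bH].
  have hA := hypF n.+1; rewrite {1}/N expnS -mulnA fermat_poly_comp in hA.
  exact: (torsion_basis_decomposition p_prime p_gt2 two_neq0 hA (hypF n) (hypH n) bF bH).
have rF n : exists r, rank _ (ff_const (F n)) r.
  elim: n => [|n [r rr]]; first by exists rF0; exists dF0.
  by have [s rs] := rH n; exists (r + s)%N; apply: rFS.
have rankE (K : fieldType) (c : {rmorphism k -> K}) r : rank K c r -> prank_of c p = r.
  by move=> [d bd]; apply: torsion_basis_prank bd.
have step n : prank p (F n.+1) = (prank p (F n) + prank p (H n))%N.
  have [r rr] := rF n; have [s rs] := rH n.
  by rewrite /prank (rankE _ _ _ rr) (rankE _ _ _ rs) (rankE _ _ _ (rFS _ _ _ rr rs)).
have first : prank p (F 0%N) = prank p (H 0%N).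
  by rewrite /prank (rankE _ _ _ rH0); apply: rankE; exists dF0.
split=> //.
- by case=> // n _; rewrite step PoszD [X in X - _]addrC addrK.
- case=> // n _; elim: n => [|n IH]; first by rewrite big_nat1 step.
  by rewrite big_nat_recr //= addnA -IH step.
- by rewrite step first mul2n addnn.
Qed.
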